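(* Let $r\ge1$ be an integer, $a>0$, $w_1,\dots,w_r>0$ real, and let $r-1<\sigma_1<\sigma_2$ and $C>1$. Then for $x\ge 1$ and every $s=\sigma+it\in\mathbb{C}$ with $\sigma_1<\sigma<\sigma_2$ and $|t|\le 2\pi x/C$, \[ \zeta_r(s,a,\mathbf{w})=\sum_{0\le m_1\le x}\cdots\sum_{0\le m_r\le x}\frac{1}{(a+\mathbf{m}\cdot\mathbf{w})^{s}} -\sum_{\substack{I\subseteq\{1,\dots,r\}\\ I\neq\emptyset}}(-1)^{\# I}\,\frac{\bigl(a+x\sum_{i\in I}w_i\bigr)^{r-s}}{(s-1)(s-2)\cdots(s-r)\,w_1\cdots w_r}+O(x^{r-1-\sigma}) \] as $x\to\infty$ (the $m_i$ run over integers).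
   Context: For $\mathbf{m}=(m_1,\dots,m_r)\in\mathbb{Z}_{\ge0}^r$ write $\mathbf{m}\cdot\mathbf{w}=m_1w_1+\cdots+m_rw_r$. The Barnes multiple zeta function is \[ \zeta_r(s,a,\mathbf{w})=\sum_{m_1,\dots,m_r\ge 0}\frac{1}{(a+\mathbf{m}\cdot\mathbf{w})^s}, \] absolutely convergent for $\mathrm{Re}(s)>r$ and meromorphically continued to $\mathbb{C}$ (simple poles at $s=1,\dots,r$). Complex powers use the principal branch (bases are positive reals). The implied constant may depend on $r,a,\mathbf{w},\sigma_1,\sigma_2,C$ but not on $x$ or $t$. *)

(* Defs.v *)
From Stdlib Require Import Reals ZArith.
From Coquelicot Require Import Coquelicot.
Open Scope R_scope.

Definition cexp (z : C) : C :=
  (exp (Re z) * cos (Im z), exp (Re z) * sin (Im z)).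

Definition cpow (b : R) (s : C) : C := cexp (Cmult s (RtoC (ln b))).

Definition floor_nat (x : R) : nat := Z.to_nat (Int_part x).

(* box_sum w r N F = sum over (m_0,...,m_{r-1}) in {0,...,N}^r of F(m_0 w_0 + ... + m_{r-1} w_{r-1}) *)
Fixpoint box_sum (w : nat -> R) (r N : nat) (F : R -> C) : C :=
  match r with
  | O => F 0
  | S r' => sum_n (fun m : nat => box_sum w r' N (fun u => F (u + INR m * w r'))) N
  end.

(* subset_sum w r F = sum over subsets I of {0,...,r-1} of F (#I) (sum_{i in I} w_i) *)
Fixpoint subset_sum (w : nat -> R) (r : nat) (F : nat -> R -> C) : C :=
  match r with
  | O => F O 0
  | S r' => Cplus (subset_sum w r' F) (subset_sum w r' (fun k u => F (S k) (u + w r')))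
  end.

Fixpoint poch (r : nat) (s : C) : C :=
  match r with
  | O => RtoC 1
  | S r' => Cmult (poch r' s) (Cminus s (RtoC (INR (S r'))))
  end.

Fixpoint wprod (w : nat -> R) (r : nat) : R :=
  match r with
  | O => 1
  | S r' => wprod w r' * w r'
  end.

Definition barnes_box (r : nat) (a : R) (w : nat -> R) (s : C) (N : nat) : C :=
  box_sum w r N (fun u => cpow (a + u) (Copp s)).

(* Z is the Barnes zeta function zeta_r(., a, w) on the half-plane Re s > r - 1
   (minus the poles 1..r): Z is complex-differentiable there and coincides with
   the (absolutely convergent) defining series for Re s > r.  By uniqueness of
   analytic continuation (the domain is connected) this determines Z there. *)
Definition is_barnes_zeta_cont (r : nat) (a : R) (w : nat -> R) (Z : C -> C) : Prop :=
  (forall s : C, INR r - 1 < Re s ->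
     (forall k : nat, (1 <= k <= r)%nat -> s <> RtoC (INR k)) ->
     @ex_derive C_AbsRing C_NormedModule Z s) /\
  (forall s : C, INR r < Re s ->
     filterlim (barnes_box r a w s) eventually (locally (Z s))).

Definition corr_term (r : nat) (a : R) (w : nat -> R) (x : R) (s : C) : C :=
  subset_sum w r (fun k u =>
    match k with
    | O => RtoC 0
    | S _ => Cdiv (Cmult (RtoC ((-1) ^ k)) (cpow (a + x * u) (Cminus (RtoC (INR r)) s)))
                  (Cmult (poch r s) (RtoC (wprod w r)))
    end).

(* Main.v *)
(* Write f(b) = b^(-z) and J_w f(b) = b^(1-z) / ((z-1) w), the tail integral of f in steps of w.
   With P_N = (box sum over m_i < N) - (correction term at N), everything follows from
   |P_M - P_N| <= K N^(r-1-sigma) for N <= M, once zeta = lim P_M is known.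

   Passing from N to M one coordinate at a time, the difference is a sum of box sums having
   one coordinate in [N, M), and there |t| w_i / (a + N w_i) <= 2 pi / C < 2 pi.  In that
   coordinate G = f q - J_w f, where q = 1/(e^l - 1) - 1/l at l = - i t w / b, satisfies
   G(b + w) - G(b) = f(b) + O(b^(-sigma-1)), so the sum is the integral up to O(b^(-sigma)).
   The integral carries a factor 1/(z - 1), which absorbs the factor |z| lost in the other
   coordinates, where f(b) = J_w f(b) - J_w f(b + w) + O(|z| b^(-sigma-1)) suffices.

   For Re s > r the hypothesis on zeta gives zeta = lim P_M.  To continue the identity to the
   left, integrate (zeta - P_M) exp(n cosh(mu (s - s0))) around a long rectangle whose left
   side is centred at s0 and whose right side lies in Re s > r; by Goursat the integral
   vanishes, while for large n the kernel concentrates at s0 on the left side and has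
   modulus 1 on the horizontal sides. *)

Require Import Defs.
From Stdlib Require Import Reals ZArith Lra Lia List Permutation.
From Stdlib Require Import FunctionalExtensionality ClassicalEpsilon.
From Coquelicot Require Import Coquelicot.
Open Scope R_scope.

(** * The complex exponential along real curves *)

(** Every constant has to be uniform both as [t] grows with [x] and as [s] approaches [r], the only
    pole that the strip can contain. The coordinates cannot be treated alike: with coordinate [i] in
    [[N, M)], the frequency in another direction [j] is only known to be at most
    [(2 pi / C) w_j / w_i], which may exceed [2 pi], so the sharp comparison is available in
    direction [i] alone. Near [s = r] the correction terms at [N] and at [M] are unbounded
    separately, so only differences are estimated. The continuation meets another obstacle: the
    limit of [P_N] is merely a locally uniform limit of differentiable functions. The kernel is
    therefore applied to approximants, and these are chosen after [n], so close to the limit that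
    the size of the kernel on the right side does no harm. A rectangle reaching right from a real
    point could run through the poles; real points are recovered by continuity. *)

Lemma Cmod_sqr (z : C) : Cmod z * Cmod z = Re z * Re z + Im z * Im z.
Proof. generalize (Cmod2_alt z); simpl; lra. Qed.

Lemma Re_le_Cmod_r (z : C) : Re z <= Cmod z.
Proof. apply Rle_trans with (2 := re_le_Cmod z), Rle_abs. Qed.

Lemma Im_le_Cmod (z : C) : Rabs (Im z) <= Cmod z.
Proof. apply Rle_trans with (2 := Rmax_Cmod z), Rmax_r. Qed.

Lemma Cmod_le_Re_Im (z : C) : Cmod z <= Rabs (Re z) + Rabs (Im z).
Proof.
  assert (H := Cmod_sqr z); assert (H0 := Cmod_ge_0 z).
  assert (H1 := Rabs_pos (Re z)); assert (H2 := Rabs_pos (Im z)).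
  assert (H3 : Re z * Re z = Rabs (Re z) * Rabs (Re z)) by (rewrite <- Rabs_mult, Rabs_right; nra).
  assert (H4 : Im z * Im z = Rabs (Im z) * Rabs (Im z)) by (rewrite <- Rabs_mult, Rabs_right; nra).
  nra.
Qed.

Lemma Cmod_minus_sym (x y : C) : Cmod (x - y) = Cmod (y - x).
Proof. rewrite <- (Cmod_opp (x - y)); f_equal; ring. Qed.

Lemma Cmod_minus_le (x y : C) : Cmod (x - y) <= Cmod x + Cmod y.
Proof. unfold Cminus; rewrite <- (Cmod_opp y); apply Cmod_triangle. Qed.

Definition cder (g : R -> C) (v : R) (l : C) : Prop :=
  is_derive (fun u => Re (g u)) v (Re l) /\ is_derive (fun u => Im (g u)) v (Im l).

Lemma cder_eq (g : R -> C) (v : R) (l l' : C) : cder g v l -> l = l' -> cder g v l'.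
Proof. now intros H <-. Qed.

Lemma cder_const (c : C) (v : R) : cder (fun _ => c) v 0.
Proof. split; apply @is_derive_const. Qed.

Lemma cder_minus (f g : R -> C) (v : R) (l k : C) :
  cder f v l -> cder g v k -> cder (fun u => f u - g u)%C v (l - k)%C.
Proof. intros [H1 H2] [H3 H4]; split; now apply @is_derive_minus. Qed.

Lemma cder_scal (c : C) (g : R -> C) (v : R) (l : C) :
  cder g v l -> cder (fun u => c * g u)%C v (c * l)%C.
Proof.
  intros [H1 H2]; split; simpl.
  - apply @is_derive_minus; apply is_derive_scal; assumption.
  - apply @is_derive_plus; apply is_derive_scal; assumption.
Qed.

Lemma cder_linear (c : C) (v : R) : cder (fun u => c * RtoC u)%C v c.
Proof.
  split; simpl; auto_derive; auto; unfold Re, Im; ring.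
Qed.

Lemma cder_cexp (z : C) (h : R -> R) (v dh : R) :
  is_derive h v dh ->
  cder (fun u => cexp (z * RtoC (h u))) v (z * RtoC dh * cexp (z * RtoC (h v)))%C.
Proof.
  intros H.
  assert (Hex : ex_derive h v) by now exists dh.
  assert (HD : Derive (fun x : R => h x) v = dh) by now apply is_derive_unique.
  assert (Hre : forall u, Re (z * RtoC (h u)) = Re z * h u) by (intros; apply re_scal_r).
  assert (Him : forall u, Im (z * RtoC (h u)) = Im z * h u) by (intros; apply im_scal_r).
  split; unfold cexp.
  - apply is_derive_ext with (fun u => exp (Re z * h u) * cos (Im z * h u)).
    { intros u; rewrite <- Hre, <- Him; reflexivity. }
    auto_derive; [now repeat split|].
    rewrite HD, Hre, Him, re_mult, re_scal_r, im_scal_r; simpl.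
    ring.
  - apply is_derive_ext with (fun u => exp (Re z * h u) * sin (Im z * h u)).
    { intros u; rewrite <- Hre, <- Him; reflexivity. }
    auto_derive; [now repeat split|].
    rewrite HD, Hre, Him, im_mult, re_scal_r, im_scal_r; simpl.
    ring.
Qed.

(** Project onto the chord [u = g 1 - g 0]: the real mean value theorem for the inner product of [u]
    with [g], followed by Cauchy-Schwarz, gives [|u|^2 <= |u| M]. *)
Lemma curve_mvt (g dg : R -> C) (M : R) :
  (forall v, 0 <= v <= 1 -> cder g v (dg v)) ->
  (forall v, 0 <= v <= 1 -> Cmod (dg v) <= M) ->
  Cmod (g 1 - g 0) <= M.
Proof.
  intros Hd HM.
  set (u := (g 1 - g 0)%C).
  set (p := fun v => Re u * Re (g v) + Im u * Im (g v)).
  set (dp := fun v => Re u * Re (dg v) + Im u * Im (dg v)).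
  assert (Hp : forall v, 0 <= v <= 1 -> is_derive p v (dp v)).
  { intros v Hv; destruct (Hd v Hv) as [H1 H2].
    apply @is_derive_plus; apply is_derive_scal; assumption. }
  destruct (MVT_gen p 0 1 dp) as [c [Hc Hc']].
  - intros v Hv; rewrite Rmin_left, Rmax_right in Hv by lra; apply Hp; lra.
  - intros v Hv; rewrite Rmin_left, Rmax_right in Hv by lra.
    apply derivable_continuous_pt; exists (dp v); apply is_derive_Reals, Hp; lra.
  - rewrite Rmin_left, Rmax_right in Hc by lra.
    assert (Hu : p 1 - p 0 = Cmod u * Cmod u).
    { rewrite Cmod_sqr; unfold p, u, Cminus; rewrite !re_plus, !im_plus, !re_opp, !im_opp; ring. }
    assert (Hcs : dp c <= Cmod u * Cmod (dg c)).
    { rewrite <- (Cmod_conj u), <- Cmod_mult.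
      apply Rle_trans with (2 := Re_le_Cmod_r _).
      rewrite re_mult, re_conj, im_conj; unfold dp; lra. }
    assert (HMc := HM c Hc); assert (H0 := Cmod_ge_0 u); assert (H1 := Cmod_ge_0 (dg c)).
    destruct (Rle_lt_or_eq_dec _ _ H0) as [Hpos|Hz]; [|rewrite <- Hz; lra].
    apply Rmult_le_reg_l with (Cmod u); nra.
Qed.

Lemma Cmod_cexp (z : C) : Cmod (cexp z) = exp (Re z).
Proof.
  assert (H := Cmod_sqr (cexp z)); assert (H0 := Cmod_ge_0 (cexp z)).
  assert (He := exp_pos (Re z)).
  unfold cexp in H; simpl in H.
  assert (Hs := sin2_cos2 (Im z)); unfold Rsqr in Hs.
  fold (cexp z) in H.
  assert (H2 : Cmod (cexp z) * Cmod (cexp z) = exp (Re z) * exp (Re z)) by nra.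
  nra.
Qed.

Lemma cexp_plus (x y : C) : cexp (x + y) = (cexp x * cexp y)%C.
Proof.
  unfold cexp; rewrite re_plus, im_plus, exp_plus, cos_plus, sin_plus.
  apply injective_projections; simpl; ring.
Qed.

Lemma cexp_0 : cexp 0 = 1.
Proof. unfold cexp; simpl; rewrite exp_0, cos_0, sin_0, Rmult_1_r, Rmult_0_r; reflexivity. Qed.

Lemma cexp_neq_0 (z : C) : cexp z <> 0.
Proof. apply Cmod_gt_0; rewrite Cmod_cexp; apply exp_pos. Qed.

Lemma exp_le_mono (x y : R) : x <= y -> exp x <= exp y.
Proof.
  intros H; destruct (Rle_lt_or_eq_dec _ _ H) as [L|<-]; [left; now apply exp_increasing|lra].
Qed.

(** The segment from [B] to [A] stays in the left half-plane, where [cexp] has modulus at most 1. *)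
Lemma cexp_lipschitz (A B : C) :
  Re A <= 0 -> Re B <= 0 -> Cmod (cexp A - cexp B) <= Cmod (A - B).
Proof.
  intros HA HB.
  replace (cexp A - cexp B)%C
    with (cexp B * cexp ((A - B) * RtoC 1) - cexp B * cexp ((A - B) * RtoC 0))%C.
  2: { rewrite Cmult_0_r, cexp_0, Cmult_1_r, <- cexp_plus, Cmult_1_r; f_equal; f_equal; ring. }
  apply (curve_mvt (fun v => cexp B * cexp ((A - B) * RtoC v))%C
           (fun v => cexp B * ((A - B) * RtoC 1 * cexp ((A - B) * RtoC v)))%C).
  - intros v _; apply cder_scal, (cder_cexp _ (fun u => u)), @is_derive_id.
  - intros v Hv; rewrite !Cmod_mult, Cmod_1, !Cmod_cexp, re_scal_r.
    rewrite <- (Rmult_1_r (Cmod (A - B))) at 2.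
    replace (exp (Re B) * (Cmod (A - B) * 1 * exp (Re (A - B) * v)))
      with (Cmod (A - B) * (exp (Re B) * exp (Re (A - B) * v))) by ring.
    apply Rmult_le_compat_l; [apply Cmod_ge_0|].
    rewrite <- exp_plus, <- exp_0; unfold Cminus; rewrite re_plus, re_opp.
    apply exp_le_mono; nra.
Qed.

Lemma cexp_minus_1 (z : C) : Cmod (cexp z - 1) <= Cmod z * exp (Cmod z).
Proof.
  replace (cexp z - 1)%C with (cexp (z * RtoC 1) - cexp (z * RtoC 0))%C
    by now rewrite Cmult_0_r, cexp_0, Cmult_1_r.
  apply (curve_mvt (fun v => cexp (z * RtoC v)) (fun v => z * RtoC 1 * cexp (z * RtoC v))%C).
  - intros v _; apply (cder_cexp _ (fun u => u)), @is_derive_id.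
  - intros v Hv; rewrite !Cmod_mult, Cmod_1, Cmod_cexp, re_scal_r, Rmult_1_r.
    apply Rmult_le_compat_l; [apply Cmod_ge_0|].
    apply exp_le_mono; assert (H1 := Re_le_Cmod_r z); assert (H2 := Cmod_ge_0 z); nra.
Qed.

Lemma cexp_minus_1_minus_id (z : C) :
  Cmod (cexp z - 1 - z) <= Cmod z * (Cmod z * exp (Cmod z)).
Proof.
  replace (cexp z - 1 - z)%C
    with ((cexp (z * RtoC 1) - z * RtoC 1) - (cexp (z * RtoC 0) - z * RtoC 0))%C
    by (rewrite !Cmult_0_r, cexp_0, Cmult_1_r; ring).
  apply (curve_mvt (fun v => cexp (z * RtoC v) - z * RtoC v)%C
           (fun v => z * RtoC 1 * cexp (z * RtoC v) - z)%C).
  - intros v _; apply cder_minus; [apply (cder_cexp _ (fun u => u)), @is_derive_id|].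
    apply cder_linear.
  - intros v Hv.
    replace (z * RtoC 1 * cexp (z * RtoC v) - z)%C with (z * (cexp (z * RtoC v) - 1))%C by ring.
    rewrite Cmod_mult; apply Rmult_le_compat_l; [apply Cmod_ge_0|].
    apply Rle_trans with (1 := cexp_minus_1 _).
    assert (H0 := Cmod_ge_0 z).
    assert (H : Cmod (z * RtoC v) <= Cmod z)
      by (rewrite Cmod_mult, Cmod_R, Rabs_right by lra; nra).
    apply Rmult_le_compat; [apply Cmod_ge_0|left; apply exp_pos|exact H|now apply exp_le_mono].
Qed.

(** * Complex powers of positive reals *)

Lemma Cmod_cpow (b : R) (z : C) : Cmod (cpow b z) = Rpower b (Re z).
Proof. unfold cpow; now rewrite Cmod_cexp, re_scal_r. Qed.

Lemma cpow_plus (b : R) (x y : C) : cpow b (x + y) = (cpow b x * cpow b y)%C.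
Proof. unfold cpow; rewrite Cmult_plus_distr_r; apply cexp_plus. Qed.

Lemma cpow_1 (b : R) : 0 < b -> cpow b 1 = b.
Proof.
  intros Hb; unfold cpow, cexp; rewrite Cmult_1_l; simpl.
  rewrite exp_ln, cos_0, sin_0 by exact Hb; unfold RtoC; f_equal; ring.
Qed.

Lemma cpow_ratio (b c : R) (z : C) :
  0 < b -> 0 < c -> cpow c z = (cpow b z * cexp (z * RtoC (ln (c / b))))%C.
Proof.
  intros Hb Hc; unfold cpow; rewrite <- cexp_plus; f_equal.
  rewrite ln_div, RtoC_minus by assumption; ring.
Qed.

Lemma cder_cpow (b w v : R) (z : C) :
  0 < b + v * w ->
  cder (fun u => cpow (b + u * w) z) v (z * RtoC w * cpow (b + v * w) (z - 1))%C.
Proof.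
  intros H.
  apply cder_eq with (z * RtoC (w / (b + v * w)) * cexp (z * RtoC (ln (b + v * w))))%C.
  - apply (cder_cexp z (fun u => ln (b + u * w))).
    auto_derive; [exact H|field; lra].
  - fold (cpow (b + v * w) z).
    replace z with ((z - 1) + 1)%C at 2 by ring.
    rewrite cpow_plus, cpow_1, RtoC_div by lra.
    field; intros E; injection E; lra.
Qed.

(** * Sums of powers in one direction *)

Fixpoint csum (F : nat -> C) (n : nat) : C :=
  match n with
  | O => 0
  | S n' => (csum F n' + F n')%C
  end.

Lemma sum_n_csum (F : nat -> C) (n : nat) : sum_n F n = csum F (S n).
Proof.
  induction n as [|n IH].
  - rewrite sum_O; simpl; now rewrite Cplus_0_l.
  - rewrite sum_Sn, IH; reflexivity.
Qed.

Lemma csum_ext (F G : nat -> C) (n : nat) :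
  (forall m, (m < n)%nat -> F m = G m) -> csum F n = csum G n.
Proof.
  induction n as [|n IH]; intros H; simpl; [reflexivity|].
  rewrite IH, H; auto.
Qed.

Lemma csum_plus (F G : nat -> C) (n : nat) :
  csum (fun m => F m + G m)%C n = (csum F n + csum G n)%C.
Proof. induction n as [|n IH]; simpl; [ring|rewrite IH; ring]. Qed.

Lemma csum_add (F : nat -> C) (n k : nat) :
  csum F (n + k) = (csum F n + csum (fun m => F (n + m)%nat) k)%C.
Proof.
  induction k as [|k IH]; simpl.
  - rewrite Nat.add_0_r; ring.
  - rewrite Nat.add_succ_r; simpl; rewrite IH; ring.
Qed.

Lemma csum_exchange (F : nat -> nat -> C) (n k : nat) :
  csum (fun i => csum (F i) k) n = csum (fun j => csum (fun i => F i j) n) k.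
Proof.
  induction n as [|n IH]; simpl.
  - induction k as [|k IHk]; simpl; [reflexivity|rewrite <- IHk; ring].
  - rewrite IH, <- csum_plus; reflexivity.
Qed.

Lemma csum_telescope (G : nat -> C) (n : nat) :
  csum (fun m => G m - G (S m))%C n = (G O - G n)%C.
Proof. induction n as [|n IH]; simpl; [ring|rewrite IH; ring]. Qed.

Lemma Rpower_pos (x y : R) : 0 < Rpower x y.
Proof. apply exp_pos. Qed.

Lemma Rpower_decr (x y p : R) : 0 < x -> x <= y -> p <= 0 -> Rpower y p <= Rpower x p.
Proof.
  intros Hx Hxy Hp; unfold Rpower; apply exp_le_mono.
  assert (ln x <= ln y) by (destruct (Req_dec x y) as [->|]; [lra|left; apply ln_increasing; lra]).
  nra.
Qed.

Lemma Rpower_minus_1 (x p : R) : 0 < x -> Rpower x p = x * Rpower x (p - 1).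
Proof.
  intros Hx; rewrite <- (Rpower_1 x) at 2 by exact Hx.
  rewrite <- Rpower_plus; f_equal; ring.
Qed.

(** One step of the integral test; [dlt] stands in for [p - 1] to keep the bound uniform in the
    exponent. *)
Lemma Rpower_step (b w p dlt : R) :
  0 < b -> 0 < w -> 0 < dlt -> 1 + dlt <= p ->
  dlt * w * Rpower (b + w) (- p) <= Rpower b (1 - p) - Rpower (b + w) (1 - p).
Proof.
  intros Hb Hw Hd Hp.
  destruct (MVT_gen (fun x => Rpower x (1 - p)) b (b + w) (fun x => (1 - p) * Rpower x (- p)))
    as [c [Hc E]].
  - intros x Hx; rewrite Rmin_left, Rmax_right in Hx by lra.
    unfold Rpower; auto_derive; [lra|].
    fold (Rpower x (1 - p)) (Rpower x (- p)).
    rewrite (Rpower_minus_1 x (1 - p)) by lra.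
    replace (1 - p - 1) with (- p) by ring; field; lra.
  - intros x Hx; rewrite Rmin_left, Rmax_right in Hx by lra.
    apply derivable_continuous_pt; exists ((1 - p) * Rpower x (- p)); apply is_derive_Reals.
    unfold Rpower; auto_derive; [lra|].
    fold (Rpower x (1 - p)) (Rpower x (- p)).
    rewrite (Rpower_minus_1 x (1 - p)) by lra.
    replace (1 - p - 1) with (- p) by ring; field; lra.
  - rewrite Rmin_left, Rmax_right in Hc by lra.
    assert (H := Rpower_decr c (b + w) (- p) ltac:(lra) ltac:(lra) ltac:(lra)).
    assert (H0 := Rpower_pos (b + w) (- p)).
    replace (b + w - b) with w in E by ring.
    assert (dlt * w * Rpower (b + w) (- p) <= (p - 1) * w * Rpower c (- p)); [|lra].
    apply Rmult_le_compat; nra.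
Qed.

(** Relative to [b^(1-p)], the first summand of a power sum costs at most [/ b0] and the integral of
    the rest at most [/ (dlt * w0)]. *)
Definition psumK (b0 w0 dlt : R) : R := / b0 + / (dlt * w0).

Lemma psumK_pos (b0 w0 dlt : R) : 0 < b0 -> 0 < w0 -> 0 < dlt -> 0 < psumK b0 w0 dlt.
Proof.
  intros; unfold psumK; apply Rplus_lt_0_compat; apply Rinv_0_lt_compat; nra.
Qed.

Lemma csum_power_bound (b0 w0 dlt b w p A : R) (F : nat -> C) (n : nat) :
  0 < b0 -> 0 < w0 -> 0 < dlt -> b0 <= b -> w0 <= w -> 1 + dlt <= p -> 0 <= A ->
  (forall m, Cmod (F m) <= A * Rpower (b + INR m * w) (- p)) ->
  Cmod (csum F n) <= A * psumK b0 w0 dlt * Rpower b (1 - p).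
Proof.
  intros Hb0 Hw0 Hd Hb Hw Hp HA HF.
  (* The integral over a step dominates only the value at its right end; the extra summand [x^(-p)]
     of [Phi] pays for the left end, so that the sum telescopes. *)
  set (Phi := fun x => Rpower x (- p) + Rpower x (1 - p) / (dlt * w)).
  assert (Hpos : 0 < dlt * w) by nra.
  assert (Hstep : forall x, 0 < x -> Rpower x (- p) <= Phi x - Phi (x + w)).
  { intros x Hx; unfold Phi.
    assert (H := Rpower_step x w p dlt Hx ltac:(lra) Hd Hp).
    assert (H1 : Rpower (x + w) (- p) <= (Rpower x (1 - p) - Rpower (x + w) (1 - p)) / (dlt * w))
      by (apply Rle_div_r; lra).
    unfold Rdiv in *; rewrite Rmult_minus_distr_r in H1; lra. }
  assert (Hsum : forall k, Cmod (csum F k) <= A * (Phi b - Phi (b + INR k * w))).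
  { intros k; induction k as [|k IH]; simpl csum.
    - rewrite Cmod_0; simpl; rewrite Rmult_0_l, Rplus_0_r; lra.
    - apply Rle_trans with (1 := Cmod_triangle _ _).
      assert (Hk := pos_INR k).
      assert (H := Hstep (b + INR k * w) ltac:(nra)).
      replace (b + INR (S k) * w) with (b + INR k * w + w) by (rewrite S_INR; ring).
      assert (H2 := HF k).
      assert (A * Rpower (b + INR k * w) (- p) <= A * (Phi (b + INR k * w) - Phi (b + INR k * w + w)))
        by (apply Rmult_le_compat_l; assumption).
      lra. }
  apply Rle_trans with (1 := Hsum n).
  rewrite Rmult_assoc; apply Rmult_le_compat_l; [exact HA|].
  assert (Hn := pos_INR n).
  assert (H1 : 0 <= Phi (b + INR n * w)).
  { unfold Phi; apply Rplus_le_le_0_compat; [left; apply Rpower_pos|].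
    apply Rle_div_r; [lra|]; rewrite Rmult_0_l; left; apply Rpower_pos. }
  apply Rle_trans with (Phi b); [lra|].
  unfold Phi, psumK; rewrite Rmult_plus_distr_r.
  assert (Hq := Rpower_pos b (1 - p)).
  apply Rplus_le_compat.
  - rewrite (Rpower_minus_1 b (1 - p)) by lra.
    replace (1 - p - 1) with (- p) by ring.
    assert (Hq' := Rpower_pos b (- p)).
    rewrite <- Rmult_assoc; rewrite <- (Rmult_1_l (Rpower b (- p))) at 1.
    apply Rmult_le_compat_r; [lra|].
    rewrite <- (Rinv_l b0) by lra; apply Rmult_le_compat_l; [|lra].
    left; apply Rinv_0_lt_compat; lra.
  - unfold Rdiv; rewrite Rmult_comm; apply Rmult_le_compat_r; [lra|].
    apply Rinv_le_contravar; nra.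
Qed.

(** The [J_w f] of the overview: for [Re z > 1] it is [1 / w] times the integral of [y^(-z)] over
    [y >= b]; the closed form also serves for the other [z <> 1]. *)
Definition tail_int (w : R) (z : C) (b : R) : C := (cpow b (1 - z) / ((z - 1) * w))%C.

Lemma cder_tail_int (b w v : R) (z : C) :
  0 < w -> 0 < b + v * w -> z <> 1 ->
  cder (fun u => tail_int w z (b + u * w)) v (- cpow (b + v * w) (- z))%C.
Proof.
  intros Hw Hb Hz.
  assert (Hz' : (z - 1)%C <> 0) by now apply Cminus_eq_contra.
  assert (Hw' : RtoC w <> 0) by (intros E; injection E; lra).
  apply cder_eq with ((/ ((z - 1) * w)) * ((1 - z) * RtoC w * cpow (b + v * w) (1 - z - 1)))%C.
  - unfold tail_int, Cdiv.
    assert (H := cder_scal (/ ((z - 1) * w)) _ _ _ (cder_cpow b w v (1 - z) Hb)).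
    destruct H as [H1 H2]; split.
    + apply is_derive_ext with (2 := H1); intros u; f_equal; apply Cmult_comm.
    + apply is_derive_ext with (2 := H2); intros u; f_equal; apply Cmult_comm.
  - replace (1 - z - 1)%C with (- z)%C by ring.
    field; split; assumption.
Qed.

Lemma ln_1_plus_bounds (y : R) : 0 <= y -> 0 <= y - ln (1 + y) <= y * y.
Proof.
  intros Hy; split.
  - assert (H := exp_ineq1_le (ln (1 + y))); rewrite exp_ln in H by lra; lra.
  - assert (H := exp_ineq1_le (- ln (1 + y))); rewrite exp_Ropp, exp_ln in H by lra.
    assert (/ (1 + y) <= 1 - y + y * y); [|lra].
    apply Rmult_le_reg_l with (1 + y); [lra|]; rewrite Rinv_r by lra.
    assert (0 <= y * y * y) by (apply Rmult_le_pos; nra); nra.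
Qed.

Lemma ln_1_plus_pos (y : R) : 0 <= y -> 0 <= ln (1 + y).
Proof.
  intros Hy; rewrite <- ln_1; destruct (Req_dec y 0) as [->|]; [rewrite Rplus_0_r; lra|].
  left; apply ln_increasing; lra.
Qed.

(** Seen as a curve in the step length [v w], the error has derivative [f(b) - f(b + v w)].
    Factoring out [b^(-z)] leaves a difference of exponentials of size at most [|z| w / b], whence
    the loss of [|z|]. *)
Lemma crude_step (b w : R) (z : C) :
  0 < b -> 0 < w -> z <> 1 -> 0 <= Re z ->
  Cmod (cpow b (- z) - (tail_int w z b - tail_int w z (b + w)))
    <= Cmod z * w * Rpower b (- (Re z + 1)).
Proof.
  intros Hb Hw Hz Hre.
  set (g := fun v => (cpow b (- z) * RtoC v - (tail_int w z b - tail_int w z (b + v * w)))%C).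
  replace (cpow b (- z) - (tail_int w z b - tail_int w z (b + w)))%C with (g 1 - g 0)%C.
  2: { unfold g; rewrite Rmult_1_l, Rmult_0_l, Rplus_0_r; ring. }
  apply (curve_mvt g (fun v => cpow b (- z) - (0 - - cpow (b + v * w) (- z)))%C).
  - intros v Hv; unfold g; apply cder_minus; [apply cder_linear|].
    apply cder_minus; [apply cder_const|apply cder_tail_int; nra || assumption].
  - intros v Hv.
    assert (Hy : 0 <= v * w / b) by (apply Rle_div_r; nra).
    assert (Hbv : 0 < b + v * w) by nra.
    replace (cpow b (- z) - (0 - - cpow (b + v * w) (- z)))%C
      with (cpow b (- z) * (cexp 0 - cexp (- z * RtoC (ln (1 + v * w / b)))))%C.
    2: { rewrite (cpow_ratio b (b + v * w)), cexp_0 by lra.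
         replace ((b + v * w) / b) with (1 + v * w / b) by (field; lra); ring. }
    rewrite Cmod_mult, Cmod_cpow, re_opp.
    assert (Hl := ln_1_plus_pos _ Hy); assert (Hl' := proj1 (ln_1_plus_bounds _ Hy)).
    assert (H : Cmod (cexp 0 - cexp (- z * RtoC (ln (1 + v * w / b)))) <= Cmod z * (w / b)).
    { eapply Rle_trans; [apply cexp_lipschitz|].
      - simpl; lra.
      - rewrite re_scal_r, re_opp; nra.
      - replace (0 - - z * RtoC (ln (1 + v * w / b)))%C with (z * RtoC (ln (1 + v * w / b)))%C by ring.
        rewrite Cmod_mult, Cmod_R, Rabs_right by lra.
        apply Rmult_le_compat_l; [apply Cmod_ge_0|].
        apply Rle_trans with (v * w / b); [lra|].
        apply Rmult_le_compat_r; [left; now apply Rinv_0_lt_compat|nra]. }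
    replace (- (Re z + 1)) with (- Re z - 1) by ring.
    rewrite (Rpower_minus_1 b (- Re z)) by exact Hb.
    assert (Hp := Rpower_pos b (- Re z - 1)).
    apply Rle_trans with (b * Rpower b (- Re z - 1) * (Cmod z * (w / b))).
    + apply Rmult_le_compat_l; [nra|exact H].
    + right; field; lra.
Qed.

(** * The cotangent correction at frequencies below 2 pi *)

Lemma sin_lower (y : R) : 0 <= y <= PI -> y - y * y * y / 6 <= sin y.
Proof.
  intros Hy; assert (HP := PI_4).
  destruct (pre_sin_bound y 0 ltac:(lra) ltac:(lra)) as [H _].
  apply Rle_trans with (2 := H).
  unfold sin_approx, sum_f_R0, sin_term; simpl; right; field.
Qed.

Lemma sin_ge_linear (Y : R) :
  0 < Y < PI -> exists c, 0 < c /\ forall y, 0 < y <= Y -> c * y <= sin y.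
Proof.
  intros HY; assert (HP := PI_4).
  assert (HP0 := PI_RGT_0).
  assert (Hs : 0 < sin Y) by (apply sin_gt_0; lra).
  (* On [(0, pi/2]] one has [y <= 2], so [y - y^3 / 6 >= y / 3]; beyond [pi/2] the sine decreases to
     [sin Y] while [y] stays below [pi]. *)
  exists (Rmin (/ 3) (sin Y / PI)); split.
  - apply Rmin_glb_lt; [lra|]; apply Rdiv_lt_0_compat; lra.
  - intros y Hy; destruct (Rle_dec y (PI / 2)) as [H|H].
    + apply Rle_trans with (/ 3 * y); [apply Rmult_le_compat_r; [lra|apply Rmin_l]|].
      assert (H1 := sin_lower y ltac:(lra)).
      assert (0 <= y * (4 - y * y)) by (apply Rmult_le_pos; nra).
      nra.
    + apply Rle_trans with (sin Y / PI * y); [apply Rmult_le_compat_r; [lra|apply Rmin_r]|].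
      assert (sin Y <= sin y).
      { destruct (Req_dec y Y) as [->|]; [lra|]; left; apply sin_decreasing_1; lra. }
      apply Rle_trans with (2 := H0).
      unfold Rdiv; rewrite Rmult_assoc; rewrite <- (Rmult_1_r (sin Y)) at 2.
      apply Rmult_le_compat_l; [lra|].
      apply Rmult_le_reg_l with PI; [lra|]; rewrite <- Rmult_assoc, Rinv_r; lra.
Qed.

(** This is [1/tau - cot(tau/2)/2]. The singularities at 0 cancel and the next ones lie at
    [+- 2 pi]: this is where the restriction [|t| <= 2 pi x / C] with [C > 1] comes from. *)
Definition cot_gap (tau : R) : R := / tau - cos (tau / 2) / (2 * sin (tau / 2)).

Lemma cot_gap_opp (tau : R) : cot_gap (- tau) = - cot_gap tau.
Proof.
  unfold cot_gap.
  replace (- tau / 2) with (- (tau / 2)) by field.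
  rewrite cos_neg, sin_neg, Rinv_opp; unfold Rdiv.
  replace (2 * - sin (tau * / 2)) with (- (2 * sin (tau * / 2))) by ring.
  rewrite Rinv_opp; ring.
Qed.

Lemma cot_gap_lipschitz_pos (th : R) :
  0 < th < 2 * PI ->
  exists L, 0 < L /\ forall x y, 0 < x <= th -> 0 < y <= th ->
    Rabs (cot_gap x - cot_gap y) <= L * Rabs (x - y).
Proof.
  intros Hth.
  destruct (sin_ge_linear (th / 2) ltac:(lra)) as [c [Hc Hsin]].
  (* With [y = x / 2] and [s = sin y] the derivative is [(y^2 - s^2) / (4 y^2 s^2)]; now
     [y^2 - s^2 <= y^4 / 3] and [s >= c y]. *)
  exists (/ (12 * (c * c))); split; [apply Rinv_0_lt_compat; nra|].
  set (D := fun x => - / (x * x) + / (4 * (sin (x / 2) * sin (x / 2)))).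
  assert (Hpos : forall x, 0 < x <= th -> 0 < sin (x / 2)).
  { intros x Hx; assert (H := Hsin (x / 2) ltac:(lra)); nra. }
  assert (HD : forall x, 0 < x <= th -> is_derive cot_gap x (D x)).
  { intros x Hx; assert (H := Hpos x Hx); unfold cot_gap, D.
    auto_derive.
    - split; [lra|]; split; [|exact I]; unfold Rdiv in H; lra.
    - assert (Hs := sin2_cos2 (x * / 2)); unfold Rsqr in Hs; unfold Rdiv in *.
      transitivity (- / (x * x) + (sin (x * / 2) * sin (x * / 2) + cos (x * / 2) * cos (x * / 2))
                      * / (4 * (sin (x * / 2) * sin (x * / 2)))).
      + field; split; lra.
      + rewrite Hs; ring. }
  assert (HB : forall x, 0 < x <= th -> Rabs (D x) <= / (12 * (c * c))).
  { intros x Hx; assert (H := Hpos x Hx).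
    assert (H1 := Hsin (x / 2) ltac:(lra)); unfold D.
    assert (H2 := sin_lower (x / 2) ltac:(lra)).
    assert (H3 := sin_lt_x (x / 2) ltac:(lra)).
    set (y := x / 2) in *; replace x with (2 * y) by (unfold y; field).
    assert (Hy : 0 < y) by (unfold y; lra).
    set (s := sin y) in *.
    replace (- / (2 * y * (2 * y)) + / (4 * (s * s)))
      with ((y - s) * (y + s) / (4 * (y * y) * (s * s))) by (field; lra).
    rewrite Rabs_right.
    2: { apply Rle_ge, Rle_div_r; [|rewrite Rmult_0_l]; repeat apply Rmult_lt_0_compat; nra. }
    apply Rle_div_l; [repeat apply Rmult_lt_0_compat; lra|].
    apply Rmult_le_reg_l with (12 * (c * c)); [nra|].
    rewrite <- (Rmult_assoc (12 * (c * c)) (/ _)), Rinv_r, Rmult_1_l by nra.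
    assert (Hcy : c * y * (c * y) <= s * s) by (apply Rmult_le_compat; nra).
    assert (Hys : (y - s) * (y + s) <= y * y * y / 6 * (2 * y)) by (apply Rmult_le_compat; nra).
    apply Rle_trans with (12 * (c * c) * (y * y * y / 6 * (2 * y))).
    - apply Rmult_le_compat_l; nra.
    - replace (12 * (c * c) * (y * y * y / 6 * (2 * y))) with (4 * (y * y) * (c * y * (c * y))) by field.
      apply Rmult_le_compat_l; nra. }
  intros x y Hx Hy.
  destruct (MVT_gen cot_gap y x D) as [d [Hd E]].
  - intros u Hu; apply HD; revert Hu; unfold Rmin, Rmax; destruct (Rle_dec y x); lra.
  - intros u Hu; apply derivable_continuous_pt; exists (D u); apply is_derive_Reals, HD.
    revert Hu; unfold Rmin, Rmax; destruct (Rle_dec y x); lra.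
  - rewrite E, Rabs_mult; apply Rmult_le_compat_r; [apply Rabs_pos|]; apply HB.
    revert Hd; unfold Rmin, Rmax; destruct (Rle_dec y x); lra.
Qed.

(** Boundedness follows from the Lipschitz bound by comparison with the value at [th], and oddness
    carries both to negative arguments. Pairs straddling 0 never arise: the sign of the frequency is
    that of [Im z]. *)
Lemma cot_gap_bounds (th : R) :
  0 < th < 2 * PI ->
  exists L, 0 < L /\
    (forall x, 0 < Rabs x <= th -> Rabs (cot_gap x) <= L) /\
    (forall x y, 0 < x * y -> Rabs x <= th -> Rabs y <= th ->
       Rabs (cot_gap x - cot_gap y) <= L * Rabs (x - y)).
Proof.
  intros Hth; destruct (cot_gap_lipschitz_pos th Hth) as [L [HL H]].
  assert (Ha := Rabs_pos (cot_gap th)).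
  exists (L + Rabs (cot_gap th) + L * th); split; [nra|].
  assert (Hp : forall x, 0 < x <= th -> Rabs (cot_gap x) <= L + Rabs (cot_gap th) + L * th).
  { intros x Hx.
    assert (H1 := H x th Hx ltac:(lra)).
    assert (H2 := Rabs_triang (cot_gap x - cot_gap th) (cot_gap th)).
    replace (cot_gap x - cot_gap th + cot_gap th) with (cot_gap x) in H2 by ring.
    rewrite (Rabs_left1 (x - th)) in H1 by lra; nra. }
  assert (HL' : L <= L + Rabs (cot_gap th) + L * th) by nra.
  assert (Hl : forall x y, 0 < x <= th -> 0 < y <= th ->
    Rabs (cot_gap x - cot_gap y) <= (L + Rabs (cot_gap th) + L * th) * Rabs (x - y)).
  { intros x y Hx Hy; apply Rle_trans with (1 := H x y Hx Hy).
    apply Rmult_le_compat_r; [apply Rabs_pos|exact HL']. }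
  split.
  - intros x Hx; unfold Rabs in Hx; destruct (Rcase_abs x).
    + rewrite <- (Ropp_involutive x), cot_gap_opp, Rabs_Ropp; apply Hp; lra.
    + apply Hp; lra.
  - intros x y Hxy Hx Hy; unfold Rabs in Hx, Hy; destruct (Rcase_abs x), (Rcase_abs y); try nra.
    + assert (H1 := Hl (- x) (- y) ltac:(lra) ltac:(lra)); rewrite !cot_gap_opp in H1.
      replace (- cot_gap x - - cot_gap y) with (- (cot_gap x - cot_gap y)) in H1 by ring.
      replace (- x - - y) with (- (x - y)) in H1 by ring.
      now rewrite !Rabs_Ropp in H1.
    + apply Hl; nra.
Qed.

(* [summand_q tau = 1/(e^l - 1) - 1/l] at [l = - i tau]: the discrete antiderivative of
   [e^(l m)] minus its continuous one. *)
Definition summand_q (tau : R) : C := (- / 2, - cot_gap tau).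

(** Since [Ci / tau] is [1 / l], this says [(e^l - 1) (1/l + q) = 1]; half-angle formulas reduce the
    real part to [sin^2 + cos^2 = 1]. *)
Lemma summand_q_spec (tau : R) :
  tau <> 0 -> sin (tau / 2) <> 0 ->
  ((cexp (- (Ci * tau)) - 1) * (Ci / tau) + (cexp (- (Ci * tau)) - 1) * summand_q tau = 1)%C.
Proof.
  intros Ht Hs.
  assert (E : cexp (- (Ci * tau)) = (cos tau, - sin tau)).
  { unfold cexp; simpl.
    replace (- (0 * tau - 1 * 0)) with 0 by ring.
    replace (- (0 * 0 + 1 * tau)) with (- tau) by ring.
    rewrite exp_0, cos_neg, sin_neg; f_equal; ring. }
  assert (E2 : (Ci / tau)%C = (0, / tau)).
  { unfold Cdiv; rewrite <- RtoC_inv by exact Ht; apply injective_projections; simpl; ring. }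
  rewrite E, E2, <- Cmult_plus_distr_l; unfold summand_q, cot_gap.
  assert (Hc : cos tau = 1 - 2 * (sin (tau / 2) * sin (tau / 2))).
  { replace tau with (2 * (tau / 2)) at 1 by field; rewrite cos_2a_sin; ring. }
  assert (Hn : sin tau = 2 * sin (tau / 2) * cos (tau / 2)).
  { replace tau with (2 * (tau / 2)) at 1 by field; apply sin_2a. }
  assert (H1 := sin2_cos2 (tau / 2)); unfold Rsqr in H1.
  rewrite Hc, Hn; set (s := sin (tau / 2)) in *; set (k := cos (tau / 2)) in *.
  unfold Cmult, Cplus, Cminus, Copp, RtoC; simpl; f_equal.
  - transitivity (s * s + k * k); [field; split; assumption|exact H1].
  - field; split; assumption.
Qed.

(** Over one step the oscillation is frozen at its frequency in [b]. The linear part of the phase is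
    matched exactly, so [Im z] meets only the quadratic remainder of the logarithm; a bound on
    [|Im z| w / b] then leaves a single factor [w / b] and no power of [Im z]. *)
Lemma cpow_twist (b w v : R) (z : C) :
  0 < b -> 0 < w -> 0 <= v <= 1 -> 0 <= Re z ->
  Cmod (cpow (b + v * w) (- z) - cpow b (- z) * cexp (- (Ci * RtoC (Im z * w / b)) * v))
    <= Rpower b (- Re z) * (Re z * (w / b) + Rabs (Im z) * (w / b * (w / b))).
Proof.
  intros Hb Hw Hv Hre.
  assert (Hwb : 0 < w / b) by now apply Rdiv_lt_0_compat.
  set (y := v * (w / b)).
  assert (Hy : 0 <= y <= w / b) by (unfold y; nra).
  assert (Hl := ln_1_plus_pos y (proj1 Hy)); assert (Hl' := ln_1_plus_bounds y (proj1 Hy)).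
  rewrite (cpow_ratio b (b + v * w)) by nra.
  replace ((b + v * w) / b) with (1 + y) by (unfold y; field; lra).
  set (A := (- z * RtoC (ln (1 + y)))%C); set (B := (- (Ci * RtoC (Im z * w / b)) * v)%C).
  replace (cpow b (- z) * cexp A - cpow b (- z) * cexp B)%C
    with (cpow b (- z) * (cexp A - cexp B))%C by ring.
  rewrite Cmod_mult, Cmod_cpow, re_opp.
  apply Rmult_le_compat_l; [left; apply Rpower_pos|].
  assert (HBre : Re B = 0) by (unfold B, Re, Im; simpl; ring).
  assert (HBim : Im B = - (Im z * y)) by (unfold B, y, Re, Im; simpl; field; lra).
  assert (HAre : Re A = - Re z * ln (1 + y)) by (unfold A; now rewrite re_scal_r, re_opp).
  assert (HAim : Im A = - Im z * ln (1 + y)) by (unfold A; now rewrite im_scal_r, im_opp).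
  eapply Rle_trans; [apply cexp_lipschitz; rewrite ?HAre, ?HBre; nra|].
  eapply Rle_trans; [apply Cmod_le_Re_Im|]; unfold Cminus.
  rewrite re_plus, im_plus, re_opp, im_opp, HAre, HAim, HBre, HBim.
  apply Rplus_le_compat.
  - replace (- Re z * ln (1 + y) + - 0) with (- (Re z * ln (1 + y))) by ring.
    rewrite Rabs_Ropp, Rabs_right by nra; apply Rmult_le_compat_l; lra.
  - replace (- Im z * ln (1 + y) + - - (Im z * y)) with (Im z * (y - ln (1 + y))) by ring.
    rewrite Rabs_mult; apply Rmult_le_compat_l; [apply Rabs_pos|].
    rewrite Rabs_right by lra; nra.
Qed.

Lemma RtoC_neq_0 (x : R) : x <> 0 -> RtoC x <> 0.
Proof. intros H E; injection E; lra. Qed.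

(** If [f] were exactly [e^(l v)] along the step, [f q - J_w f] would be an exact antidifference by
    [summand_q_spec]. The actual [f] deviates from this by [cpow_twist], and [q] moves slightly
    because the frequency drops from [tau] to [tau']. *)
Lemma good_step (th L b w : R) (z : C) :
  0 < th < 2 * PI -> 0 < L ->
  (forall x, 0 < Rabs x <= th -> Rabs (cot_gap x) <= L) ->
  (forall x y, 0 < x * y -> Rabs x <= th -> Rabs y <= th ->
     Rabs (cot_gap x - cot_gap y) <= L * Rabs (x - y)) ->
  0 < b -> 0 < w -> z <> 1 -> 0 <= Re z -> Im z <> 0 -> Rabs (Im z) * w / b <= th ->
  let G := fun x => (cpow x (- z) * summand_q (Im z * w / x) - tail_int w z x)%C in
  Cmod (cpow b (- z) - (G (b + w) - G b))
    <= ((1 + (1 + L)) * (Re z + th) + L * th) * w * Rpower b (- (Re z + 1)).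
Proof.
  intros Hth HL Hq Hlip Hb Hw Hz Hre Him Ht G.
  set (tau := Im z * w / b); set (tau' := Im z * w / (b + w)).
  set (E := cexp (- (Ci * RtoC tau))).
  assert (Htau : Rabs tau = Rabs (Im z) * w / b).
  { unfold tau, Rdiv; rewrite !Rabs_mult, Rabs_inv, (Rabs_right w), (Rabs_right b); lra. }
  assert (Htau' : Rabs tau' <= Rabs tau).
  { rewrite Htau; unfold tau', Rdiv.
    rewrite !Rabs_mult, Rabs_inv, (Rabs_right w), (Rabs_right (b + w)) by lra.
    apply Rmult_le_compat_l; [apply Rmult_le_pos; [apply Rabs_pos|lra]|].
    apply Rinv_le_contravar; lra. }
  assert (Hi : forall x, 0 < x -> 0 < / x) by (intros; now apply Rinv_0_lt_compat).
  assert (Htn : tau <> 0).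
  { unfold tau, Rdiv; assert (H := Hi b Hb); repeat apply Rmult_integral_contrapositive_currified; lra. }
  assert (Htn' : tau' <> 0).
  { unfold tau', Rdiv; assert (H := Hi (b + w) ltac:(lra));
      repeat apply Rmult_integral_contrapositive_currified; lra. }
  assert (Hpos : 0 < tau' * tau).
  { unfold tau', tau, Rdiv.
    replace (Im z * w * / (b + w) * (Im z * w * / b))
      with ((Im z * Im z) * (w * w * (/ (b + w) * / b))) by ring.
    apply Rmult_lt_0_compat; [nra|].
    assert (H := Hi b Hb); assert (H' := Hi (b + w) ltac:(lra)).
    repeat apply Rmult_lt_0_compat; lra. }
  (* [0 < |tau| <= th < 2 pi] keeps [tau / 2] off the zeros of the sine, that is, [e^l <> 1]. *)
  assert (Hsin : sin (tau / 2) <> 0).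
  { destruct (Rtotal_order tau 0) as [H|[H|H]]; [|lra|].
    - rewrite Rabs_left in Htau by lra.
      replace (tau / 2) with (- (- tau / 2)) by field; rewrite sin_neg.
      assert (0 < sin (- tau / 2)) by (apply sin_gt_0; lra); lra.
    - rewrite Rabs_right in Htau by lra.
      assert (0 < sin (tau / 2)) by (apply sin_gt_0; lra); lra. }
  assert (Hspec := summand_q_spec tau Htn Hsin); fold E in Hspec.
  (* The three errors: [A] is the twist error at the far end, [Bt] the one inside the integral, and
     the third is the change of [q]. They account for the summands [1 + L], [1] and [L * th] of the
     constant. *)
  set (A := (cpow (b + w) (- z) - cpow b (- z) * E)%C).
  set (Bt := (tail_int w z b - tail_int w z (b + w) - cpow b (- z) * (Ci / tau) * (E - 1))%C).
  assert (Hdec : (cpow b (- z) - (G (b + w)%R - G b) =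
     - (Bt + (A * summand_q tau' + cpow b (- z) * E * (summand_q tau' - summand_q tau))))%C).
  { unfold G, Bt, A; fold tau tau'.
    transitivity (cpow b (- z) * ((E - 1) * (Ci / tau) + (E - 1) * summand_q tau)
       - (cpow (b + w) (- z) * summand_q tau' - tail_int w z (b + w)
          - (cpow b (- z) * summand_q tau - tail_int w z b)))%C.
    - rewrite Hspec; ring.
    - ring. }
  set (X := Rpower b (- Re z) * ((Re z + th) * (w / b))).
  assert (HX0 : 0 <= X).
  { unfold X; apply Rmult_le_pos; [left; apply Rpower_pos|].
    apply Rmult_le_pos; [lra|left; now apply Rdiv_lt_0_compat]. }
  assert (Htwist : forall v, 0 <= v <= 1 ->
    Cmod (cpow (b + v * w) (- z) - cpow b (- z) * cexp (- (Ci * RtoC tau) * v)) <= X).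
  { intros v Hv; eapply Rle_trans; [apply cpow_twist; assumption|].
    unfold X; apply Rmult_le_compat_l; [left; apply Rpower_pos|].
    rewrite Rmult_plus_distr_r; apply Rplus_le_compat_l.
    rewrite <- Rmult_assoc; apply Rmult_le_compat_r; [left; now apply Rdiv_lt_0_compat|].
    unfold Rdiv in *; lra. }
  assert (HA : Cmod A <= X).
  { assert (H := Htwist 1 ltac:(lra)); rewrite Rmult_1_l in H.
    unfold A, E; replace (- (Ci * tau))%C with (- (Ci * tau) * RtoC 1)%C by ring; exact H. }
  assert (HBt : Cmod Bt <= X).
  (* Differentiating [e^(l v) / l] returns [e^(l v)], so the derivative of [g] at [v] is the twist
     error at [v]. *)
  { set (g := fun v => (tail_int w z b - tail_int w z (b + v * w)
       - cpow b (- z) * (Ci / tau) * (cexp (- (Ci * tau) * RtoC v) - 1))%C).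
    replace Bt with (g 1 - g 0)%C.
    2: { unfold g, Bt, E.
         rewrite Rmult_1_l, Rmult_0_l, Rplus_0_r, Cmult_0_r, cexp_0, Cmult_1_r; ring. }
    apply (curve_mvt g (fun v => 0 - - cpow (b + v * w) (- z)
       - cpow b (- z) * (Ci / tau) * (- (Ci * tau) * RtoC 1 * cexp (- (Ci * tau) * RtoC v) - 0))%C).
    - intros v Hv; unfold g; apply cder_minus.
      + apply cder_minus; [apply cder_const|apply cder_tail_int; nra || assumption].
      + apply cder_scal, cder_minus; [|apply cder_const].
        apply (cder_cexp _ (fun u => u)), @is_derive_id.
    - intros v Hv; eapply Rle_trans with (2 := Htwist v Hv); right; f_equal.
      assert (HCi : (Ci * Ci = - (1))%C) by (unfold Ci; apply injective_projections; simpl; ring).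
      assert (Htc := RtoC_neq_0 tau Htn).
      replace (cpow b (- z) * (Ci / tau) * (- (Ci * tau) * RtoC 1 * cexp (- (Ci * tau) * RtoC v) - 0))%C
        with (- (Ci * Ci) * cpow b (- z) * cexp (- (Ci * tau) * RtoC v))%C by (field; exact Htc).
      rewrite HCi; ring. }
  assert (Hq' : Cmod (summand_q tau') <= 1 + L).
  { eapply Rle_trans; [apply Cmod_le_Re_Im|]; unfold summand_q; simpl.
    rewrite !Rabs_Ropp, (Rabs_right (/ 2)) by lra.
    assert (H := Hq tau'); assert (0 < Rabs tau') by now apply Rabs_pos_lt.
    apply Rplus_le_compat; [lra|apply H; lra]. }
  assert (Hdq : Cmod (summand_q tau' - summand_q tau) <= L * th * (w / b)).
  { replace (summand_q tau' - summand_q tau)%C with (0, - (cot_gap tau' - cot_gap tau)).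
    2: { unfold summand_q; apply injective_projections; simpl; ring. }
    eapply Rle_trans; [apply Cmod_le_Re_Im|]; simpl; rewrite Rabs_R0, Rplus_0_l, Rabs_Ropp.
    eapply Rle_trans; [apply Hlip; [exact Hpos|lra|lra]|].
    rewrite Rmult_assoc; apply Rmult_le_compat_l; [lra|].
    replace (tau' - tau) with (- (tau * (w / (b + w)))) by (unfold tau, tau'; field; lra).
    assert (Hr : 0 < w / (b + w)) by (apply Rdiv_lt_0_compat; lra).
    rewrite Rabs_Ropp, Rabs_mult, (Rabs_right (w / (b + w))) by lra.
    apply Rmult_le_compat; [apply Rabs_pos|lra|lra|].
    unfold Rdiv; apply Rmult_le_compat_l; [lra|]; apply Rinv_le_contravar; lra. }
  assert (HE : Cmod E = 1).
  { unfold E; rewrite Cmod_cexp, <- exp_0; f_equal; unfold Re; simpl; ring. }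
  rewrite Hdec, Cmod_opp.
  eapply Rle_trans; [apply Cmod_triangle|].
  eapply Rle_trans; [apply Rplus_le_compat; [exact HBt|apply Cmod_triangle]|].
  rewrite !Cmod_mult, HE, Cmod_cpow, re_opp.
  assert (Hp := Rpower_pos b (- Re z)).
  assert (H1 : Cmod A * Cmod (summand_q tau') <= X * (1 + L)).
  { apply Rmult_le_compat; try apply Cmod_ge_0; assumption. }
  assert (H2 : Rpower b (- Re z) * 1 * Cmod (summand_q tau' - summand_q tau)
                 <= Rpower b (- Re z) * (L * th * (w / b))).
  { rewrite Rmult_1_r; apply Rmult_le_compat_l; lra. }
  apply Rle_trans with (X + (X * (1 + L) + Rpower b (- Re z) * (L * th * (w / b)))); [lra|].
  unfold X; replace (- (Re z + 1)) with (- Re z - 1) by ring.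
  rewrite (Rpower_minus_1 b (- Re z)) by exact Hb.
  right; field; lra.
Qed.

(** * Sums against integrals in one direction *)

Lemma csum_minus_telescope_bound (F : nat -> C) (G : nat -> C) (b0 w0 dlt b w p A : R) (n : nat) :
  0 < b0 -> 0 < w0 -> 0 < dlt -> b0 <= b -> w0 <= w -> 1 + dlt <= p -> 0 <= A ->
  (forall m, Cmod (F m - (G m - G (S m))) <= A * Rpower (b + INR m * w) (- p)) ->
  Cmod (csum F n - (G O - G n)) <= A * psumK b0 w0 dlt * Rpower b (1 - p).
Proof.
  intros Hb0 Hw0 Hd Hb Hw Hp HA HF.
  replace (csum F n - (G O - G n))%C with (csum (fun m => F m - (G m - G (S m)))%C n).
  - now apply csum_power_bound with w.
  - rewrite <- csum_telescope; clear.
    induction n as [|n IH]; simpl; [ring|rewrite IH; ring].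
Qed.

Lemma crude_sum (b0 w0 dlt b w : R) (z : C) (n : nat) :
  0 < b0 -> 0 < w0 -> 0 < dlt -> b0 <= b -> w0 <= w -> dlt <= Re z -> z <> 1 ->
  Cmod (csum (fun m => cpow (b + INR m * w) (- z)) n
          - (tail_int w z b - tail_int w z (b + INR n * w)))
    <= Cmod z * w * psumK b0 w0 dlt * Rpower b (- Re z).
Proof.
  intros Hb0 Hw0 Hd Hb Hw Hre Hz.
  assert (H := csum_minus_telescope_bound (fun m => cpow (b + INR m * w) (- z))
    (fun m => tail_int w z (b + INR m * w)) b0 w0 dlt b w (Re z + 1) (Cmod z * w) n).
  simpl in H; rewrite Rmult_0_l, Rplus_0_r in H.
  replace (1 - (Re z + 1)) with (- Re z) in H by ring.
  apply H; try lra.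
  - apply Rmult_le_pos; [apply Cmod_ge_0|lra].
  - intros m; change (match m with O => 1 | S _ => INR m + 1 end) with (INR (S m)).
    replace (b + INR (S m) * w) with (b + INR m * w + w) by (rewrite S_INR; ring).
    assert (Hm := pos_INR m); apply crude_step; nra || assumption.
Qed.

Lemma good_sum (th b0 w0 w1 dlt s1 : R) :
  0 < th < 2 * PI -> 0 < b0 -> 0 < w0 -> 0 < dlt ->
  exists K, 0 < K /\ forall (b w : R) (z : C) (n : nat),
    b0 <= b -> w0 <= w <= w1 -> dlt <= Re z <= s1 -> z <> 1 -> Rabs (Im z) * w / b <= th ->
    Cmod (csum (fun m => cpow (b + INR m * w) (- z)) n
            - (tail_int w z b - tail_int w z (b + INR n * w)))
      <= K * Rpower b (- Re z).
Proof.
  intros Hth Hb0 Hw0 Hd.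
  destruct (cot_gap_bounds th Hth) as [L [HL [Hq Hlip]]].
  assert (Hps := psumK_pos b0 w0 dlt Hb0 Hw0 Hd).
  (* If [s1 <= 0] or [w1 <= 0] the range of parameters is empty; setting these cases aside makes the
     constants below positive. *)
  destruct (Rle_lt_dec s1 0) as [Hs1|Hs1].
  { exists 1; split; [lra|]; intros; exfalso; lra. }
  destruct (Rle_lt_dec w1 0) as [Hw1|Hw1].
  { exists 1; split; [lra|]; intros; exfalso; lra. }
  set (Kg := ((1 + (1 + L)) * (s1 + th) + L * th) * w1).
  assert (HKg : 0 < Kg).
  { unfold Kg; apply Rmult_lt_0_compat; [|lra].
    assert (0 < L * th) by nra; assert (0 < (1 + (1 + L)) * (s1 + th)) by (apply Rmult_lt_0_compat; lra).
    lra. }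
  exists ((s1 + 1) * w1 * psumK b0 w0 dlt + (Kg * psumK b0 w0 dlt + 2 * (1 + L))); split.
  { assert (0 < (s1 + 1) * w1) by nra.
    assert (0 < (s1 + 1) * w1 * psumK b0 w0 dlt) by nra.
    assert (0 < Kg * psumK b0 w0 dlt) by nra.
    lra. }
  intros b w z n Hb Hw Hre Hz Ht.
  assert (Hpw := Rpower_pos b (- Re z)).
  rewrite Rmult_plus_distr_r.
  assert (Hpos1 : 0 <= (s1 + 1) * w1 * psumK b0 w0 dlt) by (apply Rmult_le_pos; nra).
  assert (Hpos2 : 0 <= Kg * psumK b0 w0 dlt + 2 * (1 + L)) by nra.
  (* At frequency 0 there is no [q], but then [|z| = Re z <= s1] and the crude estimate already has
     a bounded constant. *)
  destruct (Req_dec (Im z) 0) as [Him|Him].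
  - eapply Rle_trans; [apply (crude_sum b0 w0 dlt); lra || assumption|].
    apply Rle_trans with ((s1 + 1) * w1 * psumK b0 w0 dlt * Rpower b (- Re z)); [|nra].
    apply Rmult_le_compat_r; [lra|]; apply Rmult_le_compat_r; [lra|].
    apply Rmult_le_compat; [apply Cmod_ge_0|lra| |lra].
    eapply Rle_trans; [apply Cmod_le_Re_Im|]; rewrite Him, Rabs_R0, Rabs_right; lra.
  - set (G := fun x => (cpow x (- z) * summand_q (Im z * w / x) - tail_int w z x)%C).
    assert (Hmain := csum_minus_telescope_bound (fun m => cpow (b + INR m * w) (- z))
      (fun m => - G (b + INR m * w)%R)%C b0 w0 dlt b w (Re z + 1) Kg n).
    simpl in Hmain; rewrite Rmult_0_l, Rplus_0_r in Hmain.
    replace (1 - (Re z + 1)) with (- Re z) in Hmain by ring.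
    assert (Hbm : forall m, b <= b + INR m * w) by (intros m; assert (Hm := pos_INR m); nra).
    assert (Hfreq : forall x, b <= x -> Rabs (Im z) * w / x <= th).
    { intros x Hx; apply Rle_trans with (2 := Ht); unfold Rdiv; apply Rmult_le_compat_l.
      - apply Rmult_le_pos; [apply Rabs_pos|lra].
      - apply Rinv_le_contravar; lra. }
    assert (HM : Cmod (csum (fun m => cpow (b + INR m * w) (- z)) n - (- G b - - G (b + INR n * w)%R))
       <= Kg * psumK b0 w0 dlt * Rpower b (- Re z)).
    { apply Hmain; try lra.
      intros m; change (match m with O => 1 | S _ => INR m + 1 end) with (INR (S m)).
      replace (b + INR (S m) * w) with (b + INR m * w + w) by (rewrite S_INR; ring).
      assert (H := Hbm m).
      replace (- G (b + INR m * w)%R - - G (b + INR m * w + w)%R)%C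
        with (G (b + INR m * w + w)%R - G (b + INR m * w)%R)%C by ring.
      eapply Rle_trans; [apply (good_step th L); try assumption; try lra; now apply Hfreq|].
      apply Rmult_le_compat_r; [left; apply Rpower_pos|].
      unfold Kg; apply Rmult_le_compat; try lra.
      - assert (0 < L * th) by nra; assert (0 <= (1 + (1 + L)) * (Re z + th)) by (apply Rmult_le_pos; lra).
        lra.
      - apply Rplus_le_compat_r, Rmult_le_compat_l; lra. }
    assert (Hfq : forall x, b <= x -> Cmod (cpow x (- z) * summand_q (Im z * w / x)) <= (1 + L) * Rpower b (- Re z)).
    { intros x Hx; rewrite Cmod_mult, Cmod_cpow, re_opp, Rmult_comm.
      apply Rmult_le_compat; [apply Cmod_ge_0|left; apply Rpower_pos| |apply Rpower_decr; lra].
      eapply Rle_trans; [apply Cmod_le_Re_Im|]; unfold summand_q; simpl.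
      rewrite !Rabs_Ropp, (Rabs_right (/ 2)) by lra.
      apply Rplus_le_compat; [lra|]; apply Hq.
      assert (Hx0 : 0 < / x) by (apply Rinv_0_lt_compat; lra).
      assert (Hf := Hfreq x Hx).
      unfold Rdiv in *; rewrite !Rabs_mult, (Rabs_right w), (Rabs_right (/ x)) by lra.
      split; [|exact Hf]; assert (0 < Rabs (Im z)) by now apply Rabs_pos_lt.
      repeat apply Rmult_lt_0_compat; lra. }
    assert (H1 := Hfq b ltac:(lra)); assert (H2 := Hfq (b + INR n * w) (Hbm n)).
    (* Removing the boundary terms [f q] at both ends, each of size [b^(-Re z)], leaves the two tail
       integrals. *)
    replace (csum (fun m => cpow (b + INR m * w) (- z)) n
            - (tail_int w z b - tail_int w z (b + INR n * w)))%C
      with ((csum (fun m => cpow (b + INR m * w) (- z)) n - (- G b - - G (b + INR n * w)%R))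
         - (cpow b (- z) * summand_q (Im z * w / b)
            - cpow (b + INR n * w) (- z) * summand_q (Im z * w / (b + INR n * w))))%C
      by (unfold G; ring).
    eapply Rle_trans; [apply Cmod_minus_le|].
    assert (H3 := Cmod_minus_le (cpow b (- z) * summand_q (Im z * w / b))
       (cpow (b + INR n * w) (- z) * summand_q (Im z * w / (b + INR n * w)))).
    assert (H4 : 0 <= (s1 + 1) * w1 * psumK b0 w0 dlt * Rpower b (- Re z)) by nra.
    lra.
Qed.

(** * Sums of powers over boxes *)

(* [(w, l, n)] stands for the points [l * w, ..., (l + n - 1) * w] of a direction of step [w]. *)
Definition dir : Type := (R * nat * nat)%type.

Definition step_of (d : dir) : R := fst (fst d).

Definition dsum (d : dir) (F : R -> C) (b : R) : C :=
  let '(w, l, n) := d in csum (fun m => F (b + INR (l + m) * w)) n.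

(** Start minus end: with this sign, [ddiff] of [tail_int] is [1 / w] times the integral over the
    segment. *)
Definition ddiff (d : dir) (F : R -> C) (b : R) : C :=
  let '(w, l, n) := d in (F (b + INR l * w)%R - F (b + INR (l + n) * w)%R)%C.

Fixpoint iter_op (op : dir -> (R -> C) -> R -> C) (D : list dir) (F : R -> C) : R -> C :=
  match D with
  | nil => F
  | d :: D' => op d (iter_op op D' F)
  end.

Lemma dsum_comm (d e : dir) (F : R -> C) : dsum d (dsum e F) = dsum e (dsum d F).
Proof.
  destruct d as [[w l] n], e as [[w' l'] n']; apply functional_extensionality; intros b; simpl.
  rewrite csum_exchange; apply csum_ext; intros m _; apply csum_ext; intros m' _; f_equal; ring.
Qed.

Lemma ddiff_comm (d e : dir) (F : R -> C) : ddiff d (ddiff e F) = ddiff e (ddiff d F).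
Proof.
  destruct d as [[w l] n], e as [[w' l'] n']; apply functional_extensionality; intros b; simpl.
  assert (H : forall x y, b + x + y = b + y + x) by (intros; ring).
  rewrite !(H (_ * w) (_ * w')); ring.
Qed.

Lemma csum_minus (F G : nat -> C) (n : nat) :
  csum (fun m => F m - G m)%C n = (csum F n - csum G n)%C.
Proof. induction n as [|n IH]; simpl; [ring|rewrite IH; ring]. Qed.

Lemma csum_scal (c : C) (F : nat -> C) (n : nat) : csum (fun m => F m * c)%C n = (csum F n * c)%C.
Proof. induction n as [|n IH]; simpl; [ring|rewrite IH; ring]. Qed.

Lemma dsum_ddiff_comm (d e : dir) (F : R -> C) : dsum d (ddiff e F) = ddiff e (dsum d F).
Proof.
  destruct d as [[w l] n], e as [[w' l'] n']; apply functional_extensionality; intros b; simpl.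
  rewrite csum_minus; f_equal; apply csum_ext; intros m _; f_equal; ring.
Qed.

Lemma iter_op_perm (op : dir -> (R -> C) -> R -> C) (D D' : list dir) (F : R -> C) :
  (forall d e G, op d (op e G) = op e (op d G)) ->
  Permutation D D' -> iter_op op D F = iter_op op D' F.
Proof.
  intros Hc HP; induction HP; simpl; auto; congruence.
Qed.

(** Lets a chosen direction be summed first, directly against the power, before the others are
    applied to the result. *)
Lemma iter_op_cons_inner (op : dir -> (R -> C) -> R -> C) (d : dir) (D : list dir) (F : R -> C) :
  (forall d e G, op d (op e G) = op e (op d G)) ->
  iter_op op (d :: D) F = iter_op op D (op d F).
Proof.
  intros Hc; rewrite (iter_op_perm op (d :: D) (D ++ d :: nil)) by
    (assumption || apply Permutation_cons_append).
  clear; induction D as [|e D IH]; simpl; [reflexivity|now rewrite IH].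
Qed.

Local Notation RS := (iter_op dsum).
Local Notation RI := (iter_op ddiff).

Lemma RS_ddiff_comm (D : list dir) (e : dir) (F : R -> C) : RS D (ddiff e F) = ddiff e (RS D F).
Proof.
  induction D as [|d D IH]; simpl; [reflexivity|].
  rewrite IH; apply dsum_ddiff_comm.
Qed.

Lemma RS_minus (D : list dir) (F G : R -> C) (b : R) :
  RS D (fun x => F x - G x)%C b = (RS D F b - RS D G b)%C.
Proof.
  revert b; induction D as [|[[w l] n] D IH]; intros b; simpl; [reflexivity|].
  rewrite <- csum_minus; apply csum_ext; intros m _; apply IH.
Qed.

Lemma RS_scal (D : list dir) (c : C) (F : R -> C) (b : R) :
  RS D (fun x => F x * c)%C b = (RS D F b * c)%C.
Proof.
  revert b; induction D as [|[[w l] n] D IH]; intros b; simpl; [reflexivity|].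
  rewrite <- csum_scal; apply csum_ext; intros m _; apply IH.
Qed.

Lemma RS_shift (D : list dir) (F : R -> C) (b c : R) :
  RS D (fun x => F (x + c)) b = RS D F (b + c).
Proof.
  revert b; induction D as [|[[w l] n] D IH]; intros b; simpl; [reflexivity|].
  apply csum_ext; intros m _; rewrite IH; f_equal; ring.
Qed.

Definition step_prod (D : list dir) : R := fold_right (fun d p => step_of d * p) 1 D.

(* The integral of [(b + u . w)^(-z)] over the box [D], by inclusion-exclusion on its corners. *)
Definition main_term (D : list dir) (z : C) (b : R) : C :=
  (RI D (fun x => cpow x (INR (length D) - z)) b
     * / (poch (length D) z * RtoC (step_prod D)))%C.

Definition steps_in (w0 w1 : R) (D : list dir) : Prop :=
  List.Forall (fun d => w0 <= step_of d <= w1) D.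

Lemma step_prod_pos (w0 w1 : R) (D : list dir) : 0 < w0 -> steps_in w0 w1 D -> 0 < step_prod D.
Proof.
  intros Hw H; induction H as [|d D Hd HD IH]; simpl; [lra|]; apply Rmult_lt_0_compat; lra.
Qed.

Definition off_poles (k : nat) (z : C) : Prop :=
  forall j : nat, (1 <= j <= k)%nat -> z <> RtoC (INR j).

Lemma off_poles_pred (k : nat) (z : C) : off_poles (S k) z -> off_poles k (z - 1)%C.
Proof.
  intros H j Hj E; apply (H (S j) ltac:(lia)).
  rewrite S_INR, RtoC_plus, <- E; ring.
Qed.

Lemma off_poles_1 (k : nat) (z : C) : off_poles (S k) z -> z <> 1.
Proof. intros H; apply (H 1%nat); lia. Qed.

Lemma poch_shift (k : nat) (z : C) : poch (S k) z = ((z - 1) * poch k (z - 1))%C.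
Proof.
  induction k as [|k IH]; [simpl; ring|].
  change (poch (S (S k)) z) with (poch (S k) z * (z - RtoC (INR (S (S k)))))%C.
  rewrite IH; change (poch (S k) (z - 1)) with (poch k (z - 1) * (z - 1 - RtoC (INR (S k))))%C.
  rewrite (S_INR (S k)), RtoC_plus; ring.
Qed.

Lemma poch_neq_0 (k : nat) (z : C) : off_poles k z -> poch k z <> 0.
Proof.
  revert z; induction k as [|k IH]; intros z H; [exact C1_nz|].
  rewrite poch_shift; apply Cmult_neq_0.
  - now apply Cminus_eq_contra, off_poles_1 with k.
  - now apply IH, off_poles_pred.
Qed.

(** Integrating out one direction lowers [z] by 1 and costs [1 / ((z - 1) w)]. This recursion
    matches [tail_int], which is itself a power with exponent [-(z - 1)] up to the same factor. *)
Lemma main_term_cons (w0 w1 : R) (d : dir) (D : list dir) (z : C) (b : R) :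
  0 < w0 -> steps_in w0 w1 (d :: D) -> off_poles (S (length D)) z ->
  main_term (d :: D) z b = (ddiff d (main_term D (z - 1)) b * / ((z - 1) * RtoC (step_of d)))%C.
Proof.
  intros Hw0 HD Hz; inversion HD as [|? ? Hd HD']; subst.
  assert (HpD := step_prod_pos w0 w1 D Hw0 HD').
  assert (Hz1 : (z - 1)%C <> 0) by now apply Cminus_eq_contra, off_poles_1 with (length D).
  assert (Hp := poch_neq_0 _ _ (off_poles_pred _ _ Hz)).
  assert (HD0 := RtoC_neq_0 (step_prod D) ltac:(lra)).
  assert (Hd0 := RtoC_neq_0 (step_of d) ltac:(lra)).
  unfold main_term.
  change (length (d :: D)) with (S (length D)).
  change (step_prod (d :: D)) with (step_of d * step_prod D).
  rewrite poch_shift, RtoC_mult.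
  assert (E : (fun x => cpow x (INR (S (length D)) - z)) = (fun x => cpow x (INR (length D) - (z - 1)))).
  { apply functional_extensionality; intros x; f_equal; rewrite S_INR, RtoC_plus; ring. }
  rewrite E; clear E; destruct d as [[w l] n]; simpl.
  unfold step_of in *; simpl in *.
  field; repeat split; assumption.
Qed.

(** Each direction raises the exponent by 1. The shift [c] retains decay at [b + c] although the
    sums start at [b]: it serves when one direction, already summed, began far out. *)
Lemma RS_power_bound (b0 w0 w1 dlt p A c : R) (D : list dir) (F : R -> C) (b : R) :
  0 < b0 -> 0 < w0 -> 0 < dlt -> 0 <= A -> 0 <= c -> steps_in w0 w1 D ->
  INR (length D) + dlt <= p -> b0 <= b ->
  (forall x, b <= x -> Cmod (F x) <= A * Rpower (x + c) (- p)) ->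
  Cmod (RS D F b) <= A * psumK b0 w0 dlt ^ length D * Rpower (b + c) (INR (length D) - p).
Proof.
  intros Hb0 Hw0 Hd HA Hc HD; assert (HK := psumK_pos b0 w0 dlt Hb0 Hw0 Hd).
  revert b; induction HD as [|[[w l] n] D Hw HD IH]; intros b Hp Hb HF.
  - simpl; rewrite Rmult_1_r; replace (0 - p) with (- p) by ring; apply HF; lra.
  - unfold step_of in Hw; simpl in Hw.
    change (length ((w, l, n) :: D)) with (S (length D)) in *; rewrite S_INR in *.
    assert (Hl := pos_INR l).
    assert (Hk := pos_INR (length D)).
    assert (HKk : 0 < psumK b0 w0 dlt ^ length D) by now apply pow_lt.
    simpl iter_op.
    eapply Rle_trans.
    + apply (csum_power_bound b0 w0 dlt (b + INR l * w + c) w (p - INR (length D))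
         (A * psumK b0 w0 dlt ^ length D)); try lra; try nra.
      intros m; assert (Hm := pos_INR m).
      assert (Hx : b <= b + INR (l + m) * w) by (rewrite plus_INR; nra).
      eapply Rle_trans; [apply IH; [lra|lra|]|].
      * intros x Hx'; apply HF; lra.
      * right; f_equal; f_equal; [rewrite plus_INR|]; ring.
    + replace (1 - (p - INR (length D))) with (INR (length D) + 1 - p) by ring.
      apply Rle_trans with (A * psumK b0 w0 dlt ^ length D * psumK b0 w0 dlt
                              * Rpower (b + c) (INR (length D) + 1 - p)).
      * apply Rmult_le_compat_l; [apply Rmult_le_pos; nra|].
        apply Rpower_decr; nra.
      * right; simpl; ring.
Qed.

Lemma Cmod_sub_real_ge (z : C) (x : R) : Re z - x <= Cmod (z - RtoC x).
Proof.
  eapply Rle_trans; [|apply Re_le_Cmod_r]; unfold Cminus; rewrite re_plus, re_opp; simpl; lra.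
Qed.

(* The hypothesis on [K] covers [K = 0], where [z - 1] may be arbitrarily small. *)
Lemma peel_direction (b0 w0 w1 dlt A c K : R) (w : R) (l n : nat) (D : list dir) (z : C) (b : R) :
  0 < b0 -> 0 < w0 -> 0 < dlt -> 0 <= A -> 0 <= c -> steps_in w0 w1 ((w, l, n) :: D) ->
  INR (length D) + dlt <= Re z -> off_poles (S (length D)) z -> b0 <= b ->
  0 <= K -> (K = 0 \/ dlt <= Cmod (z - 1)) ->
  (forall x, b <= x -> Cmod (dsum (w, l, n) (fun y => cpow y (- z)) x - ddiff (w, l, n) (tail_int w z) x)
     <= A * Rpower (x + c) (- Re z)) ->
  (forall x, b0 <= x -> Cmod (RS D (fun y => cpow y (- (z - 1))) x - main_term D (z - 1) x)
     <= K * (1 + Cmod (z - 1)) * Rpower x (INR (length D) - Re z)) ->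
  Cmod (RS ((w, l, n) :: D) (fun y => cpow y (- z)) b - main_term ((w, l, n) :: D) z b)
    <= A * psumK b0 w0 dlt ^ length D * Rpower (b + c) (INR (length D) - Re z)
       + 2 * K * (1 + / dlt) / w0 * Rpower (b + INR l * w) (INR (length D) - Re z).
Proof.
  intros Hb0 Hw0 Hd HA Hc HD Hre Hz Hb HK HK0 Hone Hrec.
  inversion HD as [|? ? Hw HD']; subst; unfold step_of in Hw; simpl in Hw.
  rewrite (iter_op_cons_inner dsum) by apply dsum_comm.
  rewrite (main_term_cons w0 w1) by assumption.
  assert (Hz1 : (z - 1)%C <> 0) by now apply Cminus_eq_contra, off_poles_1 with (length D).
  assert (Hwc := RtoC_neq_0 w ltac:(lra)).
  set (q := (/ ((z - 1) * RtoC w))%C).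
  set (fz := fun y => cpow y (- z)); set (f1 := fun y => cpow y (- (z - 1))).
  assert (Etail : tail_int w z = fun x => (f1 x * q)%C).
  { apply functional_extensionality; intros x; unfold tail_int, f1, q, Cdiv.
    f_equal; f_equal; ring. }
  assert (E : RS D (ddiff (w, l, n) (tail_int w z)) b = (ddiff (w, l, n) (RS D f1) b * q)%C).
  { rewrite RS_ddiff_comm, Etail; simpl; rewrite !RS_scal; ring. }
  set (x1 := b + INR l * w); set (x2 := b + INR (l + n) * w).
  assert (Hl := pos_INR l); assert (Hn := pos_INR n).
  assert (Hx1 : b0 <= x1) by (unfold x1; nra).
  assert (Hx2 : x1 <= x2) by (unfold x1, x2; rewrite plus_INR; nra).
  (* The error of direction [w] is summed over [D]; what remains are tail integrals, whose sum over
     [D] differs from the main term by the errors of [D] at exponent [z - 1] at the two ends, times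
     [1 / ((z - 1) w)]. *)
  replace (RS D (dsum (w, l, n) fz) b
             - ddiff (w, l, n) (main_term D (z - 1)) b * / ((z - 1) * RtoC (step_of (w, l, n))))%C
    with (RS D (fun x => dsum (w, l, n) fz x - ddiff (w, l, n) (tail_int w z) x) b
          + ((RS D f1 x1 - main_term D (z - 1) x1) - (RS D f1 x2 - main_term D (z - 1) x2)) * q)%C.
  2: { rewrite RS_minus, E; unfold q, x1, x2, step_of; simpl; ring. }
  eapply Rle_trans; [apply Cmod_triangle|]; apply Rplus_le_compat.
  - apply (RS_power_bound b0 w0 w1); assumption || (try lra).
  - rewrite Cmod_mult.
    assert (H1 := Hrec x1 Hx1); assert (H2 := Hrec x2 ltac:(lra)); fold f1 in H1, H2.
    assert (Hdec : Rpower x2 (INR (length D) - Re z) <= Rpower x1 (INR (length D) - Re z))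
      by (apply Rpower_decr; lra).
    set (m := Cmod (z - 1)) in *; set (P := Rpower x1 (INR (length D) - Re z)) in *.
    assert (Hm : 0 < m) by now apply Cmod_gt_0.
    assert (HP : 0 < P) by apply Rpower_pos.
    assert (Hq : Cmod q = / (m * w)).
    { unfold q; rewrite Cmod_inv, Cmod_mult, Cmod_R, Rabs_right by (try apply Cmult_neq_0; lra || assumption).
      reflexivity. }
    rewrite Hq.
    assert (Hmw : 0 < m * w) by nra.
    assert (H3 : Cmod ((RS D f1 x1 - main_term D (z - 1) x1) - (RS D f1 x2 - main_term D (z - 1) x2))
       <= 2 * (K * (1 + m) * P)).
    { eapply Rle_trans; [apply Cmod_minus_le|].
      assert (K * (1 + m) * Rpower x2 (INR (length D) - Re z) <= K * (1 + m) * P)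
        by (apply Rmult_le_compat_l; nra).
      lra. }
    apply Rle_trans with (2 * (K * (1 + m) * P) * / (m * w)).
    { apply Rmult_le_compat_r; [left; now apply Rinv_0_lt_compat|exact H3]. }
    destruct HK0 as [->|Hmd]; [right; field; lra|].
    (* Here [1 / |z - 1|] absorbs the lost factor: [(1 + m) / m <= 1 + 1 / dlt]. *)
    replace (2 * (K * (1 + m) * P) * / (m * w)) with ((2 * K * P) * ((1 + / m) * / w)) by (field; lra).
    replace (2 * K * (1 + / dlt) / w0 * P) with ((2 * K * P) * ((1 + / dlt) * / w0)) by (field; lra).
    apply Rmult_le_compat_l; [apply Rmult_le_pos; nra|].
    assert (/ m <= / dlt) by (apply Rinv_le_contravar; lra).
    assert (0 < / m) by now apply Rinv_0_lt_compat.
    assert (0 < / w) by (apply Rinv_0_lt_compat; lra).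
    apply Rmult_le_compat; try lra; apply Rinv_le_contravar; lra.
Qed.

(** The base value is exactly 0, the empty box having no error; this admits a single direction with
    [z] arbitrarily close to 1 in [peel_direction]. *)
Fixpoint crudeK (b0 w0 w1 dlt : R) (k : nat) : R :=
  match k with
  | O => 0
  | S k' => w1 * psumK b0 w0 dlt * psumK b0 w0 dlt ^ k'
            + 2 * crudeK b0 w0 w1 dlt k' * (1 + / dlt) / w0
  end.

Lemma crudeK_nonneg (b0 w0 w1 dlt : R) (k : nat) :
  0 < b0 -> 0 < w0 -> 0 <= w1 -> 0 < dlt -> 0 <= crudeK b0 w0 w1 dlt k.
Proof.
  intros Hb0 Hw0 Hw1 Hd; assert (HK := psumK_pos b0 w0 dlt Hb0 Hw0 Hd).
  assert (0 < / dlt) by now apply Rinv_0_lt_compat.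
  assert (0 < / w0) by now apply Rinv_0_lt_compat.
  induction k as [|k IH]; simpl; [lra|].
  assert (HKk : 0 < psumK b0 w0 dlt ^ k) by now apply pow_lt.
  apply Rplus_le_le_0_compat; [apply Rmult_le_pos; nra|].
  unfold Rdiv; repeat apply Rmult_le_pos; lra.
Qed.

Lemma dsum_as_csum (w : R) (l n : nat) (F : R -> C) (x : R) :
  dsum (w, l, n) F x = csum (fun m => F (x + INR l * w + INR m * w)) n.
Proof. simpl; apply csum_ext; intros m _; f_equal; rewrite plus_INR; ring. Qed.

Lemma ddiff_as_minus (w : R) (l n : nat) (F : R -> C) (x : R) :
  ddiff (w, l, n) F x = (F (x + INR l * w)%R - F (x + INR l * w + INR n * w)%R)%C.
Proof.
  simpl; replace (x + INR l * w + INR n * w) with (x + INR (l + n) * w)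
    by (rewrite plus_INR; ring); reflexivity.
Qed.

Lemma crude_multi (b0 w0 w1 dlt : R) (D : list dir) (z : C) (b : R) :
  0 < b0 -> 0 < w0 -> 0 <= w1 -> 0 < dlt -> steps_in w0 w1 D ->
  INR (length D) - 1 + dlt <= Re z -> off_poles (length D) z -> b0 <= b ->
  Cmod (RS D (fun y => cpow y (- z)) b - main_term D z b)
    <= crudeK b0 w0 w1 dlt (length D) * (1 + Cmod z) * Rpower b (INR (length D) - 1 - Re z).
Proof.
  intros Hb0 Hw0 Hw1 Hd HD; assert (HK := psumK_pos b0 w0 dlt Hb0 Hw0 Hd).
  revert z b; induction HD as [|[[w l] n] D Hw HD IH]; intros z b Hre Hz Hb.
  - simpl; unfold main_term; simpl.
    replace (0 - z)%C with (- z)%C by ring.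
    replace (/ (1 * 1))%C with (RtoC 1) by (field; exact C1_nz).
    rewrite Cmult_1_r; unfold Cminus; rewrite Cplus_opp_r, Cmod_0; lra.
  - unfold step_of in Hw; simpl in Hw.
    change (length ((w, l, n) :: D)) with (S (length D)) in *; rewrite S_INR in *.
    assert (Hl := pos_INR l); assert (Hk := pos_INR (length D)).
    assert (HC := Cmod_ge_0 z).
    assert (HKc := crudeK_nonneg b0 w0 w1 dlt (length D) Hb0 Hw0 Hw1 Hd).
    eapply Rle_trans.
    + apply (peel_direction b0 w0 w1 dlt (Cmod z * w1 * psumK b0 w0 dlt) 0
               (crudeK b0 w0 w1 dlt (length D))); try assumption; try lra.
      * apply Rmult_le_pos; [apply Rmult_le_pos; lra|lra].
      * constructor; [exact Hw|exact HD].
      (* As soon as [D] is nonempty, [Re z >= 1 + dlt] keeps [z] away from 1. *)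
      * destruct D as [|e D]; [left; reflexivity|right].
        eapply Rle_trans with (2 := Cmod_sub_real_ge z 1).
        change (length (e :: D)) with (S (length D)) in Hre; rewrite S_INR in Hre.
        assert (Hk' := pos_INR (length D)); lra.
      * intros x Hx; rewrite dsum_as_csum, ddiff_as_minus, Rplus_0_r.
        eapply Rle_trans; [apply (crude_sum b0 w0 dlt); nra || (try lra)|].
        -- now apply off_poles_1 with (length D).
        -- apply Rmult_le_compat.
           ++ repeat apply Rmult_le_pos; lra.
           ++ left; apply Rpower_pos.
           ++ apply Rmult_le_compat_r; [lra|]; apply Rmult_le_compat_l; lra.
           ++ apply Rpower_decr; nra.
      * intros x Hx; eapply Rle_trans; [apply IH|].
        -- unfold Cminus; rewrite re_plus, re_opp; simpl; lra.
        -- now apply off_poles_pred.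
        -- exact Hx.
        -- right; f_equal; f_equal; unfold Cminus; rewrite re_plus, re_opp; simpl; lra.
    + rewrite Rplus_0_r; replace (INR (length D) + 1 - 1 - Re z) with (INR (length D) - Re z) by ring.
      set (P := Rpower b (INR (length D) - Re z)).
      assert (HP : 0 < P) by apply Rpower_pos.
      assert (HPl : Rpower (b + INR l * w) (INR (length D) - Re z) <= P) by (apply Rpower_decr; nra).
      assert (HKk : 0 < psumK b0 w0 dlt ^ length D) by now apply pow_lt.
      assert (0 < / dlt) by now apply Rinv_0_lt_compat.
      assert (0 < / w0) by now apply Rinv_0_lt_compat.
      set (U := w1 * psumK b0 w0 dlt * psumK b0 w0 dlt ^ length D).
      set (V := 2 * crudeK b0 w0 w1 dlt (length D) * (1 + / dlt) / w0) in *.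
      assert (HU : 0 <= U) by (unfold U; repeat apply Rmult_le_pos; lra).
      assert (HV : 0 <= V) by (unfold V, Rdiv; repeat apply Rmult_le_pos; lra).
      simpl crudeK; fold U V.
      replace (Cmod z * w1 * psumK b0 w0 dlt * psumK b0 w0 dlt ^ length D * P) with (Cmod z * U * P)
        by (unfold U; ring).
      assert (V * Rpower (b + INR l * w) (INR (length D) - Re z) <= V * P)
        by (apply Rmult_le_compat_l; assumption).
      assert (0 <= U * P) by nra; assert (0 <= V * P) by nra.
      assert (0 <= Cmod z * (V * P)) by nra; nra.
Qed.

(** The frequency is restricted in the direction [w] only. Its error carries no [|z|]; the
    directions in [D] are treated crudely at exponent [z - 1], and their factor [1 + |z - 1|] is
    recovered by the division in [peel_direction]. *)
Lemma good_multi (th b0 w0 w1 dlt s1 : R) (k : nat) :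
  0 < th < 2 * PI -> 0 < b0 -> 0 < w0 -> 0 <= w1 -> 0 < dlt ->
  exists K, 0 < K /\ forall (w : R) (l n : nat) (D : list dir) (z : C) (b : R),
    length D = k -> steps_in w0 w1 ((w, l, n) :: D) -> b0 <= b ->
    INR k + dlt <= Re z <= s1 -> off_poles (S k) z ->
    Rabs (Im z) * w / (b + INR l * w) <= th ->
    Cmod (RS ((w, l, n) :: D) (fun y => cpow y (- z)) b - main_term ((w, l, n) :: D) z b)
      <= K * Rpower (b + INR l * w) (INR k - Re z).
Proof.
  intros Hth Hb0 Hw0 Hw1 Hd; assert (HK := psumK_pos b0 w0 dlt Hb0 Hw0 Hd).
  destruct (good_sum th b0 w0 w1 dlt s1 Hth Hb0 Hw0 Hd) as [A [HA HA']].
  assert (HKc := crudeK_nonneg b0 w0 w1 dlt k Hb0 Hw0 Hw1 Hd).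
  assert (HKk : 0 < psumK b0 w0 dlt ^ k) by now apply pow_lt.
  assert (Hid : 0 < / dlt) by now apply Rinv_0_lt_compat.
  assert (Hiw : 0 < / w0) by now apply Rinv_0_lt_compat.
  exists (A * psumK b0 w0 dlt ^ k + 2 * crudeK b0 w0 w1 dlt k * (1 + / dlt) / w0); split.
  { apply Rplus_lt_le_0_compat; [now apply Rmult_lt_0_compat|].
    unfold Rdiv; repeat apply Rmult_le_pos; lra. }
  intros w l n D z b <- HD Hb Hre Hz Ht.
  inversion HD as [|? ? Hw HD']; subst; unfold step_of in Hw; simpl in Hw.
  assert (Hl := pos_INR l); assert (Hk := pos_INR (length D)).
  rewrite Rmult_plus_distr_r.
  apply (peel_direction b0 w0 w1 dlt A (INR l * w) (crudeK b0 w0 w1 dlt (length D)));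
    try assumption; try lra; try nra.
  - destruct D as [|e D]; [left; reflexivity|right].
    eapply Rle_trans with (2 := Cmod_sub_real_ge z 1).
    change (length (e :: D)) with (S (length D)) in Hre; rewrite S_INR in Hre.
    assert (Hk' := pos_INR (length D)); lra.
  - intros x Hx; rewrite dsum_as_csum, ddiff_as_minus.
    apply HA'; try nra; [now apply off_poles_1 with (length D)|].
    eapply Rle_trans with (2 := Ht); unfold Rdiv; apply Rmult_le_compat_l.
    + apply Rmult_le_pos; [apply Rabs_pos|lra].
    + apply Rinv_le_contravar; nra.
  - intros x Hx; eapply Rle_trans; [apply (crude_multi b0 w0 w1 dlt)|]; try assumption.
    + unfold Cminus; rewrite re_plus, re_opp; simpl; lra.
    + now apply off_poles_pred.
    + right; f_equal; f_equal; unfold Cminus; rewrite re_plus, re_opp; simpl; lra.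
Qed.

Definition box_err (D : list dir) (z : C) (b : R) : C :=
  (RS D (fun y => cpow y (- z)) b - main_term D z b)%C.

Lemma step_prod_perm (D D' : list dir) : Permutation D D' -> step_prod D = step_prod D'.
Proof.
  unfold step_prod; intros H; induction H; simpl; rewrite ?IHPermutation; try ring; congruence.
Qed.

Lemma box_err_perm (D D' : list dir) (z : C) (b : R) :
  Permutation D D' -> box_err D z b = box_err D' z b.
Proof.
  intros H; unfold box_err, main_term.
  rewrite (iter_op_perm dsum D D'), (iter_op_perm ddiff D D'), (step_prod_perm D D'),
    (Permutation_length H) by (assumption || apply dsum_comm || apply ddiff_comm).
  reflexivity.
Qed.

(** Sum and main term are both additive in the subdivided direction; a permutation first brings that
    direction to the front. *)
Lemma box_err_split (w : R) (l n1 n2 : nat) (D1 D2 : list dir) (z : C) (b : R) :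
  box_err (D1 ++ (w, l, n1 + n2)%nat :: D2) z b
  = (box_err (D1 ++ (w, l, n1) :: D2) z b + box_err (D1 ++ (w, l + n1, n2)%nat :: D2) z b)%C.
Proof.
  assert (H : forall d, Permutation (D1 ++ d :: D2) (d :: D1 ++ D2))
    by (intros d; apply Permutation_sym, Permutation_middle).
  rewrite !(box_err_perm _ _ z b (H _)); set (D := D1 ++ D2).
  unfold box_err, main_term.
  change (length ((w, l, (n1 + n2)%nat) :: D)) with (S (length D)).
  change (length ((w, l, n1) :: D)) with (S (length D)).
  change (length ((w, (l + n1)%nat, n2) :: D)) with (S (length D)).
  change (step_prod ((w, l, (n1 + n2)%nat) :: D)) with (w * step_prod D).
  change (step_prod ((w, l, n1) :: D)) with (w * step_prod D).
  change (step_prod ((w, (l + n1)%nat, n2) :: D)) with (w * step_prod D).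
  cbn [iter_op dsum ddiff].
  rewrite csum_add, Nat.add_assoc.
  rewrite (csum_ext (fun m => iter_op dsum D (fun y => cpow y (- z)) (b + INR (l + (n1 + m)) * w))
     (fun m => iter_op dsum D (fun y => cpow y (- z)) (b + INR (l + n1 + m) * w)))
    by (intros; now rewrite Nat.add_assoc).
  ring.
Qed.

Fixpoint boxdirs (w : nat -> R) (r n : nat) : list dir :=
  match r with
  | O => nil
  | S r' => (w r', O, n) :: boxdirs w r' n
  end.

Lemma length_boxdirs (w : nat -> R) (r n : nat) : length (boxdirs w r n) = r.
Proof. induction r; simpl; congruence. Qed.

Lemma steps_in_boxdirs (w0 w1 : R) (w : nat -> R) (r n : nat) :
  (forall i, (i < r)%nat -> w0 <= w i <= w1) -> steps_in w0 w1 (boxdirs w r n).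
Proof.
  induction r as [|r IH]; intros H; constructor.
  - apply (H r); lia.
  - apply IH; intros; apply H; lia.
Qed.

(* Passing from [n] to [n + k] one direction at a time, each change is supported on a
   box having one direction restricted to [n, n + k). *)
Lemma box_err_diff (w0 w1 B : R) (w : nat -> R) (r k n q : nat) (D0 : list dir) (z : C) (b : R) :
  (forall i, (i < r)%nat -> w0 <= w i <= w1) -> steps_in w0 w1 D0 ->
  (length D0 + r = S q)%nat ->
  (forall i D, (i < r)%nat -> length D = q -> steps_in w0 w1 D ->
     Cmod (box_err ((w i, n, k) :: D) z b) <= B) ->
  Cmod (box_err (D0 ++ boxdirs w r (n + k)) z b - box_err (D0 ++ boxdirs w r n) z b) <= INR r * B.
Proof.
  revert D0; induction r as [|r IH]; intros D0 Hw HD0 Hlen HB.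
  - cbn [boxdirs]; unfold Cminus; rewrite Cplus_opp_r, Cmod_0; simpl; lra.
  - cbn [boxdirs]; rewrite box_err_split, Nat.add_0_l.
    assert (E : forall m, D0 ++ (w r, O, n) :: boxdirs w r m = (D0 ++ (w r, O, n) :: nil) ++ boxdirs w r m)
      by (intros; rewrite <- app_assoc; reflexivity).
    rewrite !E.
    assert (H1 := IH (D0 ++ (w r, O, n) :: nil)).
    assert (H1' : Cmod (box_err ((D0 ++ (w r, O, n) :: nil) ++ boxdirs w r (n + k)) z b
               - box_err ((D0 ++ (w r, O, n) :: nil) ++ boxdirs w r n) z b) <= INR r * B).
    { apply H1.
      - intros; apply Hw; lia.
      - apply Forall_app; split; [exact HD0|]; constructor; [apply (Hw r); lia|constructor].
      - rewrite length_app; simpl; lia.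
      - intros; apply HB; auto; lia. }
    assert (H2 : Cmod (box_err (D0 ++ (w r, n, k) :: boxdirs w r (n + k)) z b) <= B).
    { rewrite (box_err_perm _ ((w r, n, k) :: D0 ++ boxdirs w r (n + k)))
        by apply Permutation_sym, Permutation_middle.
      apply HB; [lia| |].
      - rewrite length_app, length_boxdirs; lia.
      - apply Forall_app; split; [exact HD0|]; apply steps_in_boxdirs; intros; apply Hw; lia. }
    rewrite S_INR.
    set (X := box_err ((D0 ++ (w r, O, n) :: nil) ++ boxdirs w r (n + k)) z b) in *.
    set (Y := box_err ((D0 ++ (w r, O, n) :: nil) ++ boxdirs w r n) z b) in *.
    set (Z := box_err (D0 ++ (w r, n, k) :: boxdirs w r (n + k)) z b) in *.
    replace (X + Z - Y)%C with ((X - Y) + Z)%C by ring.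
    eapply Rle_trans; [apply Cmod_triangle|]; lra.
Qed.

Lemma positive_bounds (w : nat -> R) (r : nat) :
  (forall i, (i < r)%nat -> 0 < w i) ->
  exists w0 w1, 0 < w0 <= 1 /\ 0 <= w1 /\ forall i, (i < r)%nat -> w0 <= w i <= w1.
Proof.
  induction r as [|r IH]; intros H.
  - exists 1, 0; split; [lra|]; split; [lra|]; intros; lia.
  - destruct IH as [w0 [w1 [H0 [H1 H2]]]]; [intros; apply H; lia|].
    exists (Rmin w0 (w r)), (Rmax w1 (w r)).
    assert (Hr := H r ltac:(lia)).
    assert (Ha := Rmin_l w0 (w r)); assert (Hb := Rmin_r w0 (w r)).
    assert (Hc := Rmax_l w1 (w r)); assert (Hd := Rmax_r w1 (w r)).
    split; [split; [apply Rmin_glb_lt; lra|lra]|]; split; [lra|].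
    intros i Hi; destruct (Nat.eq_dec i r) as [->|]; [lra|].
    assert (H3 := H2 i ltac:(lia)); lra.
Qed.

(** For [c <= 1] the power [c^p] is largest at the smallest exponent [e0], which makes the factor
    uniform in [p]; [positive_bounds] provides [w0 <= 1] for this purpose. *)
Lemma Rpower_mult_l (c x p e0 : R) :
  0 < c <= 1 -> 0 < x -> e0 <= p -> Rpower (c * x) p <= Rpower c e0 * Rpower x p.
Proof.
  intros Hc Hx Hp; rewrite <- Rpower_mult_distr by lra.
  apply Rmult_le_compat_r; [left; apply Rpower_pos|]; unfold Rpower; apply exp_le_mono.
  assert (ln c <= 0).
  { rewrite <- ln_1; destruct (Req_dec c 1) as [->|]; [lra|left; apply ln_increasing; lra]. }
  nra.
Qed.

Lemma box_err_cauchy (r : nat) (a th dlt s1 : R) (w : nat -> R) :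
  (1 <= r)%nat -> 0 < a -> (forall i, (i < r)%nat -> 0 < w i) -> 0 < th < 2 * PI -> 0 < dlt ->
  exists K, 0 < K /\ forall (n k : nat) (z : C),
    (1 <= n)%nat -> INR r - 1 + dlt <= Re z <= s1 -> off_poles r z -> Rabs (Im z) <= th * INR n ->
    Cmod (box_err (boxdirs w r (n + k)) z a - box_err (boxdirs w r n) z a)
      <= K * Rpower (INR n) (INR r - 1 - Re z).
Proof.
  intros Hr Ha Hw Hth Hd.
  destruct (positive_bounds w r Hw) as [w0 [w1 [Hw0 [Hw1 Hwb]]]].
  destruct r as [|q]; [lia|].
  destruct (good_multi th a w0 w1 dlt s1 q Hth Ha (proj1 Hw0) Hw1 Hd) as [K [HK HK']].
  assert (Hpw := Rpower_pos w0 (INR q - s1)).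
  assert (HI : 0 < INR (S q)) by (apply lt_0_INR; lia).
  exists (INR (S q) * (K * Rpower w0 (INR q - s1))); split.
  { repeat apply Rmult_lt_0_compat; assumption. }
  intros n k z Hn Hre Hz Ht.
  rewrite S_INR in Hre; replace (INR (S q) - 1 - Re z) with (INR q - Re z) by (rewrite S_INR; ring).
  assert (Hn' : 1 <= INR n) by (apply (le_INR 1); lia).
  rewrite (Rmult_assoc (INR (S q))).
  apply (box_err_diff w0 w1 (K * Rpower w0 (INR q - s1) * Rpower (INR n) (INR q - Re z))
           w (S q) k n q nil); [exact Hwb|constructor|reflexivity|].
  intros i D Hi HlD HD.
  assert (Hwi := Hwb i Hi).
  assert (Hnw : w0 * INR n <= a + INR n * w i) by nra.
  eapply Rle_trans.
  - apply HK'; try assumption; try lra.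
    + constructor; [exact Hwi|exact HD].
    (* The step cancels: [|Im z| w_i <= th n w_i <= th (a + n w_i)], so the same [th] bounds the
       frequency in every direction that starts at [n]. *)
    + assert (Hpos : 0 < a + INR n * w i) by nra.
      apply Rle_div_l; [lra|].
      assert (Rabs (Im z) * w i <= th * INR n * w i) by (apply Rmult_le_compat_r; lra).
      nra.
  - rewrite Rmult_assoc; apply Rmult_le_compat_l; [lra|].
    eapply Rle_trans; [apply (Rpower_decr (w0 * INR n)); nra|].
    apply Rpower_mult_l; lra.
Qed.

(** * Subset sums and the correction term *)

Lemma subset_sum_ext (w : nat -> R) (r : nat) (F G : nat -> R -> C) :
  (forall k u, F k u = G k u) -> subset_sum w r F = subset_sum w r G.
Proof.
  revert F G; induction r as [|r IH]; intros F G H; simpl; [apply H|].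
  f_equal; apply IH; intros; apply H.
Qed.

Lemma subset_sum_scal (w : nat -> R) (r : nat) (c : C) (F : nat -> R -> C) :
  subset_sum w r (fun k u => F k u * c)%C = (subset_sum w r F * c)%C.
Proof.
  revert F; induction r as [|r IH]; intros F; simpl; [reflexivity|].
  rewrite IH, (IH (fun k u => F (S k) (u + w r))); ring.
Qed.

Lemma subset_sum_minus (w : nat -> R) (r : nat) (F G : nat -> R -> C) :
  subset_sum w r (fun k u => F k u - G k u)%C = (subset_sum w r F - subset_sum w r G)%C.
Proof.
  revert F G; induction r as [|r IH]; intros F G; simpl; [reflexivity|].
  rewrite IH, (IH (fun k u => F (S k) (u + w r)) (fun k u => G (S k) (u + w r))); ring.
Qed.

Lemma subset_sum_nonempty (w : nat -> R) (r : nat) (F : nat -> R -> C) :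
  subset_sum w r (fun k u => match k with O => 0 | S _ => F k u end)
  = (subset_sum w r F - F O 0)%C.
Proof.
  revert F; induction r as [|r IH]; intros F; simpl; [ring|].
  rewrite IH; ring.
Qed.

(** The empty set is kept apart because decay of [(a + x u)^p] in [x] requires [u] to stay away from
    0, which holds with [u >= w0] for all other subsets. *)
Lemma subset_sum_bound (w : nat -> R) (r : nat) (w0 U B : R) (F : nat -> R -> C) :
  0 <= w0 -> (forall i, (i < r)%nat -> w0 <= w i <= U) ->
  (forall k u, (k = O /\ u = 0) \/ w0 <= u <= INR r * U -> Cmod (F k u) <= B) ->
  Cmod (subset_sum w r F) <= 2 ^ r * B.
Proof.
  intros Hw0; revert F; induction r as [|r IH]; intros F Hw HF.
  - simpl; rewrite Rmult_1_l; apply HF; now left.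
  - assert (Hwr := Hw r ltac:(lia)); assert (Hr := pos_INR r); rewrite S_INR in HF.
    simpl; eapply Rle_trans; [apply Cmod_triangle|].
    assert (H1 : Cmod (subset_sum w r F) <= 2 ^ r * B).
    { apply IH; [intros; apply Hw; lia|]; intros k u H; apply HF.
      destruct H as [H|H]; [now left|right]; nra. }
    assert (H2 : Cmod (subset_sum w r (fun k u => F (S k) (u + w r))) <= 2 ^ r * B).
    { apply IH; [intros; apply Hw; lia|]; intros k u H; apply HF; right.
      destruct H as [[-> ->]|H]; nra. }
    lra.
Qed.

(** When the iterated difference is expanded, a subset records the directions taken at the far end,
    each of which contributes a sign. *)
Lemma RI_boxdirs (w : nat -> R) (r n : nat) (F : R -> C) (b : R) :
  RI (boxdirs w r n) F b
  = subset_sum w r (fun k u => F (b + INR n * u)%R * RtoC ((-1) ^ k))%C.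
Proof.
  revert b; induction r as [|r IH]; intros b; cbn [boxdirs iter_op ddiff subset_sum].
  - rewrite Rmult_0_r, Rplus_0_r; simpl; now rewrite Cmult_1_r.
  - rewrite !IH, Nat.add_0_l, Rmult_0_l, Rplus_0_r.
    rewrite (subset_sum_ext w r (fun k u => F (b + INR n * (u + w r))%R * RtoC ((-1) ^ S k))%C
      (fun k u => F (b + INR n * w r + INR n * u)%R * RtoC ((-1) ^ k) * RtoC (-1))%C).
    + rewrite subset_sum_scal; ring.
    + intros k u; replace (b + INR n * (u + w r)) with (b + INR n * w r + INR n * u) by ring.
      simpl; rewrite RtoC_mult; ring.
Qed.

Lemma step_prod_boxdirs (w : nat -> R) (r n : nat) : step_prod (boxdirs w r n) = wprod w r.
Proof.
  induction r as [|r IH]; simpl; [reflexivity|].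
  rewrite <- IH; unfold step_of; simpl; ring.
Qed.

Lemma box_sum_RS (w : nat -> R) (r n : nat) (F : R -> C) :
  box_sum w r n F = RS (boxdirs w r (S n)) F 0.
Proof.
  revert F; induction r as [|r IH]; intros F; [reflexivity|].
  cbn [boxdirs iter_op dsum box_sum].
  rewrite sum_n_csum; apply csum_ext; intros m _.
  rewrite IH, RS_shift, Nat.add_0_l; f_equal.
Qed.

Lemma barnes_box_RS (r : nat) (a : R) (w : nat -> R) (s : C) (n : nat) :
  barnes_box r a w s n = RS (boxdirs w r (S n)) (fun y => cpow y (- s)) a.
Proof.
  unfold barnes_box; rewrite box_sum_RS.
  transitivity (RS (boxdirs w r (S n)) (fun x => cpow (x + a) (- s)) 0).
  - f_equal; apply functional_extensionality; intros u; now rewrite Rplus_comm.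
  - rewrite (RS_shift _ (fun y => cpow y (- s))); now rewrite Rplus_0_l.
Qed.

(** The two differ by the corner at the origin, that is, the empty set. It does not depend on [n]
    and so cancels when two cutoffs are compared. *)
Lemma corr_term_main (r : nat) (a : R) (w : nat -> R) (s : C) (n : nat) :
  corr_term r a w (INR n) s
  = (main_term (boxdirs w r n) s a
     - cpow a (INR r - s) * / (poch r s * RtoC (wprod w r)))%C.
Proof.
  unfold corr_term, main_term; rewrite RI_boxdirs, length_boxdirs, step_prod_boxdirs.
  rewrite (subset_sum_nonempty w r (fun k u =>
     (RtoC ((-1) ^ k) * cpow (a + INR n * u) (INR r - s) / (poch r s * RtoC (wprod w r))))%C).
  rewrite Rmult_0_r, Rplus_0_r, <- subset_sum_scal; f_equal.
  - apply subset_sum_ext; intros; unfold Cdiv; ring.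
  - unfold Cdiv; simpl pow; ring.
Qed.

(* [barnes_box] has [m_i <= n], i.e. [n + 1] points per direction, whence the correction at [n + 1]. *)
Definition reg_box (r : nat) (a : R) (w : nat -> R) (n : nat) (s : C) : C :=
  (barnes_box r a w s n - corr_term r a w (INR (S n)) s)%C.

Lemma reg_box_box_err (r : nat) (a : R) (w : nat -> R) (n : nat) (s : C) :
  reg_box r a w n s
  = (box_err (boxdirs w r (S n)) s a + cpow a (INR r - s) * / (poch r s * RtoC (wprod w r)))%C.
Proof.
  unfold reg_box, box_err; rewrite barnes_box_RS, corr_term_main; ring.
Qed.

Lemma reg_box_cauchy (r : nat) (a th dlt s1 : R) (w : nat -> R) :
  (1 <= r)%nat -> 0 < a -> (forall i, (i < r)%nat -> 0 < w i) -> 0 < th < 2 * PI -> 0 < dlt ->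
  exists K, 0 < K /\ forall (n k : nat) (z : C),
    INR r - 1 + dlt <= Re z <= s1 -> off_poles r z -> Rabs (Im z) <= th * INR (S n) ->
    Cmod (reg_box r a w (n + k) z - reg_box r a w n z)
      <= K * Rpower (INR (S n)) (INR r - 1 - Re z).
Proof.
  intros Hr Ha Hw Hth Hd.
  destruct (box_err_cauchy r a th dlt s1 w Hr Ha Hw Hth Hd) as [K [HK H]].
  exists K; split; [exact HK|]; intros n k z Hre Hz Ht.
  rewrite !reg_box_box_err.
  assert (H1 := H (S n) k z ltac:(lia) Hre Hz Ht).
  change (S n + k)%nat with (S (n + k)) in H1.
  eapply Rle_trans with (2 := H1); right; f_equal; ring.
Qed.

(** * Goursat's theorem and a uniqueness principle *)

Definition ccont (f : C -> C) (z : C) : Prop :=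
  forall eps, 0 < eps -> exists d, 0 < d /\ forall y, Cmod (y - z) < d -> Cmod (f y - f z) < eps.

(* Caratheodory's form of complex differentiability, with [phi z] the derivative. *)
Definition cdiff (f : C -> C) (z : C) : Prop :=
  exists phi, (forall y, f y = (f z + phi y * (y - z))%C) /\ ccont phi z.

Lemma Cmod_minus_diag (x : C) : Cmod (x - x) = 0.
Proof. unfold Cminus; now rewrite Cplus_opp_r, Cmod_0. Qed.

Lemma ccont_const (c z : C) : ccont (fun _ => c) z.
Proof. intros eps H; exists 1; split; [lra|]; intros; rewrite Cmod_minus_diag; exact H. Qed.

Lemma ccont_id (z : C) : ccont (fun y => y) z.
Proof. intros eps H; exists eps; split; [lra|]; auto. Qed.

Lemma ccont_plus (f g : C -> C) (z : C) :
  ccont f z -> ccont g z -> ccont (fun y => f y + g y)%C z.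
Proof.
  intros Hf Hg eps H.
  destruct (Hf (eps / 2) ltac:(lra)) as [d1 [H1 H1']].
  destruct (Hg (eps / 2) ltac:(lra)) as [d2 [H2 H2']].
  exists (Rmin d1 d2); split; [now apply Rmin_glb_lt|]; intros y Hy.
  assert (Ha := H1' y ltac:(eapply Rlt_le_trans; [exact Hy|apply Rmin_l])).
  assert (Hb := H2' y ltac:(eapply Rlt_le_trans; [exact Hy|apply Rmin_r])).
  replace (f y + g y - (f z + g z))%C with ((f y - f z) + (g y - g z))%C by ring.
  eapply Rle_lt_trans; [apply Cmod_triangle|]; lra.
Qed.

Lemma ccont_mult (f g : C -> C) (z : C) :
  ccont f z -> ccont g z -> ccont (fun y => f y * g y)%C z.
Proof.
  intros Hf Hg eps H.
  set (A := 1 + Cmod (g z) + Cmod (f z)).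
  assert (Hgz := Cmod_ge_0 (g z)); assert (Hfz := Cmod_ge_0 (f z)).
  assert (HA : 0 < A) by (unfold A; lra).
  set (e := Rmin 1 (eps / (2 * A))).
  assert (He : 0 < e) by (apply Rmin_glb_lt; [lra|apply Rdiv_lt_0_compat; lra]).
  assert (He1 : e <= 1) by apply Rmin_l.
  assert (He2 : e * A <= eps / 2).
  { apply Rle_trans with (eps / (2 * A) * A); [apply Rmult_le_compat_r; [lra|apply Rmin_r]|].
    right; field; lra. }
  destruct (Hf e He) as [d1 [H1 H1']].
  destruct (Hg e He) as [d2 [H2 H2']].
  exists (Rmin d1 d2); split; [now apply Rmin_glb_lt|]; intros y Hy.
  assert (Ha := H1' y ltac:(eapply Rlt_le_trans; [exact Hy|apply Rmin_l])).
  assert (Hb := H2' y ltac:(eapply Rlt_le_trans; [exact Hy|apply Rmin_r])).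
  replace (f y * g y - f z * g z)%C
    with ((f y - f z) * (g y - g z) + ((f y - f z) * g z + f z * (g y - g z)))%C by ring.
  eapply Rle_lt_trans; [apply Cmod_triangle|].
  eapply Rle_lt_trans; [apply Rplus_le_compat_l, Cmod_triangle|].
  rewrite !Cmod_mult.
  assert (Hp := Cmod_ge_0 (f y - f z)); assert (Hq := Cmod_ge_0 (g y - g z)).
  unfold A in He2; nra.
Qed.

Lemma ccont_comp (f g : C -> C) (z : C) :
  ccont g z -> ccont f (g z) -> ccont (fun y => f (g y)) z.
Proof.
  intros Hg Hf eps H.
  destruct (Hf eps H) as [d1 [H1 H1']]; destruct (Hg d1 H1) as [d2 [H2 H2']].
  exists d2; split; auto.
Qed.

Lemma ccont_ext_near (f g : C -> C) (z : C) (d : R) :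
  0 < d -> (forall y, Cmod (y - z) < d -> f y = g y) -> ccont f z -> ccont g z.
Proof.
  intros Hd E Hf eps H; destruct (Hf eps H) as [d1 [H1 H1']].
  exists (Rmin d d1); split; [now apply Rmin_glb_lt|]; intros y Hy.
  rewrite <- (E y), <- (E z).
  - apply H1'; eapply Rlt_le_trans; [exact Hy|apply Rmin_r].
  - now rewrite Cmod_minus_diag.
  - eapply Rlt_le_trans; [exact Hy|apply Rmin_l].
Qed.

Lemma ccont_inv (z : C) : z <> 0 -> ccont Cinv z.
Proof.
  intros Hz eps H; assert (Hm := proj1 (Cmod_gt_0 z) Hz); set (m := Cmod z) in *.
  exists (Rmin (m / 2) (eps * (m * m) / 2)); split.
  { apply Rmin_glb_lt; [lra|]; assert (0 < m * m) by nra; nra. }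
  intros y Hy.
  assert (Ha := Rlt_le_trans _ _ _ Hy (Rmin_l _ _)).
  assert (Hb := Rlt_le_trans _ _ _ Hy (Rmin_r _ _)).
  assert (Hym : m / 2 < Cmod y).
  { assert (m <= Cmod y + Cmod (y - z)); [|lra].
    unfold m; replace z with (y - (y - z))%C at 1 by ring; apply Cmod_minus_le. }
  assert (Hy0 : y <> 0) by (apply Cmod_gt_0; lra).
  replace (/ y - / z)%C with (- ((y - z) * / (y * z)))%C by (field; now split).
  rewrite Cmod_opp, Cmod_mult, Cmod_inv, Cmod_mult by now apply Cmult_neq_0.
  fold m; apply Rlt_div_l; [nra|].
  eapply Rlt_le_trans; [exact Hb|].
  replace (eps * (m * m) / 2) with (eps * (m / 2 * m)) by field.
  apply Rmult_le_compat_l; [lra|]; apply Rmult_le_compat_r; lra.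
Qed.

Lemma cdiff_ccont (f : C -> C) (z : C) : cdiff f z -> ccont f z.
Proof.
  intros [phi [E Hphi]].
  apply (ccont_ext_near (fun y => f z + phi y * (y - z))%C f z 1); [lra|intros; now rewrite <- E|].
  apply ccont_plus; [apply ccont_const|apply ccont_mult; [exact Hphi|]].
  apply (ccont_plus (fun y => y)); [apply ccont_id|apply ccont_const].
Qed.

Lemma cdiff_const (c z : C) : cdiff (fun _ => c) z.
Proof. exists (fun _ => RtoC 0); split; [intros; ring|apply ccont_const]. Qed.

Lemma cdiff_id (z : C) : cdiff (fun y => y) z.
Proof. exists (fun _ => RtoC 1); split; [intros; ring|apply ccont_const]. Qed.

Lemma cdiff_plus (f g : C -> C) (z : C) :
  cdiff f z -> cdiff g z -> cdiff (fun y => f y + g y)%C z.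
Proof.
  intros [p [Ep Hp]] [q [Eq Hq]]; exists (fun y => p y + q y)%C; split.
  - intros y; rewrite (Ep y), (Eq y); ring.
  - now apply ccont_plus.
Qed.

Lemma cdiff_mult (f g : C -> C) (z : C) :
  cdiff f z -> cdiff g z -> cdiff (fun y => f y * g y)%C z.
Proof.
  intros Hf Hg; assert (Hgc := cdiff_ccont _ _ Hg).
  destruct Hf as [p [Ep Hp]], Hg as [q [Eq Hq]].
  exists (fun y => p y * g y + f z * q y)%C; split.
  - intros y; rewrite (Ep y), (Eq y); ring.
  - apply ccont_plus; apply ccont_mult; auto; apply ccont_const.
Qed.

Lemma cdiff_opp (f : C -> C) (z : C) : cdiff f z -> cdiff (fun y => - f y)%C z.
Proof.
  intros [p [Ep Hp]]; exists (fun y => RtoC (-1) * p y)%C; split.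
  - intros y; rewrite (Ep y); ring.
  - apply ccont_mult; [apply ccont_const|exact Hp].
Qed.

Lemma cdiff_minus (f g : C -> C) (z : C) :
  cdiff f z -> cdiff g z -> cdiff (fun y => f y - g y)%C z.
Proof. intros Hf Hg; apply cdiff_plus; [|apply cdiff_opp]; assumption. Qed.

Lemma cdiff_comp (f g : C -> C) (z : C) :
  cdiff g z -> cdiff f (g z) -> cdiff (fun y => f (g y)) z.
Proof.
  intros Hg Hf; assert (Hgc := cdiff_ccont _ _ Hg).
  destruct Hf as [p [Ep Hp]], Hg as [q [Eq Hq]].
  exists (fun y => p (g y) * q y)%C; split.
  - intros y; rewrite (Ep (g y)); rewrite (Eq y) at 2; ring.
  - apply ccont_mult; [now apply ccont_comp|exact Hq].
Qed.

Lemma cdiff_Cinv (z : C) : z <> 0 -> cdiff Cinv z.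
Proof.
  (* The factorization is required at every [y], so at [y = 0] the value of [phi] is solved for from
     whatever [/ 0] is; continuity is only tested near [z <> 0]. *)
  intros Hz; exists (fun y => if Ceq_dec y 0 then (/ z * / z - / z * / RtoC 0)%C else (- (/ y * / z))%C); split.
  - intros y; destruct (Ceq_dec y 0) as [->|Hy].
    + transitivity (/ RtoC 0 * (z * / z))%C; [rewrite Cinv_r by exact Hz; ring|].
      replace (/ z + (/ z * / z - / z * / RtoC 0) * (0 - z))%C
        with (/ z - / z * (z * / z) + / RtoC 0 * (z * / z))%C by ring.
      rewrite Cinv_r by exact Hz; ring.
    + field; split; assumption.
  - assert (Hm := proj1 (Cmod_gt_0 z) Hz).
    apply (ccont_ext_near (fun y => RtoC (-1) * (/ y * / z))%C _ z (Cmod z)); [exact Hm| |].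
    + intros y Hy; destruct (Ceq_dec y 0) as [->|_]; [|ring].
      exfalso; revert Hy; replace (0 - z)%C with (- z)%C by ring; rewrite Cmod_opp; lra.
    + apply ccont_mult; [apply ccont_const|]; apply ccont_mult; [now apply ccont_inv|apply ccont_const].
Qed.

Lemma cdiff_inv (f : C -> C) (z : C) : cdiff f z -> f z <> 0 -> cdiff (fun y => / f y)%C z.
Proof. intros Hf Hz; apply (cdiff_comp Cinv f); [exact Hf|now apply cdiff_Cinv]. Qed.

Lemma cdiff_cexp_id (z : C) : cdiff cexp z.
Proof.
  exists (fun y => if Ceq_dec y z then cexp z else cexp z * ((cexp (y - z) - 1) / (y - z)))%C; split.
  - intros y; destruct (Ceq_dec y z) as [->|Hy]; [ring|].
    assert (H := Cminus_eq_contra _ _ Hy).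
    replace y with (z + (y - z))%C at 1 by ring; rewrite cexp_plus; field; exact H.
  - intros eps He; destruct (Ceq_dec z z) as [_|]; [|tauto].
    set (m := Cmod (cexp z)).
    assert (Hm : 0 < m) by (apply Cmod_gt_0, cexp_neq_0).
    assert (He1 := exp_pos 1).
    exists (Rmin 1 (eps / (m * exp 1))); split.
    { apply Rmin_glb_lt; [lra|]; apply Rdiv_lt_0_compat; [lra|nra]. }
    intros y Hy; destruct (Ceq_dec y z) as [->|Hyz].
    { now rewrite Cmod_minus_diag. }
    assert (Ha := Rlt_le_trans _ _ _ Hy (Rmin_l _ _)).
    assert (Hb := Rlt_le_trans _ _ _ Hy (Rmin_r _ _)).
    assert (H := Cminus_eq_contra _ _ Hyz); set (h := (y - z)%C) in *.
    assert (Hh := proj1 (Cmod_gt_0 h) H).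
    replace (cexp z * ((cexp h - 1) / h) - cexp z)%C with (cexp z * ((cexp h - 1 - h) / h))%C
      by (field; exact H).
    rewrite Cmod_mult, Cmod_div by exact H; fold m.
    assert (H1 : Cmod (cexp h - 1 - h) / Cmod h <= Cmod h * exp 1).
    { apply Rle_div_l; [exact Hh|]; eapply Rle_trans; [apply cexp_minus_1_minus_id|].
      rewrite (Rmult_comm (Cmod h * exp 1)); apply Rmult_le_compat_l; [lra|].
      apply Rmult_le_compat_l; [lra|]; apply exp_le_mono; lra. }
    apply Rle_lt_trans with (m * (Cmod h * exp 1)); [apply Rmult_le_compat_l; lra|].
    apply Rlt_le_trans with (m * (eps / (m * exp 1) * exp 1)).
    + apply Rmult_lt_compat_l; [exact Hm|]; apply Rmult_lt_compat_r; assumption.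
    + right; field; split; lra.
Qed.

Lemma cdiff_cexp (f : C -> C) (z : C) : cdiff f z -> cdiff (fun y => cexp (f y)) z.
Proof. intros Hf; apply (cdiff_comp cexp f); [exact Hf|apply cdiff_cexp_id]. Qed.

Lemma cdiff_estimate (f : C -> C) (z : C) :
  cdiff f z -> exists l, forall eps, 0 < eps -> exists d, 0 < d /\
    forall y, Cmod (y - z) < d -> Cmod (f y - f z - l * (y - z)) <= eps * Cmod (y - z).
Proof.
  intros [phi [E Hphi]]; exists (phi z); intros eps He.
  destruct (Hphi eps He) as [d [Hd H]]; exists d; split; [exact Hd|]; intros y Hy.
  rewrite (E y); replace (f z + phi y * (y - z) - f z - phi z * (y - z))%C
    with ((phi y - phi z) * (y - z))%C by ring.
  rewrite Cmod_mult; apply Rmult_le_compat_r; [apply Cmod_ge_0|left; now apply H].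
Qed.

Lemma ex_derive_cdiff (f : C -> C) (z : C) :
  @ex_derive C_AbsRing C_NormedModule f z -> cdiff f z.
Proof.
  intros [l [_ Hl]].
  specialize (Hl z (fun P HP => HP)).
  exists (fun y => if Ceq_dec y z then l else (f y - f z) / (y - z))%C; split.
  - intros y; destruct (Ceq_dec y z) as [->|Hy]; [ring|].
    field; now apply Cminus_eq_contra.
  - intros eps He; destruct (Ceq_dec z z) as [_|]; [|tauto].
    assert (He2 : 0 < eps / 2) by lra.
    specialize (Hl (mkposreal _ He2)).
    apply locally_C in Hl; destruct Hl as [d Hd]; simpl in Hd.
    exists d; split; [apply cond_pos|]; intros y Hy.
    destruct (Ceq_dec y z) as [->|Hyz]; [now rewrite Cmod_minus_diag|].
    assert (H := Cminus_eq_contra _ _ Hyz).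
    assert (Hh := proj1 (Cmod_gt_0 (y - z)) H).
    assert (H1 : Cmod (f y - f z - (y - z) * l) <= eps / 2 * Cmod (y - z)) by exact (Hd y (C_NormedModule_mixin_compat1 z y d Hy)).
    replace ((f y - f z) / (y - z) - l)%C with ((f y - f z - (y - z) * l) / (y - z))%C
      by (field; exact H).
    rewrite Cmod_div by exact H; apply Rlt_div_l; [exact Hh|]; nra.
Qed.

(** * Integrals over segments and rectangles *)

Definition rcont (f : R -> C) (x : R) : Prop :=
  continuous (fun t => Re (f t)) x /\ continuous (fun t => Im (f t)) x.

Lemma continuous_eps (g : R -> R) (x : R) :
  (forall eps, 0 < eps -> exists d, 0 < d /\ forall t, Rabs (t - x) < d -> Rabs (g t - g x) < eps) ->
  continuous g x.
Proof.
  intros H P [e He]; destruct (H e (cond_pos e)) as [d [Hd H']].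
  exists (mkposreal d Hd); intros t Ht; apply He, H', Ht.
Qed.

Lemma ccont_rcont (f : C -> C) (p : R -> C) (x : R) :
  (forall s t, Cmod (p s - p t) = Rabs (s - t)) -> ccont f (p x) -> rcont (fun t => f (p t)) x.
Proof.
  intros Hp H; split; apply continuous_eps; intros eps He; destruct (H eps He) as [d [Hd H']];
    exists d; (split; [exact Hd|]); intros t Ht; rewrite <- Hp in Ht; specialize (H' _ Ht);
    (eapply Rle_lt_trans; [|exact H']).
  - unfold Rminus; rewrite <- re_opp, <- re_plus; apply re_le_Cmod.
  - unfold Rminus; rewrite <- im_opp, <- im_plus; apply Im_le_Cmod.
Qed.

Lemma ccont_horizontal (f : C -> C) (x y : R) : ccont f (x, y) -> rcont (fun t => f (t, y)) x.
Proof.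
  apply (ccont_rcont f (fun t => (t, y))).
  intros s t; rewrite <- Cmod_R; f_equal; apply injective_projections; simpl; ring.
Qed.

Lemma ccont_vertical (f : C -> C) (x y : R) : ccont f (x, y) -> rcont (fun t => f (x, t)) y.
Proof.
  apply (ccont_rcont f (fun t => (x, t))).
  intros s t; transitivity (Cmod (Ci * RtoC (s - t))).
  - f_equal; apply injective_projections; simpl; ring.
  - now rewrite Cmod_mult, Cmod_Ci, Cmod_R, Rmult_1_l.
Qed.

Lemma rcont_minus (f g : R -> C) (x : R) : rcont f x -> rcont g x -> rcont (fun t => f t - g t)%C x.
Proof.
  intros [H1 H2] [H3 H4]; split.
  - now apply (continuous_minus (fun t => Re (f t)) (fun t => Re (g t))).
  - now apply (continuous_minus (fun t => Im (f t)) (fun t => Im (g t))).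
Qed.

Lemma rcont_const (c : C) (x : R) : rcont (fun _ => c) x.
Proof. split; apply continuous_const. Qed.

Definition cint (f : R -> C) (a b : R) : C :=
  (RInt (fun t => Re (f t)) a b, RInt (fun t => Im (f t)) a b).

Definition rcont_on (f : R -> C) (a b : R) : Prop := forall x, a <= x <= b -> rcont f x.

Lemma rcont_on_ex_RInt (f : R -> C) (a b : R) :
  a <= b -> rcont_on f a b ->
  ex_RInt (fun t => Re (f t)) a b /\ ex_RInt (fun t => Im (f t)) a b.
Proof.
  intros Hab H; split; apply (ex_RInt_continuous (V := R_CompleteNormedModule));
    intros x Hx; rewrite Rmin_left, Rmax_right in Hx by exact Hab; apply (H x Hx).
Qed.

Lemma rcont_on_minus (f g : R -> C) (a b : R) :
  rcont_on f a b -> rcont_on g a b -> rcont_on (fun t => f t - g t)%C a b.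
Proof. intros Hf Hg x Hx; apply rcont_minus; auto. Qed.

Lemma rcont_on_sub (f : R -> C) (a b c d : R) :
  a <= c -> d <= b -> rcont_on f a b -> rcont_on f c d.
Proof. intros H1 H2 H x Hx; apply H; lra. Qed.

Lemma cint_minus (f g : R -> C) (a b : R) :
  a <= b -> rcont_on f a b -> rcont_on g a b ->
  cint (fun t => f t - g t)%C a b = (cint f a b - cint g a b)%C.
Proof.
  intros Hab Hf Hg.
  destruct (rcont_on_ex_RInt f a b Hab Hf) as [H1 H2], (rcont_on_ex_RInt g a b Hab Hg) as [H3 H4].
  apply injective_projections; simpl.
  - exact (RInt_minus (V := R_CompleteNormedModule) _ _ a b H1 H3).
  - exact (RInt_minus (V := R_CompleteNormedModule) _ _ a b H2 H4).
Qed.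

Lemma cint_chasles (f : R -> C) (a b c : R) :
  a <= b <= c -> rcont_on f a c -> cint f a c = (cint f a b + cint f b c)%C.
Proof.
  intros Hab Hf.
  destruct (rcont_on_ex_RInt f a b) as [H1 H2]; [lra|now apply (rcont_on_sub f a c); try lra|].
  destruct (rcont_on_ex_RInt f b c) as [H3 H4]; [lra|now apply (rcont_on_sub f a c); try lra|].
  apply injective_projections; simpl; symmetry.
  - exact (RInt_Chasles (V := R_CompleteNormedModule) _ a b c H1 H3).
  - exact (RInt_Chasles (V := R_CompleteNormedModule) _ a b c H2 H4).
Qed.

Lemma cint_const (c : C) (a b : R) : cint (fun _ => c) a b = (c * RtoC (b - a))%C.
Proof.
  unfold cint; rewrite !RInt_const; apply injective_projections; simpl.
  - change (scal (b - a) (Re c)) with ((b - a) * Re c); unfold Re; ring.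
  - change (scal (b - a) (Im c)) with ((b - a) * Im c); unfold Im; ring.
Qed.

Lemma cint_ext (f g : R -> C) (a b : R) :
  a <= b -> (forall x, a <= x <= b -> f x = g x) -> cint f a b = cint g a b.
Proof.
  intros Hab H; apply injective_projections; apply RInt_ext;
    intros x Hx; rewrite Rmin_left, Rmax_right in Hx by exact Hab; rewrite H by lra; reflexivity.
Qed.

(** The factor 2 comes from bounding real and imaginary parts separately. *)
Lemma cint_bound (f : R -> C) (a b M : R) :
  a <= b -> rcont_on f a b -> (forall x, a <= x <= b -> Cmod (f x) <= M) ->
  Cmod (cint f a b) <= 2 * M * (b - a).
Proof.
  intros Hab Hf HM; destruct (rcont_on_ex_RInt f a b Hab Hf) as [H1 H2].
  eapply Rle_trans; [apply Cmod_le_Re_Im|]; unfold cint.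
  assert (Ha : Rabs (RInt (fun t => Re (f t)) a b) <= (b - a) * M).
  { apply abs_RInt_le_const; [exact Hab|exact H1|].
    intros t Ht; eapply Rle_trans; [apply re_le_Cmod|now apply HM]. }
  assert (Hb : Rabs (RInt (fun t => Im (f t)) a b) <= (b - a) * M).
  { apply abs_RInt_le_const; [exact Hab|exact H2|].
    intros t Ht; eapply Rle_trans; [apply Im_le_Cmod|now apply HM]. }
  apply Rle_trans with
    (Rabs (RInt (fun t => Re (f t)) a b) + Rabs (RInt (fun t => Im (f t)) a b)); [right; reflexivity|lra].
Qed.

Lemma cint_near_const (f : R -> C) (c : C) (a b M : R) :
  a <= b -> rcont_on f a b -> (forall x, a <= x <= b -> Cmod (f x - c) <= M) ->
  Cmod (cint f a b - c * RtoC (b - a)) <= 2 * M * (b - a).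
Proof.
  intros Hab Hf HM; rewrite <- cint_const, <- cint_minus; try assumption.
  - apply cint_bound; try assumption; apply rcont_on_minus; [exact Hf|].
    intros x _; apply rcont_const.
  - intros x _; apply rcont_const.
Qed.

Definition ccont_rect (f : C -> C) (x1 x2 y1 y2 : R) : Prop :=
  forall x y, x1 <= x <= x2 -> y1 <= y <= y2 -> ccont f (x, y).

(** The counterclockwise contour integral, with opposite sides paired in one integrand so that an
    affine [f] gives a constant on each pair. *)
Definition rect_int (f : C -> C) (x1 x2 y1 y2 : R) : C :=
  (cint (fun x => f (x, y1) - f (x, y2)) x1 x2
   + Ci * cint (fun y => f (x2, y) - f (x1, y)) y1 y2)%C.

Lemma rect_int_split_x (f : C -> C) (x1 xm x2 y1 y2 : R) :
  x1 <= xm <= x2 -> y1 <= y2 -> ccont_rect f x1 x2 y1 y2 ->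
  rect_int f x1 x2 y1 y2 = (rect_int f x1 xm y1 y2 + rect_int f xm x2 y1 y2)%C.
Proof.
  intros Hx Hy H; unfold rect_int.
  assert (Hv : forall x, x1 <= x <= x2 -> rcont_on (fun y => f (x, y)) y1 y2)
    by (intros x Hx' y Hy'; apply ccont_vertical, H; assumption).
  assert (Hh : forall y, y1 <= y <= y2 -> rcont_on (fun x => f (x, y)) x1 x2)
    by (intros y Hy' x Hx'; apply ccont_horizontal, H; assumption).
  rewrite (cint_chasles _ x1 xm x2) by (try lra; apply rcont_on_minus; apply Hh; lra).
  rewrite !(cint_minus (fun y => f (_, y))) by (try lra; apply Hv; lra).
  ring.
Qed.

Lemma rect_int_split_y (f : C -> C) (x1 x2 y1 ym y2 : R) :
  x1 <= x2 -> y1 <= ym <= y2 -> ccont_rect f x1 x2 y1 y2 ->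
  rect_int f x1 x2 y1 y2 = (rect_int f x1 x2 y1 ym + rect_int f x1 x2 ym y2)%C.
Proof.
  intros Hx Hy H; unfold rect_int.
  assert (Hv : forall x, x1 <= x <= x2 -> rcont_on (fun y => f (x, y)) y1 y2)
    by (intros x Hx' y Hy'; apply ccont_vertical, H; assumption).
  assert (Hh : forall y, y1 <= y <= y2 -> rcont_on (fun x => f (x, y)) x1 x2)
    by (intros y Hy' x Hx'; apply ccont_horizontal, H; assumption).
  rewrite (cint_chasles _ y1 ym y2) by (try lra; apply rcont_on_minus; apply Hv; lra).
  rewrite !(cint_minus (fun x => f (x, _))) by (try lra; apply Hh; lra).
  ring.
Qed.

(** The affine part contributes [- i l h w] from the horizontal pair and [i l w h] from the vertical
    one, which cancel; in each pair the integrand is within [2 e] of its constant. *)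
Lemma rect_int_local_bound (f : C -> C) (l p : C) (x1 x2 y1 y2 e : R) :
  x1 <= x2 -> y1 <= y2 -> ccont_rect f x1 x2 y1 y2 ->
  (forall x y, x1 <= x <= x2 -> y1 <= y <= y2 ->
     Cmod (f (x, y) - f p - l * ((x, y) - p)) <= e) ->
  Cmod (rect_int f x1 x2 y1 y2) <= 4 * e * ((x2 - x1) + (y2 - y1)).
Proof.
  intros Hx Hy H He; unfold rect_int.
  set (w := x2 - x1); set (h := y2 - y1).
  assert (HA : Cmod (cint (fun x => f (x, y1) - f (x, y2))%C x1 x2 - (- (l * (Ci * RtoC h))) * RtoC w)
                 <= 2 * (2 * e) * w).
  { apply cint_near_const; [exact Hx| |].
    - intros x Hx'; apply rcont_minus; apply ccont_horizontal, H; lra.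
    - intros x Hx'.
      replace (f (x, y1) - f (x, y2) - - (l * (Ci * h)))%C
        with ((f (x, y1) - f p - l * ((x, y1) - p)) - (f (x, y2) - f p - l * ((x, y2) - p)))%C.
      + eapply Rle_trans; [apply Cmod_minus_le|].
        assert (H1 := He x y1 Hx' ltac:(lra)); assert (H2 := He x y2 Hx' ltac:(lra)); lra.
      + replace (x, y2) with ((x, y1) + Ci * RtoC h)%C; [ring|].
        unfold h; apply injective_projections; simpl; ring. }
  assert (HB : Cmod (cint (fun y => f (x2, y) - f (x1, y))%C y1 y2 - (l * RtoC w) * RtoC h)
                 <= 2 * (2 * e) * h).
  { apply cint_near_const; [exact Hy| |].
    - intros y Hy'; apply rcont_minus; apply ccont_vertical, H; lra.
    - intros y Hy'.
      replace (f (x2, y) - f (x1, y) - l * w)%C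
        with ((f (x2, y) - f p - l * ((x2, y) - p)) - (f (x1, y) - f p - l * ((x1, y) - p)))%C.
      + eapply Rle_trans; [apply Cmod_minus_le|].
        assert (H1 := He x2 y ltac:(lra) Hy'); assert (H2 := He x1 y ltac:(lra) Hy'); lra.
      + replace (x2, y) with ((x1, y) + RtoC w)%C; [ring|].
        unfold w; apply injective_projections; simpl; ring. }
  set (A := cint (fun x => f (x, y1) - f (x, y2))%C x1 x2) in *.
  set (B := cint (fun y => f (x2, y) - f (x1, y))%C y1 y2) in *.
  replace (A + Ci * B)%C
    with ((A - - (l * (Ci * RtoC h)) * RtoC w) + Ci * (B - l * RtoC w * RtoC h))%C by ring.
  eapply Rle_trans; [apply Cmod_triangle|]; rewrite Cmod_mult, Cmod_Ci; lra.
Qed.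

(* Goursat's lemma, by repeated quartering: the integral over some quarter is always at
   least a quarter of the integral. *)
Lemma rect_int_zero (f : C -> C) (x0 y0 W H : R) :
  0 < W -> 0 < H ->
  (forall x y, x0 <= x <= x0 + W -> y0 <= y <= y0 + H -> cdiff f (x, y)) ->
  rect_int f x0 (x0 + W) y0 (y0 + H) = 0.
Proof.
  intros HW HH Hf; apply Cmod_eq_0.
  destruct (Rle_lt_or_eq_dec _ _ (Cmod_ge_0 (rect_int f x0 (x0 + W) y0 (y0 + H)))) as [Hpos|E];
    [exfalso|now symmetry].
  set (eta := Cmod (rect_int f x0 (x0 + W) y0 (y0 + H))) in *.
  assert (Hc : ccont_rect f x0 (x0 + W) y0 (y0 + H))
    by (intros x y Hx Hy; apply cdiff_ccont, Hf; assumption).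
  set (sc := fun n : nat => / 2 ^ n).
  assert (Hsc : forall n, 0 < sc n) by (intros n; apply Rinv_0_lt_compat, pow_lt; lra).
  assert (HscS : forall n, sc n = 2 * sc (S n)).
  { intros n; unfold sc; simpl; assert (0 < 2 ^ n) by (apply pow_lt; lra); field; lra. }
  (* A rectangle of generation [n] is encoded by its lower left corner, its sides being [W / 2^n]
     and [H / 2^n]. *)
  set (inside := fun n (q : R * R) =>
    x0 <= fst q /\ fst q + W * sc n <= x0 + W /\ y0 <= snd q /\ snd q + H * sc n <= y0 + H).
  set (bad := fun n (q : R * R) => inside n q /\
    eta * (sc n * sc n) <= Cmod (rect_int f (fst q) (fst q + W * sc n) (snd q) (snd q + H * sc n))).
  assert (Hstep : forall n q, bad n q -> exists q', bad (S n) q' /\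
    fst q <= fst q' <= fst q + W * sc (S n) /\ snd q <= snd q' <= snd q + H * sc (S n)).
  { intros n [x y] [Hin Hb]; unfold inside in Hin; simpl in Hin, Hb.
    assert (Hs := Hsc (S n)); assert (Es := HscS n).
    set (s := sc (S n)) in *; rewrite Es in *.
    assert (HWs : 0 < W * s) by nra; assert (HHs : 0 < H * s) by nra.
    assert (Hc' : ccont_rect f x (x + W * (2 * s)) y (y + H * (2 * s)))
      by (intros u v Hu Hv; apply Hc; lra).
    rewrite (rect_int_split_x f x (x + W * s)) in Hb by (try exact Hc'; lra).
    rewrite (rect_int_split_y f x (x + W * s) y (y + H * s)) in Hb
      by (try lra; intros u v Hu Hv; apply Hc'; lra).
    rewrite (rect_int_split_y f (x + W * s) (x + W * (2 * s)) y (y + H * s)) in Hb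
      by (try lra; intros u v Hu Hv; apply Hc'; lra).
    replace (x + W * (2 * s)) with (x + W * s + W * s) in Hb by ring.
    replace (y + H * (2 * s)) with (y + H * s + H * s) in Hb by ring.
    set (I1 := rect_int f x (x + W * s) y (y + H * s)) in *.
    set (I2 := rect_int f x (x + W * s) (y + H * s) (y + H * s + H * s)) in *.
    set (I3 := rect_int f (x + W * s) (x + W * s + W * s) y (y + H * s)) in *.
    set (I4 := rect_int f (x + W * s) (x + W * s + W * s) (y + H * s) (y + H * s + H * s)) in *.
    assert (Ht : Cmod (I1 + I2 + (I3 + I4)) <= Cmod I1 + Cmod I2 + (Cmod I3 + Cmod I4)).
    { eapply Rle_trans; [apply Cmod_triangle|]; apply Rplus_le_compat; apply Cmod_triangle. }
    unfold bad, inside.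
    destruct (Rle_lt_dec (eta * (s * s)) (Cmod I1)) as [G|G1];
      [exists (x, y); simpl; fold s; repeat split; try lra; exact G|].
    destruct (Rle_lt_dec (eta * (s * s)) (Cmod I2)) as [G|G2];
      [exists (x, y + H * s); simpl; fold s; repeat split; try lra; exact G|].
    destruct (Rle_lt_dec (eta * (s * s)) (Cmod I3)) as [G|G3];
      [exists (x + W * s, y); simpl; fold s; repeat split; try lra; exact G|].
    destruct (Rle_lt_dec (eta * (s * s)) (Cmod I4)) as [G|G4];
      [exists (x + W * s, y + H * s); simpl; fold s; repeat split; try lra; exact G|].
    exfalso; lra. }
  assert (H0 : bad O (x0, y0)).
  { unfold bad, inside, sc; simpl; rewrite Rinv_1, !Rmult_1_r; repeat split; lra || (fold eta; lra). }
  set (next := fun n (q : {q | bad n q}) =>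
    let s := constructive_indefinite_description _ (Hstep n (proj1_sig q) (proj2_sig q)) in
    exist (bad (S n)) (proj1_sig s) (proj1 (proj2_sig s))).
  set (Q := fix Q (n : nat) : {q | bad n q} :=
    match n with O => exist _ (x0, y0) H0 | S n' => next n' (Q n') end).
  set (X := fun n => fst (proj1_sig (Q n))); set (Y := fun n => snd (proj1_sig (Q n))).
  assert (HXY : forall n, X n <= X (S n) <= X n + W * sc (S n) /\ Y n <= Y (S n) <= Y n + H * sc (S n)).
  { intros n; unfold X, Y; simpl; unfold next; simpl.
    destruct (constructive_indefinite_description _ (Hstep n (proj1_sig (Q n)) (proj2_sig (Q n))))
      as [q' [Hq1 Hq2]]; simpl; exact Hq2. }
  assert (Hbad : forall n, bad n (X n, Y n)).
  { intros n; unfold X, Y; rewrite <- surjective_pairing; apply (proj2_sig (Q n)). }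
  assert (Hmono : forall n k, X n <= X (n + k)%nat <= X n + W * (sc n - sc (n + k)%nat)
                            /\ Y n <= Y (n + k)%nat <= Y n + H * (sc n - sc (n + k)%nat)).
  { intros n k; induction k as [|k IH].
    - rewrite Nat.add_0_r; split; lra.
    - rewrite Nat.add_succ_r; assert (H1 := HXY (n + k)%nat); assert (H2 := HscS (n + k)%nat).
      rewrite H2 in IH; split; lra. }
  (* The left ends increase and the right ends [Z n + L * sc n] decrease, so the supremum of the
     left ends lies in all the intervals. *)
  assert (Hlim : forall (Z : nat -> R) L, 0 < L ->
    (forall n k, Z n <= Z (n + k)%nat <= Z n + L * (sc n - sc (n + k)%nat)) ->
    exists p, forall n, Z n <= p <= Z n + L * sc n).
  { intros Z L HL HZ.
    destruct (completeness (fun x => exists n, x = Z n)) as [p [Hub Hlub]].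
    - exists (Z O + L * sc O); intros x [n ->].
      assert (H1 := HZ O n); simpl in H1; assert (H2 := Hsc n); nra.
    - exists (Z O); now exists O.
    - exists p; intros n; split; [apply Hub; now exists n|].
      apply Hlub; intros x [m ->].
      assert (Hn := Hsc n); assert (Hm := Hsc m).
      destruct (Nat.le_gt_cases n m) as [Hle|Hlt].
      + assert (H1 := HZ n (m - n)%nat); replace (n + (m - n))%nat with m in H1 by lia; nra.
      + assert (H1 := HZ m (n - m)%nat); replace (m + (n - m))%nat with n in H1 by lia; nra. }
  destruct (Hlim X W HW ltac:(intros n k; apply (Hmono n k))) as [px Hpx].
  destruct (Hlim Y H HH ltac:(intros n k; apply (Hmono n k))) as [py Hpy].
  assert (Hp : cdiff f (px, py)).
  { assert (H1 := Hpx O); assert (H2 := Hpy O); destruct (Hbad O) as [[H3 [H4 [H5 H6]]] _]; simpl in *.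
    apply Hf; lra. }
  destruct (cdiff_estimate f (px, py) Hp) as [l Hl].
  set (S2 := (W + H) * (W + H)).
  assert (HS2 : 0 < S2) by (unfold S2; nra).
  (* With this tolerance [rect_int_local_bound] yields [eta s^2 / 2] on a rectangle of scale [s],
     half of what [bad] demands. *)
  destruct (Hl (eta / (8 * S2)) ltac:(apply Rdiv_lt_0_compat; lra)) as [d [Hd Hl']].
  destruct (pow_lt_1_zero (/ 2) ltac:(rewrite Rabs_right; lra) (d / (W + H)) ltac:(apply Rdiv_lt_0_compat; lra))
    as [n0 Hn0].
  assert (Hsn : sc n0 * (W + H) < d).
  { specialize (Hn0 n0 (le_n _)); rewrite pow_inv, Rabs_right in Hn0 by (left; apply Hsc).
    apply Rlt_div_r in Hn0; [exact Hn0|lra]. }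
  destruct (Hbad n0) as [[H3 [H4 [H5 H6]]] Hbig]; simpl in H3, H4, H5, H6, Hbig.
  assert (Hs := Hsc n0); assert (Hx := Hpx n0); assert (Hy := Hpy n0).
  set (s := sc n0) in *.
  assert (Hsmall : Cmod (rect_int f (X n0) (X n0 + W * s) (Y n0) (Y n0 + H * s))
     <= 4 * (eta / (8 * S2) * (s * (W + H))) * ((X n0 + W * s - X n0) + (Y n0 + H * s - Y n0))).
  { apply (rect_int_local_bound f l (px, py)); try nra.
    - intros u v Hu Hv; apply Hc; lra.
    - intros u v Hu Hv.
      assert (Hdist : Cmod ((u, v) - (px, py)) <= s * (W + H)).
      { eapply Rle_trans; [apply Cmod_le_Re_Im|]; simpl.
        apply Rle_trans with (W * s + H * s); [|lra].
        apply Rplus_le_compat; apply Rabs_le; lra. }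
      eapply Rle_trans; [apply Hl'; lra|].
      apply Rmult_le_compat_l; [|exact Hdist].
      left; apply Rdiv_lt_0_compat; lra. }
  replace (4 * (eta / (8 * S2) * (s * (W + H))) * (X n0 + W * s - X n0 + (Y n0 + H * s - Y n0)))
    with (eta * (s * s) / 2) in Hsmall by (unfold S2; field; lra).
  assert (0 < s * s) by nra.
  assert (0 < eta * (s * s)) by nra.
  lra.
Qed.

(** * The peak kernel and uniqueness on a rectangle *)

Lemma rcont_on_bounded (f : R -> C) (a b : R) :
  a <= b -> rcont_on f a b -> exists B, 0 <= B /\ forall x, a <= x <= b -> Cmod (f x) <= B.
Proof.
  intros Hab H.
  set (F := fun x => Rabs (Re (f x)) + Rabs (Im (f x))).
  destruct (continuity_ab_maj F a b Hab) as [m [Hm _]].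
  - intros x Hx; destruct (H x Hx) as [H1 H2].
    apply continuity_pt_filterlim.
    apply (continuous_plus (V := R_NormedModule)
      (fun x => Rabs (Re (f x))) (fun x => Rabs (Im (f x))));
      apply (continuous_comp _ Rabs); assumption || apply continuous_Rabs.
  - exists (F m); split; [apply Rplus_le_le_0_compat; apply Rabs_pos|].
    intros x Hx; eapply Rle_trans; [apply Cmod_le_Re_Im|now apply Hm].
Qed.

(* [exp (n cosh (mu (z - z0)))]: on the line [Re z = Re z0] it is a positive peak at [z0],
   while it has modulus 1 on the lines [Im (z - z0) = +- pi / (2 mu)]. *)
Definition peak (mu : R) (z0 : C) (n : nat) (z : C) : C :=
  cexp (RtoC (INR n) * ((cexp (RtoC mu * (z - z0)) + cexp (RtoC (- mu) * (z - z0))) * RtoC (/ 2))).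

Lemma cdiff_peak (mu : R) (z0 : C) (n : nat) (z : C) : cdiff (peak mu z0 n) z.
Proof.
  unfold peak; apply cdiff_cexp, cdiff_mult; [apply cdiff_const|].
  apply cdiff_mult; [|apply cdiff_const].
  apply cdiff_plus; apply cdiff_cexp; (apply cdiff_mult; [apply cdiff_const|]);
    (apply cdiff_minus; [apply cdiff_id|apply cdiff_const]).
Qed.

Lemma cexp_scaled (mu x0 y0 x y : R) :
  cexp (RtoC mu * ((x, y) - (x0, y0)))
  = (exp (mu * (x - x0)) * cos (mu * (y - y0)), exp (mu * (x - x0)) * sin (mu * (y - y0))).
Proof.
  unfold cexp; rewrite re_scal_l, im_scal_l; reflexivity.
Qed.

Lemma peak_exponent (mu x0 y0 x y : R) :
  ((cexp (RtoC mu * ((x, y) - (x0, y0))) + cexp (RtoC (- mu) * ((x, y) - (x0, y0)))) * RtoC (/ 2))%C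
  = ((exp (mu * (x - x0)) + exp (- (mu * (x - x0)))) / 2 * cos (mu * (y - y0)),
     (exp (mu * (x - x0)) - exp (- (mu * (x - x0)))) / 2 * sin (mu * (y - y0))).
Proof.
  rewrite !cexp_scaled, !Ropp_mult_distr_l_reverse, cos_neg, sin_neg.
  apply injective_projections; simpl; field.
Qed.

Lemma Cmod_peak (mu x0 y0 x y : R) (n : nat) :
  Cmod (peak mu (x0, y0) n (x, y))
  = exp (INR n * ((exp (mu * (x - x0)) + exp (- (mu * (x - x0)))) / 2 * cos (mu * (y - y0)))).
Proof.
  unfold peak; rewrite Cmod_cexp, re_scal_l, peak_exponent; reflexivity.
Qed.

Lemma peak_left (mu x0 y0 y : R) (n : nat) :
  peak mu (x0, y0) n (x0, y) = RtoC (exp (INR n * cos (mu * (y - y0)))).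
Proof.
  unfold peak; rewrite peak_exponent.
  replace (x0 - x0) with 0 by ring; rewrite Rmult_0_r, Ropp_0, exp_0.
  replace ((1 + 1) / 2 * cos (mu * (y - y0))) with (cos (mu * (y - y0))) by field.
  replace ((1 - 1) / 2 * sin (mu * (y - y0))) with 0 by field.
  unfold cexp; rewrite re_scal_l, im_scal_l; simpl.
  rewrite Rmult_0_r, cos_0, sin_0; unfold RtoC; f_equal; ring.
Qed.

Lemma RInt_ge_const (f : R -> R) (a b m : R) :
  a <= b -> ex_RInt f a b -> (forall x, a <= x <= b -> m <= f x) -> m * (b - a) <= RInt f a b.
Proof.
  intros Hab Hf Hm.
  replace (m * (b - a)) with (RInt (fun _ => m) a b).
  - apply RInt_le; [exact Hab|apply ex_RInt_const|exact Hf|intros; apply Hm; lra].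
  - rewrite RInt_const; exact (Rmult_comm (b - a) m).
Qed.

Lemma real_pairing_lower (h g : C) (c : R) :
  Cmod h = c -> Cmod (g - h) <= c / 2 -> c * c / 2 <= Re h * Re g + Im h * Im g.
Proof.
  intros Hh Hg.
  assert (H1 := re_le_Cmod (Cconj h * (g - h))).
  rewrite Cmod_mult, Cmod_conj, Hh, re_mult, re_conj, im_conj in H1; unfold Cminus in H1.
  rewrite re_plus, im_plus, re_opp, im_opp in H1.
  assert (H2 := Cmod_sqr h); rewrite Hh in H2.
  apply Rabs_le_between in H1.
  assert (H0 := Cmod_ge_0 h); rewrite Hh in H0.
  unfold Cminus in Hg; nra.
Qed.

Lemma real_pairing_abs (h g : C) : Rabs (Re h * Re g + Im h * Im g) <= Cmod h * Cmod g.
Proof.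
  assert (H1 := re_le_Cmod (Cconj h * g)).
  rewrite Cmod_mult, Cmod_conj, re_mult, re_conj, im_conj in H1.
  eapply Rle_trans with (2 := H1); right; f_equal; ring.
Qed.

Lemma cos_abs (x : R) : cos (Rabs x) = cos x.
Proof. unfold Rabs; destruct (Rcase_abs x); [apply cos_neg|reflexivity]. Qed.

(** Pairing with [h0] makes the integrand real: at least [c^2 / 2] times the weight within [rho] of
    [y0], and at least [- c B] times the weight elsewhere. The gain is counted only within
    [rho / 2], so that its rate [cos (mu (rho / 2))] strictly exceeds the rate [cos (mu rho)] of the
    outer part. *)
Lemma peak_lower (eta rho c B y0 : R) (h0 : C) (n : nat) (g : R -> C) :
  0 < eta -> 0 < rho <= eta -> Cmod h0 = c -> 0 < c -> 0 <= B ->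
  rcont_on g (y0 - eta) (y0 + eta) ->
  (forall y, y0 - eta <= y <= y0 + eta -> Cmod (g y) <= B) ->
  (forall y, Rabs (y - y0) <= rho -> Cmod (g y - h0) <= c / 2) ->
  let mu := PI / (2 * eta) in
  let F := fun y => (g y * RtoC (exp (INR n * cos (mu * (y - y0)))))%C in
  rcont_on F (y0 - eta) (y0 + eta) ->
  rho * (c * c / 2) * exp (INR n * cos (mu * (rho / 2)))
    - 2 * eta * (c * B) * exp (INR n * cos (mu * rho))
  <= c * Cmod (cint F (y0 - eta) (y0 + eta)).
Proof.
  intros Heta Hrho Hh Hc HB Hg HgB Hnear mu F HF.
  assert (HPI := PI_RGT_0).
  assert (Hmu : 0 < mu) by (apply Rdiv_lt_0_compat; lra).
  assert (Hmueta : mu * eta = PI / 2) by (unfold mu; field; lra).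
  assert (Hn := pos_INR n).
  set (E := fun y => exp (INR n * cos (mu * (y - y0)))).
  set (I := fun y => Re h0 * Re (F y) + Im h0 * Im (F y)).
  destruct (rcont_on_ex_RInt F (y0 - eta) (y0 + eta) ltac:(lra) HF) as [HR HI].
  assert (HIex : forall a b, y0 - eta <= a -> a <= b -> b <= y0 + eta -> ex_RInt I a b).
  { intros a b H1 H2 H3.
    destruct (rcont_on_ex_RInt F a b H2) as [Ha Hb]; [apply (rcont_on_sub F _ _ _ _ H1 H3 HF)|].
    apply (ex_RInt_plus (V := R_NormedModule) (fun y => Re h0 * Re (F y)) (fun y => Im h0 * Im (F y)));
      apply (ex_RInt_scal (V := R_NormedModule)); assumption. }
  assert (HIval : RInt I (y0 - eta) (y0 + eta)
     = Re h0 * Re (cint F (y0 - eta) (y0 + eta)) + Im h0 * Im (cint F (y0 - eta) (y0 + eta))).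
  { unfold I.
    rewrite (RInt_plus (V := R_CompleteNormedModule) (fun y => Re h0 * Re (F y)) (fun y => Im h0 * Im (F y)))
      by (apply (ex_RInt_scal (V := R_NormedModule)); assumption).
    rewrite (RInt_scal (V := R_CompleteNormedModule) (fun y => Re (F y))) by assumption.
    rewrite (RInt_scal (V := R_CompleteNormedModule) (fun y => Im (F y))) by assumption.
    reflexivity. }
  assert (HIE : forall y, I y = (Re h0 * Re (g y) + Im h0 * Im (g y)) * E y).
  { intros y; unfold I, F; rewrite re_scal_r, im_scal_r; fold (E y); ring. }
  assert (Hin : forall y, Rabs (y - y0) <= rho -> c * c / 2 * E y <= I y).
  { intros y Hy; rewrite HIE; apply Rmult_le_compat_r; [left; apply exp_pos|].
    now apply real_pairing_lower; [|apply Hnear]. }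
  assert (Hcos : forall x y, 0 <= x <= y -> y <= eta -> cos (mu * y) <= cos (mu * x)).
  { intros x y Hx Hy.
    assert (mu * y <= PI / 2) by (rewrite <- Hmueta; apply Rmult_le_compat_l; lra).
    apply cos_decr_1; try lra; try nra. }
  assert (HcosE : forall y, cos (mu * (y - y0)) = cos (mu * Rabs (y - y0))).
  { intros y; rewrite <- (cos_abs (mu * (y - y0))), Rabs_mult, (Rabs_right mu) by lra; reflexivity. }
  assert (Hout : forall y, y0 - eta <= y <= y0 + eta ->
     - (c * B) * exp (INR n * cos (mu * rho)) <= I y).
  { intros y Hy; assert (HE := exp_pos (INR n * cos (mu * (y - y0)))); fold (E y) in HE.
    assert (He2 := exp_pos (INR n * cos (mu * rho))).
    assert (HcB : 0 <= c * B) by nra.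
    destruct (Rle_lt_dec (Rabs (y - y0)) rho) as [Hy'|Hy'].
    - assert (H1 := Hin y Hy'); assert (0 <= c * c / 2 * E y) by nra; nra.
    - assert (H1 := real_pairing_abs h0 (g y)); rewrite Hh in H1; apply Rabs_le_between in H1.
      assert (H2 := HgB y Hy).
      assert (H3 : c * Cmod (g y) <= c * B) by (apply Rmult_le_compat_l; lra).
      assert (H4 : E y <= exp (INR n * cos (mu * rho))).
      { unfold E; apply exp_le_mono, Rmult_le_compat_l; [exact Hn|]; rewrite HcosE.
        apply Hcos; [lra|]; apply Rabs_le; lra. }
      rewrite HIE; apply Rle_trans with (- (c * B) * E y); [nra|].
      apply Rmult_le_compat_r; lra. }
  assert (Hmid : forall y, y0 - rho / 2 <= y <= y0 + rho / 2 ->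
     c * c / 2 * exp (INR n * cos (mu * (rho / 2))) <= I y).
  { intros y Hy; assert (Ha : Rabs (y - y0) <= rho / 2) by (apply Rabs_le; lra).
    eapply Rle_trans; [|apply Hin; lra].
    apply Rmult_le_compat_l; [nra|]; unfold E; apply exp_le_mono, Rmult_le_compat_l; [exact Hn|].
    rewrite HcosE; apply Hcos; [split; [apply Rabs_pos|exact Ha]|lra]. }
  assert (Hsplit : RInt I (y0 - eta) (y0 + eta)
     = RInt I (y0 - eta) (y0 - rho / 2) + RInt I (y0 - rho / 2) (y0 + rho / 2)
       + RInt I (y0 + rho / 2) (y0 + eta)).
  { rewrite <- (RInt_Chasles (V := R_CompleteNormedModule) I (y0 - eta) (y0 + rho / 2) (y0 + eta))
      by (apply HIex; lra).
    rewrite <- (RInt_Chasles (V := R_CompleteNormedModule) I (y0 - eta) (y0 - rho / 2) (y0 + rho / 2))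
      by (apply HIex; lra).
    reflexivity. }
  set (m := - (c * B) * exp (INR n * cos (mu * rho))) in *.
  set (M := c * c / 2 * exp (INR n * cos (mu * (rho / 2)))) in *.
  assert (L1 : m * (y0 - rho / 2 - (y0 - eta)) <= RInt I (y0 - eta) (y0 - rho / 2))
    by (apply RInt_ge_const; [lra|apply HIex; lra|intros; apply Hout; lra]).
  assert (L2 : M * (y0 + rho / 2 - (y0 - rho / 2)) <= RInt I (y0 - rho / 2) (y0 + rho / 2))
    by (apply RInt_ge_const; [lra|apply HIex; lra|intros; apply Hmid; lra]).
  assert (L3 : m * (y0 + eta - (y0 + rho / 2)) <= RInt I (y0 + rho / 2) (y0 + eta))
    by (apply RInt_ge_const; [lra|apply HIex; lra|intros; apply Hout; lra]).
  assert (Hm0 : m <= 0).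
  { unfold m; assert (0 <= c * B) by nra; assert (He2 := exp_pos (INR n * cos (mu * rho))); nra. }
  assert (Hup := real_pairing_abs h0 (cint F (y0 - eta) (y0 + eta))).
  rewrite Hh, <- HIval in Hup; apply Rabs_le_between in Hup.
  replace (rho * (c * c / 2) * exp (INR n * cos (mu * (rho / 2)))) with (rho * M) by (unfold M; ring).
  replace (2 * eta * (c * B) * exp (INR n * cos (mu * rho))) with (- (2 * eta * m)) by (unfold m; ring).
  nra.
Qed.

(** If [h (x0, y0)] were nonzero, the integral over the left side would grow like
    [exp (n cos (mu (rho / 2)))] up to terms of rate [cos (mu rho)], while the horizontal sides stay
    bounded in [n] and the right side contributes at most 1. *)
Lemma rect_unique (h : C -> C) (x0 x1 y0 eta : R) :
  x0 < x1 -> 0 < eta ->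
  (forall eps, 0 < eps -> exists g,
     (forall x y, x0 <= x <= x1 -> y0 - eta <= y <= y0 + eta -> cdiff g (x, y)) /\
     (forall x y, x0 <= x <= x1 -> y0 - eta <= y <= y0 + eta -> Cmod (g (x, y) - h (x, y)) <= eps)) ->
  (forall y, y0 - eta <= y <= y0 + eta -> h (x1, y) = 0) ->
  h (x0, y0) = 0.
Proof.
  intros Hx Heta Happ Hright.
  set (h0 := h (x0, y0)); set (c := Cmod h0).
  destruct (Rle_lt_or_eq_dec _ _ (Cmod_ge_0 h0)) as [Hc|Hc]; [exfalso|now apply Cmod_eq_0].
  fold c in Hc.
  (* The fixed approximant [g0] supplies bounds on the sides and continuity at [(x0, y0)] that do
     not depend on [n]; every later approximant lies within [c / 4] of it. *)
  destruct (Happ (c / 8) ltac:(lra)) as [g0 [Hg0 Hg0h]].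
  destruct (rcont_on_bounded (fun y => g0 (x0, y)) (y0 - eta) (y0 + eta)) as [B1 [HB1 HB1']];
    [lra|intros y Hy; apply ccont_vertical, cdiff_ccont, Hg0; lra|].
  destruct (rcont_on_bounded (fun x => g0 (x, y0 - eta)) x0 x1) as [B2 [HB2 HB2']];
    [lra|intros x Hx'; apply ccont_horizontal, cdiff_ccont, Hg0; lra|].
  destruct (rcont_on_bounded (fun x => g0 (x, y0 + eta)) x0 x1) as [B3 [HB3 HB3']];
    [lra|intros x Hx'; apply ccont_horizontal, cdiff_ccont, Hg0; lra|].
  set (B := B1 + B2 + B3 + c / 4).
  destruct (cdiff_ccont _ _ (Hg0 x0 y0 ltac:(lra) ltac:(lra)) (c / 8) ltac:(lra)) as [d [Hd Hd']].
  set (rho := Rmin eta (d / 2)).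
  assert (Hrho : 0 < rho <= eta) by (split; [apply Rmin_glb_lt; lra|apply Rmin_l]).
  assert (Hrd : rho <= d / 2) by apply Rmin_r.
  set (mu := PI / (2 * eta)).
  assert (HPI := PI_RGT_0).
  assert (Hmu : 0 < mu) by (apply Rdiv_lt_0_compat; lra).
  assert (Hmueta : mu * eta = PI / 2) by (unfold mu; field; lra).
  assert (Hk2 : 0 <= cos (mu * rho)).
  { apply cos_ge_0; [nra|]; rewrite <- Hmueta; apply Rmult_le_compat_l; lra. }
  assert (Hk12 : cos (mu * rho) < cos (mu * (rho / 2))).
  { assert (mu * rho <= PI / 2) by (rewrite <- Hmueta; apply Rmult_le_compat_l; lra).
    apply cos_decreasing_1; try lra; nra. }
  (* 1 for the right side, the rest for the two horizontal sides. *)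
  set (Q := 1 + 4 * B * (x1 - x0)).
  assert (HB : 0 <= B) by (unfold B; lra).
  assert (HQ : 0 < Q) by (unfold Q; assert (0 <= B * (x1 - x0)) by (apply Rmult_le_pos; lra); lra).
  assert (Hall : forall n : nat,
    rho * (c * c / 2) * exp (INR n * cos (mu * (rho / 2)))
      <= (2 * eta * (c * B) + c * Q) * exp (INR n * cos (mu * rho))).
  { intros n; assert (Hn := pos_INR n).
    set (ch := (exp (mu * (x1 - x0)) + exp (- (mu * (x1 - x0)))) / 2).
    assert (Hch : 0 < ch).
    { unfold ch; assert (G1 := exp_pos (mu * (x1 - x0))); assert (G2 := exp_pos (- (mu * (x1 - x0)))); lra. }
    set (En := exp (INR n * ch)).
    assert (HEn : 0 < En) by apply exp_pos.
    (* On the right side [h] vanishes, so the approximant is at most [eps] there, while the kernel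
       is at most [En]; since [n] is already fixed, [eps] can offset [En]. *)
    set (eps := Rmin (c / 8) (/ (4 * eta * En))).
    assert (Heps : 0 < eps).
    { apply Rmin_glb_lt; [lra|]; apply Rinv_0_lt_compat; nra. }
    assert (Heps1 : eps <= c / 8) by apply Rmin_l.
    assert (Heps2 : eps <= / (4 * eta * En)) by apply Rmin_r.
    destruct (Happ eps Heps) as [g [Hg Hgh]].
    set (G := fun z => (g z * peak mu (x0, y0) n z)%C).
    assert (HGd : forall x y, x0 <= x <= x1 -> y0 - eta <= y <= y0 + eta -> cdiff G (x, y))
      by (intros x y Hx' Hy'; apply cdiff_mult; [now apply Hg|apply cdiff_peak]).
    assert (HGc : forall x y, x0 <= x <= x1 -> y0 - eta <= y <= y0 + eta -> ccont G (x, y))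
      by (intros; now apply cdiff_ccont, HGd).
    assert (Hzero : rect_int G x0 x1 (y0 - eta) (y0 + eta) = 0).
    { replace x1 with (x0 + (x1 - x0)) by ring.
      replace (y0 + eta) with (y0 - eta + 2 * eta) by ring.
      apply rect_int_zero; [lra|lra|]; intros; apply HGd; lra. }
    assert (Hclose : forall x y, x0 <= x <= x1 -> y0 - eta <= y <= y0 + eta ->
       Cmod (g (x, y) - g0 (x, y)) <= c / 4).
    { intros x y Hx' Hy'.
      replace (g (x, y) - g0 (x, y))%C with ((g (x, y) - h (x, y)) - (g0 (x, y) - h (x, y)))%C by ring.
      eapply Rle_trans; [apply Cmod_minus_le|].
      assert (H1 := Hgh x y Hx' Hy'); assert (H2 := Hg0h x y Hx' Hy'); lra. }
    assert (Hbd : forall x y b, x0 <= x <= x1 -> y0 - eta <= y <= y0 + eta ->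
       Cmod (g0 (x, y)) <= b -> b <= B1 + B2 + B3 -> Cmod (g (x, y)) <= B).
    { intros x y b Hx' Hy' Hb Hb'.
      replace (g (x, y)) with ((g (x, y) - g0 (x, y)) + g0 (x, y))%C by ring.
      eapply Rle_trans; [apply Cmod_triangle|].
      assert (H1 := Hclose x y Hx' Hy'); unfold B; lra. }
    set (Lf := cint (fun y => G (x0, y)) (y0 - eta) (y0 + eta)).
    set (Rt := cint (fun y => G (x1, y)) (y0 - eta) (y0 + eta)).
    set (A := cint (fun x => G (x, (y0 - eta)%R) - G (x, (y0 + eta)%R))%C x0 x1).
    assert (HL : Lf = (Rt - Ci * A)%C).
    { unfold rect_int in Hzero; fold A in Hzero.
      rewrite cint_minus in Hzero
        by (try lra; intros y Hy; apply ccont_vertical, HGc; lra).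
      fold Lf Rt in Hzero.
      assert (HCi : (Ci * Ci = - (1))%C) by (unfold Ci; apply injective_projections; simpl; ring).
      transitivity (Rt - Ci * A + Ci * (A + Ci * (Rt - Lf)) + (Rt - Lf) * (- (Ci * Ci) - 1))%C; [ring|].
      rewrite Hzero, HCi; ring. }
    assert (HRt : Cmod Rt <= 1).
    { assert (H1 : Cmod Rt <= 2 * (eps * En) * (y0 + eta - (y0 - eta))).
      { apply cint_bound; [lra|intros y Hy; apply ccont_vertical, HGc; lra|].
        intros y Hy; unfold G; rewrite Cmod_mult, Cmod_peak; fold ch.
        apply Rmult_le_compat; [apply Cmod_ge_0|left; apply exp_pos| |].
        - assert (H1 := Hgh x1 y ltac:(lra) Hy); rewrite Hright in H1 by exact Hy.
          now replace (g (x1, y) - 0)%C with (g (x1, y)) in H1 by ring.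
        - apply exp_le_mono, Rmult_le_compat_l; [exact Hn|].
          assert (H1 := COS_bound (mu * (y - y0))); nra. }
      assert (H2 : eps * En <= / (4 * eta * En) * En) by (apply Rmult_le_compat_r; lra).
      replace (/ (4 * eta * En) * En) with (/ (4 * eta)) in H2 by (field; lra).
      apply Rle_trans with (1 := H1).
      apply Rle_trans with (2 * / (4 * eta) * (y0 + eta - (y0 - eta))).
      - apply Rmult_le_compat_r; lra.
      - right; field; lra. }
    assert (Hedge : forall y, y = y0 - eta \/ y = y0 + eta -> forall x, Cmod (peak mu (x0, y0) n (x, y)) = 1).
    { intros y Hy x; rewrite Cmod_peak.
      assert (E : cos (mu * (y - y0)) = 0).
      { destruct Hy as [-> | ->].
        - replace (mu * (y0 - eta - y0)) with (- (mu * eta)) by ring.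
          rewrite cos_neg, Hmueta; apply cos_PI2.
        - replace (mu * (y0 + eta - y0)) with (mu * eta) by ring; rewrite Hmueta; apply cos_PI2. }
      rewrite E, !Rmult_0_r; apply exp_0. }
    assert (HA : Cmod A <= 2 * (2 * B) * (x1 - x0)).
    { apply cint_bound; [lra|intros x Hx'; apply rcont_minus; apply ccont_horizontal, HGc; lra|].
      intros x Hx'; unfold G; eapply Rle_trans; [apply Cmod_minus_le|].
      rewrite !Cmod_mult, !Hedge by auto; rewrite !Rmult_1_r.
      assert (G1 := Hbd x (y0 - eta) B2 Hx' ltac:(lra) (HB2' x Hx') ltac:(lra)).
      assert (G2 := Hbd x (y0 + eta) B3 Hx' ltac:(lra) (HB3' x Hx') ltac:(lra)).
      lra. }
    assert (HLf : Cmod Lf <= Q).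
    { rewrite HL; eapply Rle_trans; [apply Cmod_minus_le|]; rewrite Cmod_mult, Cmod_Ci; unfold Q; lra. }
    assert (HLc : Lf = cint (fun y => g (x0, y) * RtoC (exp (INR n * cos (mu * (y - y0)))))%C
                         (y0 - eta) (y0 + eta)).
    { apply cint_ext; [lra|]; intros y Hy; unfold G; now rewrite peak_left. }
    assert (Hlow := peak_lower eta rho c B y0 h0 n (fun y => g (x0, y)) Heta Hrho eq_refl Hc HB).
    simpl in Hlow; fold mu in Hlow; rewrite <- HLc in Hlow.
    assert (Hlow' : rho * (c * c / 2) * exp (INR n * cos (mu * (rho / 2)))
       - 2 * eta * (c * B) * exp (INR n * cos (mu * rho)) <= c * Cmod Lf).
    { apply Hlow.
      - intros y Hy; apply ccont_vertical, cdiff_ccont, Hg; lra.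
      - intros y Hy; apply (Hbd x0 y B1); [lra|exact Hy|now apply HB1'|lra].
      - intros y Hy.
        assert (Hy2 : y0 - eta <= y <= y0 + eta) by (apply Rabs_le_between in Hy; lra).
        assert (H1 := Hgh x0 y ltac:(lra) Hy2); assert (H2 := Hg0h x0 y ltac:(lra) Hy2).
        assert (H3 := Hg0h x0 y0 ltac:(lra) ltac:(lra)).
        assert (H4 : Cmod (g0 (x0, y) - g0 (x0, y0)) < c / 8).
        { apply Hd'; eapply Rle_lt_trans; [apply Cmod_le_Re_Im|]; simpl.
          replace (x0 + - x0) with 0 by ring; rewrite Rabs_R0; unfold Rminus in Hy; lra. }
        assert (H5 := Hclose x0 y ltac:(lra) Hy2).
        replace (g (x0, y) - h0)%C
          with ((g (x0, y) - g0 (x0, y)) + ((g0 (x0, y) - g0 (x0, y0)) + (g0 (x0, y0) - h0)))%C by ring.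
        eapply Rle_trans; [apply Cmod_triangle|].
        eapply Rle_trans; [apply Rplus_le_compat_l, Cmod_triangle|].
        fold h0 in H3; lra.
      - intros y Hy; destruct (ccont_vertical _ _ _ (HGc x0 y ltac:(lra) Hy)) as [H1 H2]; unfold G in H1, H2.
        split.
        + apply continuous_ext with (2 := H1); intros t; now rewrite peak_left.
        + apply continuous_ext with (2 := H2); intros t; now rewrite peak_left. }
    assert (He : 1 <= exp (INR n * cos (mu * rho))).
    { rewrite <- exp_0; apply exp_le_mono; nra. }
    assert (H1 : c * Cmod Lf <= c * Q) by (apply Rmult_le_compat_l; lra).
    assert (H2 : c * Q <= c * Q * exp (INR n * cos (mu * rho))).
    { rewrite <- (Rmult_1_r (c * Q)) at 1; apply Rmult_le_compat_l; nra. }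
    lra. }
  set (k := cos (mu * (rho / 2)) - cos (mu * rho)).
  assert (Hk : 0 < k) by (unfold k; lra).
  set (a1 := rho * (c * c / 2)).
  assert (Ha1 : 0 < a1) by (unfold a1; apply Rmult_lt_0_compat; nra).
  set (a2 := 2 * eta * (c * B) + c * Q) in *.
  (* Divided by [exp (N cos (mu rho))], [Hall] reads [a1 * exp (N k) <= a2]; as
     [exp (N k) >= 1 + N k], this fails once [N > a2 / (a1 k)]. *)
  destruct (nfloor_ex (Rmax 0 (a2 / (a1 * k))) (Rmax_l _ _)) as [n [_ Hn]].
  specialize (Hall (S n)).
  rewrite <- S_INR in Hn; assert (Hn' := Rle_lt_trans _ _ _ (Rmax_r _ _) Hn).
  apply Rlt_div_l in Hn'; [|nra].
  set (N := INR (S n)) in *.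
  replace (N * cos (mu * (rho / 2))) with (N * k + N * cos (mu * rho)) in Hall by (unfold k; ring).
  rewrite exp_plus in Hall; fold a1 in Hall.
  assert (He := exp_pos (N * cos (mu * rho))).
  assert (Hle : a1 * exp (N * k) <= a2).
  { apply Rmult_le_reg_r with (exp (N * cos (mu * rho))); [exact He|lra]. }
  assert (Hx1 := exp_ineq1_le (N * k)).
  assert (a1 * (1 + N * k) <= a1 * exp (N * k)) by (apply Rmult_le_compat_l; lra).
  nra.
Qed.

(** * The analytic continuation *)

Lemma cdiff_cpow (b : R) (f : C -> C) (z : C) : cdiff f z -> cdiff (fun s => cpow b (f s)) z.
Proof. intros H; unfold cpow; apply cdiff_cexp, cdiff_mult; [exact H|apply cdiff_const]. Qed.

Lemma cdiff_csum (F : nat -> C -> C) (n : nat) (z : C) :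
  (forall m, cdiff (F m) z) -> cdiff (fun s => csum (fun m => F m s) n) z.
Proof.
  intros H; induction n as [|n IH]; simpl; [apply cdiff_const|].
  apply (cdiff_plus (fun s => csum (fun m => F m s) n)); auto.
Qed.

Lemma cdiff_box_sum (w : nat -> R) (r n : nat) (F : C -> R -> C) (z : C) :
  (forall u, cdiff (fun s => F s u) z) -> cdiff (fun s => box_sum w r n (F s)) z.
Proof.
  revert F; induction r as [|r IH]; intros F H; simpl; [apply H|].
  assert (E : (fun s => sum_n (fun m => box_sum w r n (fun u => F s (u + INR m * w r))) n)
            = (fun s => csum (fun m => box_sum w r n (fun u => F s (u + INR m * w r))) (S n)))
    by (apply functional_extensionality; intros s; apply sum_n_csum).
  rewrite E; apply (cdiff_csum (fun m s => box_sum w r n (fun u => F s (u + INR m * w r)))).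
  intros m; apply (IH (fun s u => F s (u + INR m * w r))); intros u; apply H.
Qed.

Lemma cdiff_subset_sum (w : nat -> R) (r : nat) (F : C -> nat -> R -> C) (z : C) :
  (forall k u, cdiff (fun s => F s k u) z) -> cdiff (fun s => subset_sum w r (F s)) z.
Proof.
  revert F; induction r as [|r IH]; intros F H; simpl; [apply H|].
  apply cdiff_plus; [now apply IH|].
  apply (IH (fun s k u => F s (S k) (u + w r))); intros k u; apply H.
Qed.

Lemma cdiff_poch (r : nat) (z : C) : cdiff (poch r) z.
Proof.
  induction r as [|r IH]; [apply cdiff_const|].
  apply (cdiff_mult (poch r)); [exact IH|].
  apply cdiff_minus; [apply cdiff_id|apply cdiff_const].
Qed.

Lemma wprod_pos (w : nat -> R) (r : nat) : (forall i, (i < r)%nat -> 0 < w i) -> 0 < wprod w r.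
Proof.
  induction r as [|r IH]; intros H; simpl; [lra|].
  apply Rmult_lt_0_compat; [apply IH; intros; apply H|apply H]; lia.
Qed.

Lemma cdiff_reg_box (r : nat) (a : R) (w : nat -> R) (n : nat) (z : C) :
  (forall i, (i < r)%nat -> 0 < w i) -> off_poles r z -> cdiff (reg_box r a w n) z.
Proof.
  intros Hw Hz; assert (Hp := wprod_pos w r Hw).
  assert (Hneg : forall c : C, cdiff (fun s => c - s)%C z)
    by (intros c; apply cdiff_minus; [apply cdiff_const|apply cdiff_id]).
  apply cdiff_minus.
  - apply (cdiff_box_sum w r n (fun s u => cpow (a + u) (- s))); intros u.
    apply cdiff_cpow, (cdiff_opp (fun s => s)), cdiff_id.
  - apply (cdiff_subset_sum w r (fun s k u => match k with
      | O => 0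
      | S _ => Cdiv (Cmult (RtoC ((-1) ^ k)) (cpow (a + INR (S n) * u) (Cminus (RtoC (INR r)) s)))
                  (Cmult (poch r s) (RtoC (wprod w r)))
      end)); intros [|k] u; [apply cdiff_const|].
    apply cdiff_mult; [apply cdiff_mult; [apply cdiff_const|apply cdiff_cpow, Hneg]|].
    apply cdiff_inv.
    + apply cdiff_mult; [apply cdiff_poch|apply cdiff_const].
    + apply Cmult_neq_0; [now apply poch_neq_0|apply RtoC_neq_0; lra].
Qed.

(** * The limit of the corrected box sums *)

Definition clim (P : nat -> C) (L : C) : Prop :=
  forall eps, 0 < eps -> exists n0, forall n, (n0 <= n)%nat -> Cmod (P n - L) <= eps.

Lemma clim_unique (P : nat -> C) (L L' : C) : clim P L -> clim P L' -> L = L'.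
Proof.
  intros H H'; apply Ceq_minus, Cmod_eq_0, Rle_antisym; [|apply Cmod_ge_0].
  apply Rnot_lt_le; intros Hc.
  destruct (H (Cmod (L - L') / 4) ltac:(lra)) as [n0 H0].
  destruct (H' (Cmod (L - L') / 4) ltac:(lra)) as [n1 H1].
  specialize (H0 (max n0 n1) ltac:(lia)); specialize (H1 (max n0 n1) ltac:(lia)).
  set (x := P (max n0 n1)) in *.
  assert (H2 := Cmod_minus_le (x - L') (x - L)).
  replace (x - L' - (x - L))%C with (L - L')%C in H2 by ring; lra.
Qed.

Lemma clim_cauchy (P : nat -> C) :
  (forall eps, 0 < eps -> exists n0, forall n k, (n0 <= n)%nat -> Cmod (P (n + k)%nat - P n) <= eps) ->
  exists L, clim P L.
Proof.
  intros H.
  assert (Hco : forall phi : C -> R,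
     (forall x y, Rabs (phi x - phi y) <= Cmod (x - y)) ->
     exists l, Un_cv (fun n => phi (P n)) l).
  { intros phi Hphi; destruct (Rcomplete.R_complete (fun n => phi (P n))) as [l Hl]; [|now exists l].
    intros eps He; destruct (H (eps / 3) ltac:(lra)) as [n0 Hn0]; exists n0.
    intros n m Hn Hm; unfold Rdist.
    eapply Rle_lt_trans; [apply Hphi|].
    assert (H1 := Hn0 n0 (n - n0)%nat (le_n _)); assert (H2 := Hn0 n0 (m - n0)%nat (le_n _)).
    replace (n0 + (n - n0))%nat with n in H1 by lia; replace (n0 + (m - n0))%nat with m in H2 by lia.
    replace (P n - P m)%C with ((P n - P n0) - (P m - P n0))%C by ring.
    eapply Rle_lt_trans; [apply Cmod_minus_le|]; lra. }
  destruct (Hco Re) as [l1 H1].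
  { intros x y; unfold Rminus; rewrite <- re_opp, <- re_plus; apply re_le_Cmod. }
  destruct (Hco Im) as [l2 H2].
  { intros x y; unfold Rminus; rewrite <- im_opp, <- im_plus; apply Im_le_Cmod. }
  exists (l1, l2); intros eps He.
  destruct (H1 (eps / 2) ltac:(lra)) as [n1 Hn1]; destruct (H2 (eps / 2) ltac:(lra)) as [n2 Hn2].
  exists (max n1 n2); intros n Hn.
  assert (Ha := Hn1 n ltac:(lia)); assert (Hb := Hn2 n ltac:(lia)); unfold Rdist in Ha, Hb.
  eapply Rle_trans; [apply Cmod_le_Re_Im|].
  unfold Cminus; rewrite re_plus, im_plus, re_opp, im_opp; simpl; unfold Rminus in Ha, Hb; lra.
Qed.

Lemma clim_bound (P : nat -> C) (L : C) (n : nat) (B : R) :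
  clim P L -> (forall k, Cmod (P (n + k)%nat - P n) <= B) -> Cmod (L - P n) <= B.
Proof.
  intros HL HB; apply Rnot_lt_le; intros Hc.
  destruct (HL ((Cmod (L - P n) - B) / 2) ltac:(lra)) as [n0 H0].
  specialize (H0 (n + n0)%nat ltac:(lia)); assert (H1 := HB n0).
  assert (H2 := Cmod_minus_le (P (n + n0)%nat - P n) (P (n + n0)%nat - L)).
  replace (P (n + n0)%nat - P n - (P (n + n0)%nat - L))%C with (L - P n)%C in H2 by ring; lra.
Qed.

Lemma Rpower_small (d : R) : 0 < d ->
  forall eps, 0 < eps -> exists n0, forall n, (n0 <= n)%nat -> Rpower (INR (S n)) (- d) <= eps.
Proof.
  intros Hd eps He.
  (* The threshold is [eps^(-1/d)]. *)
  destruct (nfloor_ex (exp (- ln eps / d)) ltac:(left; apply exp_pos)) as [n0 [_ Hn0]].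
  exists n0; intros n Hn.
  assert (Hle : exp (- ln eps / d) <= INR (S n)).
  { rewrite <- S_INR in Hn0; apply Rle_trans with (INR (S n0)); [lra|apply le_INR; lia]. }
  assert (Hln : - ln eps / d <= ln (INR (S n))).
  { rewrite <- (ln_exp (- ln eps / d)); apply ln_le; [apply exp_pos|exact Hle]. }
  unfold Rpower; rewrite <- (exp_ln eps He); apply exp_le_mono.
  apply Rle_div_l in Hln; [lra|exact Hd].
Qed.

Lemma Rpower_exponent_mono (x p q : R) : 1 <= x -> p <= q -> Rpower x p <= Rpower x q.
Proof.
  intros Hx Hp; unfold Rpower; apply exp_le_mono, Rmult_le_compat_r; [|exact Hp].
  rewrite <- ln_1; apply ln_le; lra.
Qed.

Lemma INR_S_ge_1 (n : nat) : 1 <= INR (S n).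
Proof. apply (le_INR 1); lia. Qed.

(** Total by choice, hence arbitrary where the sequence diverges; [reg_box_lim_spec] identifies it
    off the poles in the half-plane. *)
Definition reg_box_lim (r : nat) (a : R) (w : nat -> R) (z : C) : C :=
  epsilon (inhabits (RtoC 0)) (clim (fun n => reg_box r a w n z)).

Section Continuation.

Context (r : nat) (a : R) (w : nat -> R).
Hypothesis (Hr : (1 <= r)%nat) (Ha : 0 < a) (Hw : forall i, (i < r)%nat -> 0 < w i).

Lemma reg_box_lim_spec (z : C) :
  INR r - 1 < Re z -> off_poles r z -> clim (fun n => reg_box r a w n z) (reg_box_lim r a w z).
Proof.
  intros Hre Hz; unfold reg_box_lim; apply epsilon_spec, clim_cauchy.
  set (dlt := Re z - (INR r - 1)).
  assert (Hd : 0 < dlt) by (unfold dlt; lra).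
  assert (HPI := PI2_1).
  (* For a fixed [z], [|Im z|] is eventually below [th n] for any positive [th]; 1 is a convenient
     value below [2 pi]. *)
  destruct (reg_box_cauchy r a 1 dlt (Re z) w Hr Ha Hw ltac:(lra) Hd) as [K [HK H]].
  intros eps He.
  destruct (Rpower_small dlt Hd (eps / K) ltac:(now apply Rdiv_lt_0_compat)) as [n1 Hn1].
  destruct (nfloor_ex (Rabs (Im z)) (Rabs_pos _)) as [n2 [_ Hn2]].
  exists (max n1 n2); intros n k Hn.
  eapply Rle_trans; [apply H|].
  - unfold dlt; lra.
  - exact Hz.
  - rewrite <- S_INR in Hn2; rewrite Rmult_1_l; apply Rle_trans with (INR (S n2)); [lra|apply le_INR; lia].
  - replace (INR r - 1 - Re z) with (- dlt) by (unfold dlt; ring).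
    assert (H1 := Hn1 n ltac:(lia)).
    apply Rle_trans with (K * (eps / K)); [apply Rmult_le_compat_l; lra|right; field; lra].
Qed.

Lemma reg_box_lim_bound (th dlt s1 : R) :
  0 < th < 2 * PI -> 0 < dlt ->
  exists K, 0 < K /\ forall (n : nat) (z : C),
    INR r - 1 + dlt <= Re z <= s1 -> off_poles r z -> Rabs (Im z) <= th * INR (S n) ->
    Cmod (reg_box_lim r a w z - reg_box r a w n z)
      <= K * Rpower (INR (S n)) (INR r - 1 - Re z).
Proof.
  intros Hth Hd.
  destruct (reg_box_cauchy r a th dlt s1 w Hr Ha Hw Hth Hd) as [K [HK H]].
  exists K; split; [exact HK|]; intros n z Hre Hz Ht.
  apply (clim_bound (fun m => reg_box r a w m z)); [apply reg_box_lim_spec; [lra|exact Hz]|].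
  intros k; now apply H.
Qed.

Lemma reg_box_lim_uniform (x0 s1 Y : R) :
  INR r - 1 < x0 -> forall eps, 0 < eps -> exists n, forall z,
    x0 <= Re z <= s1 -> Rabs (Im z) <= Y -> off_poles r z ->
    Cmod (reg_box_lim r a w z - reg_box r a w n z) <= eps.
Proof.
  intros Hx0 eps He; assert (HPI := PI2_1).
  set (dlt := x0 - (INR r - 1)); assert (Hd : 0 < dlt) by (unfold dlt; lra).
  destruct (reg_box_lim_bound 1 dlt s1 ltac:(lra) Hd) as [K [HK H]].
  destruct (Rpower_small dlt Hd (eps / K) ltac:(now apply Rdiv_lt_0_compat)) as [n1 Hn1].
  destruct (nfloor_ex (Rmax 0 Y) (Rmax_l _ _)) as [n2 [_ Hn2]].
  exists (max n1 n2); intros z Hz Him Hoff.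
  eapply Rle_trans; [apply H|].
  - unfold dlt; lra.
  - exact Hoff.
  - assert (HY := Rmax_r 0 Y); rewrite <- S_INR in Hn2; rewrite Rmult_1_l.
    apply Rle_trans with (INR (S n2)); [lra|apply le_INR; lia].
  - assert (H1 := Hn1 (max n1 n2) ltac:(lia)).
    apply Rle_trans with (K * (eps / K)); [|right; field; lra].
    apply Rmult_le_compat_l; [lra|]; apply Rle_trans with (2 := H1).
    apply Rpower_exponent_mono; [apply INR_S_ge_1|unfold dlt; lra].
Qed.

(** Each nonempty subset gives a base of at least [w0 * x], raised to an exponent of negative real
    part [r - Re s]. *)
Lemma corr_term_vanishes (s : C) :
  INR r < Re s -> off_poles r s -> clim (fun n => corr_term r a w (INR (S n)) s) 0.
Proof.
  intros Hre Hs eps He.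
  destruct (positive_bounds w r Hw) as [w0 [w1 [Hw0 [Hw1 Hwb]]]].
  assert (Hp := poch_neq_0 r s Hs); assert (Hwp := wprod_pos w r Hw).
  assert (Hq : (poch r s * RtoC (wprod w r))%C <> 0)
    by (apply Cmult_neq_0; [exact Hp|apply RtoC_neq_0; lra]).
  set (q := Cmod (poch r s * RtoC (wprod w r))).
  assert (Hq0 : 0 < q) by now apply Cmod_gt_0.
  set (d := Re s - INR r); assert (Hd : 0 < d) by (unfold d; lra).
  set (c := Rpower w0 (- d)); assert (Hc : 0 < c) by apply Rpower_pos.
  assert (H2 : 0 < 2 ^ r) by (apply pow_lt; lra).
  destruct (Rpower_small d Hd (eps * q / (2 ^ r * c))) as [n0 Hn0].
  { apply Rdiv_lt_0_compat; nra. }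
  exists n0; intros n Hn; replace (corr_term r a w (INR (S n)) s - 0)%C with (corr_term r a w (INR (S n)) s) by ring.
  assert (Hn1 := INR_S_ge_1 n); set (x := INR (S n)) in *.
  apply Rle_trans with (2 ^ r * (c * Rpower x (- d) / q)).
  - unfold corr_term; apply (subset_sum_bound w r w0 w1); [lra|exact Hwb|].
    intros [|k] u Hu.
    + rewrite Cmod_0; apply Rmult_le_pos; [|left; now apply Rinv_0_lt_compat].
      apply Rmult_le_pos; [lra|left; apply Rpower_pos].
    + destruct Hu as [[Hu _]|Hu]; [discriminate|].
      rewrite Cmod_div by exact Hq; fold q; apply Rmult_le_compat_r; [left; now apply Rinv_0_lt_compat|].
      rewrite Cmod_mult, Cmod_R, pow_1_abs, Rmult_1_l, Cmod_cpow.
      replace (Re (INR r - s)) with (- d)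
        by (unfold Cminus, d; rewrite re_plus, re_opp; simpl; unfold Re; ring).
      apply Rle_trans with (Rpower (w0 * x) (- d)); [apply Rpower_decr; nra|].
      apply Rpower_mult_l; lra.
  - assert (H3 := Hn0 n Hn); fold x in H3.
    apply Rle_trans with (2 ^ r * (c * (eps * q / (2 ^ r * c)) / q)).
    + apply Rmult_le_compat_l; [lra|]; apply Rmult_le_compat_r; [left; now apply Rinv_0_lt_compat|].
      apply Rmult_le_compat_l; lra.
    + right; field; repeat split; lra.
Qed.

Context (zeta : C -> C).
Hypothesis Hzeta : is_barnes_zeta_cont r a w zeta.

Lemma off_poles_right (z : C) : INR r < Re z -> off_poles r z.
Proof.
  intros H j Hj ->; simpl in H; assert (INR j <= INR r) by (apply le_INR; lia).
  unfold Re in H; simpl in H; lra.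
Qed.

Lemma off_poles_nonreal (z : C) : Im z <> 0 -> off_poles r z.
Proof. intros H j Hj ->; apply H; reflexivity. Qed.

Lemma zeta_eq_lim_right (z : C) : INR r < Re z -> zeta z = reg_box_lim r a w z.
Proof.
  intros Hre; assert (Hoff := off_poles_right z Hre).
  apply (clim_unique (fun n => reg_box r a w n z)); [|apply reg_box_lim_spec; [lra|exact Hoff]].
  assert (Hbox : clim (fun n => barnes_box r a w z n) (zeta z)).
  { intros eps He.
    assert (He2 : 0 < eps / 2) by lra.
    destruct (proj2 Hzeta z Hre (fun y => Cmod (y - zeta z) <= eps)) as [n0 Hn0].
    - exists (mkposreal _ He2); intros y [Hy1 Hy2].
      change (Rabs (fst y - fst (zeta z)) < eps / 2) in Hy1.
      change (Rabs (snd y - snd (zeta z)) < eps / 2) in Hy2.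
      eapply Rle_trans; [apply Cmod_le_Re_Im|].
      unfold Cminus; rewrite re_plus, im_plus, re_opp, im_opp; unfold Re, Im, Rminus in *; lra.
    - exists n0; exact Hn0. }
  intros eps He.
  destruct (Hbox (eps / 2) ltac:(lra)) as [n1 H1].
  destruct (corr_term_vanishes z Hre Hoff (eps / 2) ltac:(lra)) as [n2 H2].
  exists (max n1 n2); intros n Hn; specialize (H1 n ltac:(lia)); specialize (H2 n ltac:(lia)).
  unfold reg_box.
  replace (barnes_box r a w z n - corr_term r a w (INR (S n)) z - zeta z)%C
    with ((barnes_box r a w z n - zeta z) - (corr_term r a w (INR (S n)) z - 0))%C by ring.
  eapply Rle_trans; [apply Cmod_minus_le|]; lra.
Qed.

Lemma cdiff_zeta (z : C) : INR r - 1 < Re z -> off_poles r z -> cdiff zeta z.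
Proof. intros Hre Hz; apply ex_derive_cdiff, (proj1 Hzeta); assumption. Qed.

Lemma zeta_eq_lim_nonreal (z : C) :
  INR r - 1 < Re z -> Im z <> 0 -> zeta z = reg_box_lim r a w z.
Proof.
  intros Hre Him; destruct (Rlt_le_dec (INR r) (Re z)) as [H|H]; [now apply zeta_eq_lim_right|].
  destruct z as [x0 y0]; simpl in Hre, Him, H.
  unfold Re in Hre, H; unfold Im in Him; simpl in Hre, Him, H.
  (* Half-height [|y0| / 2] keeps the rectangle off the real axis and so off the poles; its right
     side, at [r + 1], lies where the identity is already known. *)
  set (eta := Rabs y0 / 2).
  assert (Habs : 0 < Rabs y0) by now apply Rabs_pos_lt.
  assert (Hy : forall y, y0 - eta <= y <= y0 + eta -> y <> 0).
  { intros y Hy ->; revert Hy; unfold eta, Rabs; destruct (Rcase_abs y0); lra. }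
  apply Ceq_minus.
  apply (rect_unique (fun s => zeta s - reg_box_lim r a w s)%C x0 (INR r + 1) y0 eta); [lra|unfold eta; lra| |].
  - intros eps He.
    destruct (reg_box_lim_uniform x0 (INR r + 1) (Rabs y0 + eta) Hre eps He) as [n Hn].
    exists (fun s => zeta s - reg_box r a w n s)%C; split; intros x y Hx Hy'.
    + apply cdiff_minus; [apply cdiff_zeta|apply cdiff_reg_box; [exact Hw|]].
      * simpl; unfold Re; simpl; lra.
      * apply off_poles_nonreal, Hy; exact Hy'.
      * apply off_poles_nonreal, Hy; exact Hy'.
    + replace (zeta (x, y) - reg_box r a w n (x, y) - (zeta (x, y) - reg_box_lim r a w (x, y)))%C
        with (reg_box_lim r a w (x, y) - reg_box r a w n (x, y))%C by ring.
      apply Hn; [exact Hx| |apply off_poles_nonreal, Hy; exact Hy'].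
      unfold Im; simpl; revert Hy'; unfold eta, Rabs; destruct (Rcase_abs y0), (Rcase_abs y); lra.
  - intros y Hy'; apply (proj1 (Ceq_minus _ _)), zeta_eq_lim_right; unfold Re; simpl; lra.
Qed.

(** A real [z] is approached by nonreal points [z'] with the same real part. Continuity is used for
    [zeta] minus one fixed corrected box sum, uniformly close to [zeta] minus the limit; the three
    errors of [c / 8] cannot add up to [c]. *)
Lemma zeta_eq_lim (z : C) :
  INR r - 1 < Re z -> off_poles r z -> zeta z = reg_box_lim r a w z.
Proof.
  intros Hre Hoff; destruct (Req_dec (Im z) 0) as [Him|Him]; [|now apply zeta_eq_lim_nonreal].
  destruct (Rlt_le_dec (INR r) (Re z)) as [H|H]; [now apply zeta_eq_lim_right|].
  set (h := fun s => (zeta s - reg_box_lim r a w s)%C).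
  apply Ceq_minus; fold (h z); apply Cmod_eq_0, Rle_antisym; [|apply Cmod_ge_0].
  apply Rnot_lt_le; intros Hc; set (c := Cmod (h z)) in *.
  destruct (reg_box_lim_uniform (Re z) (INR r + 1) 1 Hre (c / 8) ltac:(lra)) as [n Hn].
  set (g := fun s => (zeta s - reg_box r a w n s)%C).
  assert (Hg : ccont g z).
  { apply cdiff_ccont, cdiff_minus; [now apply cdiff_zeta|now apply cdiff_reg_box]. }
  destruct (Hg (c / 8) ltac:(lra)) as [d [Hd Hd']].
  assert (Hgh : forall s, Re z <= Re s <= INR r + 1 -> Rabs (Im s) <= 1 -> off_poles r s ->
     Cmod (g s - h s) <= c / 8).
  { intros s H1 H2 H3; unfold g, h.
    replace (zeta s - reg_box r a w n s - (zeta s - reg_box_lim r a w s))%C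
      with (reg_box_lim r a w s - reg_box r a w n s)%C by ring.
    now apply Hn. }
  set (t := Rmin d 1 / 2).
  assert (Ht : 0 < Rmin d 1) by (apply Rmin_glb_lt; lra).
  assert (Ht1 := Rmin_l d 1); assert (Ht2 := Rmin_r d 1).
  set (z' := (Re z, t) : C).
  assert (Hz' : h z' = 0).
  { apply (proj1 (Ceq_minus _ _)), zeta_eq_lim_nonreal; unfold z', Re, Im, t; simpl; [exact Hre|lra]. }
  assert (H1 : Cmod (g z - h z) <= c / 8) by (apply Hgh; [lra|rewrite Him, Rabs_R0; lra|exact Hoff]).
  assert (H2 : Cmod (g z' - h z') <= c / 8).
  { apply Hgh; unfold z'.
    - unfold Re; simpl; unfold Re in H; lra.
    - unfold Im; simpl; unfold t; rewrite Rabs_right; lra.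
    - apply off_poles_nonreal; unfold Im, t; simpl; lra. }
  assert (H3 : Cmod (g z' - g z) < c / 8).
  { apply Hd'; eapply Rle_lt_trans; [apply Cmod_le_Re_Im|].
    unfold Cminus; rewrite re_plus, im_plus, re_opp, im_opp, Him; unfold z'.
    replace (Re (Re z, t) + - Re z) with 0 by (unfold Re; simpl; ring).
    replace (Im (Re z, t) + - 0) with t by (unfold Im; simpl; ring).
    rewrite Rabs_R0, Rabs_right; unfold t; lra. }
  assert (H4 : c <= Cmod (g z - h z) + (Cmod (g z' - g z) + Cmod (g z' - h z'))).
  { unfold c; rewrite (Cmod_minus_sym (g z) (h z)), (Cmod_minus_sym (g z') (g z)).
    replace (h z) with ((h z - g z) + ((g z - g z') + (g z' - h z')))%C at 1 by (rewrite Hz'; ring).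
    eapply Rle_trans; [apply Cmod_triangle|]; apply Rplus_le_compat_l, Cmod_triangle. }
  lra.
Qed.

End Continuation.

(** * Real cutoffs and the final estimate *)

Lemma poch_lower (q : nat) (s : C) (dlt : R) :
  0 < dlt -> INR q + dlt <= Re s -> dlt ^ q <= Cmod (poch q s).
Proof.
  intros Hd; induction q as [|q IH]; intros Hre; simpl pow.
  - simpl; rewrite Cmod_1; lra.
  - rewrite S_INR in Hre.
    change (poch (S q) s) with (poch q s * (s - RtoC (INR (S q))))%C; rewrite Cmod_mult, Rmult_comm.
    apply Rmult_le_compat; [apply pow_le; lra|lra|apply IH; lra|].
    eapply Rle_trans with (2 := Cmod_sub_real_ge s (INR (S q))); rewrite S_INR; lra.
Qed.

Lemma cpow_base_variation (b c : R) (z : C) :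
  0 < b <= c -> Re z <= 1 ->
  Cmod (cpow c z - cpow b z) <= Cmod z * (c - b) * Rpower b (Re z - 1).
Proof.
  intros Hb Hz.
  set (g := fun v => cpow (b + v * (c - b)) z).
  replace (cpow c z - cpow b z)%C with (g 1 - g 0)%C
    by (unfold g; f_equal; [f_equal; ring|f_equal; f_equal; ring]).
  apply (curve_mvt g (fun v => z * RtoC (c - b) * cpow (b + v * (c - b)) (z - 1))%C).
  - intros v Hv; apply cder_cpow; nra.
  - intros v Hv; rewrite !Cmod_mult, Cmod_R, Cmod_cpow, (Rabs_right (c - b)) by lra.
    apply Rmult_le_compat_l; [apply Rmult_le_pos; [apply Cmod_ge_0|lra]|].
    unfold Cminus; rewrite re_plus, re_opp; replace (Re z + - Re 1) with (Re z - 1) by (unfold Re; simpl; ring).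
    apply Rpower_decr; nra.
Qed.

(** Varying the base of [b^(r-s)] brings out a factor [r - s], which cancels [s - r] in the
    denominator, the one factor that is not bounded below in the strip. Hence the bound is uniform
    near [s = r], and it gains the power of [x] that a single correction term lacks. *)
Lemma corr_term_variation (r : nat) (a dlt s1 : R) (w : nat -> R) :
  (1 <= r)%nat -> 0 < a -> (forall i, (i < r)%nat -> 0 < w i) -> 0 < dlt ->
  exists K, forall (x y : R) (s : C), 1 <= x -> x <= y <= x + 1 ->
    INR r - 1 + dlt <= Re s <= s1 -> off_poles r s ->
    Cmod (corr_term r a w x s - corr_term r a w y s) <= K * Rpower x (INR r - 1 - Re s).
Proof.
  intros Hr Ha Hw Hd.
  destruct (positive_bounds w r Hw) as [w0 [w1 [Hw0 [Hw1 Hwb]]]].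
  destruct r as [|q]; [lia|].
  assert (Hwp := wprod_pos w (S q) Hw).
  set (c := Rpower w0 (INR q - s1)); assert (Hc : 0 < c) by apply Rpower_pos.
  set (U := INR (S q) * w1).
  assert (HU : 0 <= U) by (apply Rmult_le_pos; [apply pos_INR|exact Hw1]).
  assert (Hdq : 0 < dlt ^ q) by now apply pow_lt.
  exists (2 ^ S q * (U * c / (dlt ^ q * wprod w (S q)))); intros x y s Hx Hy Hre Hs.
  replace (INR (S q) - 1) with (INR q) in * by (rewrite S_INR; ring).
  assert (Hp := poch_neq_0 (S q) s Hs).
  assert (Hm : 0 < Cmod (s - RtoC (INR (S q)))).
  { apply Cmod_gt_0, Cminus_eq_contra, Hs; lia. }
  assert (Hpl := poch_lower q s dlt Hd ltac:(lra)).
  set (m := Cmod (s - RtoC (INR (S q)))) in *.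
  set (P := Rpower x (INR q - Re s)); assert (HP : 0 < P) by apply Rpower_pos.
  assert (Hden : (poch (S q) s * RtoC (wprod w (S q)))%C <> 0)
    by (apply Cmult_neq_0; [exact Hp|apply RtoC_neq_0; lra]).
  assert (Hdenm : Cmod (poch (S q) s * RtoC (wprod w (S q))) = Cmod (poch q s) * m * wprod w (S q)).
  { rewrite Cmod_mult, Cmod_R, Rabs_right by lra.
    change (poch (S q) s) with (poch q s * (s - RtoC (INR (S q))))%C; now rewrite Cmod_mult. }
  rewrite (Rmult_assoc (2 ^ S q)).
  unfold corr_term; rewrite <- subset_sum_minus.
  apply (subset_sum_bound w (S q) w0 w1); [lra|exact Hwb|].
  assert (Hpos : 0 <= U * c / (dlt ^ q * wprod w (S q)) * P).
  { apply Rmult_le_pos; [|lra]; apply Rmult_le_pos; [nra|left; apply Rinv_0_lt_compat; nra]. }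
  intros [|k] u Hu.
  - rewrite Cmod_minus_diag; exact Hpos.
  - destruct Hu as [[Hu _]|Hu]; [discriminate|]; fold U in Hu.
    set (D := (poch (S q) s * RtoC (wprod w (S q)))%C) in *.
    set (A := cpow (a + x * u) (INR (S q) - s)); set (B := cpow (a + y * u) (INR (S q) - s)).
    replace (RtoC ((-1) ^ S k) * A / D - RtoC ((-1) ^ S k) * B / D)%C
      with (RtoC ((-1) ^ S k) * ((A - B) / D))%C by (unfold Cdiv; ring).
    rewrite Cmod_mult, Cmod_R, pow_1_abs, Rmult_1_l, Cmod_div, Hdenm by exact Hden.
    assert (HAB : Cmod (A - B) <= m * (U * (c * P))).
    { rewrite Cmod_minus_sym; unfold A, B.
      assert (Hxu : x * u <= y * u) by (apply Rmult_le_compat_r; lra).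
      assert (Hxu0 : w0 * x <= x * u) by nra.
      assert (Hw0x : 0 < w0 * x) by nra.
      assert (Hrez : Re (INR (S q) - s) = INR q + 1 - Re s).
      { unfold Cminus; rewrite re_plus, re_opp, <- S_INR; reflexivity. }
      eapply Rle_trans; [apply cpow_base_variation; [lra|rewrite Hrez; lra]|].
      rewrite Hrez, (Cmod_minus_sym _ s); fold m.
      replace (a + y * u - (a + x * u)) with ((y - x) * u) by ring.
      replace (INR q + 1 - Re s - 1) with (INR q - Re s) by ring.
      rewrite Rmult_assoc; apply Rmult_le_compat_l; [lra|].
      apply Rmult_le_compat; [nra|left; apply Rpower_pos|nra|].
      eapply Rle_trans; [apply (Rpower_decr (w0 * x)); lra|].
      apply Rpower_mult_l; lra. }
    apply Rle_div_l; [apply Rmult_lt_0_compat; [nra|lra]|].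
    apply Rle_trans with (1 := HAB).
    replace (U * c / (dlt ^ q * wprod w (S q)) * P * (Cmod (poch q s) * m * wprod w (S q)))
      with (m * (U * (c * P)) * (Cmod (poch q s) / dlt ^ q)) by (field; lra).
    rewrite <- (Rmult_1_r (m * (U * (c * P)))) at 1; apply Rmult_le_compat_l.
    + apply Rmult_le_pos; [lra|]; apply Rmult_le_pos; nra.
    + apply Rle_div_r; lra.
Qed.

Lemma floor_nat_spec (x : R) : 1 <= x -> INR (floor_nat x) <= x < INR (floor_nat x) + 1.
Proof.
  intros Hx; destruct (base_Int_part x) as [H1 H2]; unfold floor_nat.
  assert (H : (0 <= Int_part x)%Z).
  { apply le_IZR; assert (IZR (-1) < IZR (Int_part x)) by lra.
    apply lt_IZR in H; apply IZR_le; lia. }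
  rewrite INR_IZR_INZ, Z2Nat.id by exact H; lra.
Qed.

Theorem theorem2 (r : nat) (a : R) (w : nat -> R) (sigma1 sigma2 Cst : R)
  (zeta : C -> C) :
  (1 <= r)%nat ->
  0 < a ->
  (forall i : nat, (i < r)%nat -> 0 < w i) ->
  INR r - 1 < sigma1 -> sigma1 < sigma2 -> 1 < Cst ->
  is_barnes_zeta_cont r a w zeta ->
  exists K : R, forall (x : R) (s : C),
    1 <= x ->
    sigma1 < Re s < sigma2 ->
    Rabs (Im s) <= 2 * PI * x / Cst ->
    (forall k : nat, (1 <= k <= r)%nat -> s <> RtoC (INR k)) ->
    Cmod (Cplus (Cminus (zeta s) (barnes_box r a w s (floor_nat x))) (corr_term r a w x s))
      <= K * Rpower x (INR r - 1 - Re s).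
Proof.
  intros Hr Ha Hw Hs1 Hs12 HC Hzeta.
  set (dlt := sigma1 - (INR r - 1)); assert (Hd : 0 < dlt) by (unfold dlt; lra).
  assert (HPI := PI_RGT_0).
  assert (Hth : 0 < 2 * PI / Cst < 2 * PI).
  { split; [apply Rdiv_lt_0_compat; lra|]; apply Rlt_div_l; nra. }
  (* [Cst > 1] is what makes the frequency bound [2 pi / Cst] smaller than [2 pi]. *)
  destruct (reg_box_lim_bound r a w Hr Ha Hw (2 * PI / Cst) dlt sigma2 Hth Hd) as [K1 [HK1 H1]].
  destruct (corr_term_variation r a dlt sigma2 w Hr Ha Hw Hd) as [K2 H2].
  exists (K1 + K2); intros x s Hx Hre Him Hs.
  assert (Hfl := floor_nat_spec x Hx); set (n := floor_nat x) in *; rewrite <- S_INR in Hfl.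
  assert (HnS := S_INR n).
  rewrite (zeta_eq_lim r a w Hr Ha Hw zeta Hzeta s) by (exact Hs || lra).
  (* The box sum over [m_i <= n] pairs with the correction at [n + 1]. As [x < n + 1 <= x + 1], the
     bound on [|Im s|] passes to [n + 1], negative powers of [n + 1] are at most those of [x], and
     moving the correction from [n + 1] to [x] is an admissible error. *)
  replace (reg_box_lim r a w s - barnes_box r a w s n + corr_term r a w x s)%C
    with ((reg_box_lim r a w s - reg_box r a w n s)
          + (corr_term r a w x s - corr_term r a w (INR (S n)) s))%C by (unfold reg_box; ring).
  eapply Rle_trans; [apply Cmod_triangle|]; rewrite Rmult_plus_distr_r.
  apply Rplus_le_compat.
  - eapply Rle_trans; [apply H1|].
    + unfold dlt; lra.
    + exact Hs.
    + apply Rle_trans with (1 := Him).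
      replace (2 * PI * x / Cst) with (2 * PI / Cst * x) by (field; lra).
      apply Rmult_le_compat_l; lra.
    + apply Rmult_le_compat_l; [lra|]; apply Rpower_decr; lra.
  - apply H2; [exact Hx|lra|unfold dlt; lra|exact Hs].
Qed.
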